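(* Let $\mathfrak g$ be a real finite-dimensional semisimple Lie algebra with corresponding $1$-connected Lie group $G$, and let $\mathcal O\subset\mathfrak g^{*}$ be an orbit of the coadjoint representation of $G$. Let $P(\mathcal O)$ be the Poisson algebra of polynomial functions on $\mathcal O$, regarded as a Lie algebra under its Poisson bracket. Then the Lie algebra $P(\mathcal O)$ is essentially simple if and only if the orbit $\mathcal O$ is semisimple.
   Context: The symmetric algebra $S(\mathfrak g)$ is identified with the algebra of polynomial functions on $\mathfrak g^{*}$. It is a Poisson algebra: its bracket $\{\,,\}$ is determined by $\{\xi,\eta\}=[\xi,\eta]$ for $\xi,\eta\in\mathfrak g$ and extended to all of $S(\mathfrak g)$ by the Leibniz rule. For a coadjoint orbit $\mathcal O$, $I(\mathcal O)\subset S(\mathfrak g)$ denotes the ideal of polynomials vanishing on $\mathcal O$; it is a Poisson ideal (both an associative ideal and a Lie ideal). $P(\mathcal O)$ is the algebra of restrictions to $\mathcal O$ of polynomials on $\mathfrak g^*$, identified with $S(\mathfrak g)/I(\mathcal O)$, with the induced Poisson bracket. A Lie algebra $L$ is called essentially simple if every Lie ideal of $L$ is either contained in the center $Z(L)$ of $L$ or contains the derived ideal $L'=[L,L]$ (the linear span of all brackets). A coadjoint orbit $\mathcal O$ is semisimple (standard notion) if its points correspond, under the identification $\mathfrak g^*\cong\mathfrak g$ given by the Killing form, to semisimple elements of $\mathfrak g$, i.e. elements $x$ for which $\mathrm{ad}_x$ is diagonalizable over $\mathbb C$. *)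

(* Defs.v *)
From HB Require Import structures.
From mathcomp Require Import all_boot all_order all_algebra.
From mathcomp Require Import all_classical all_reals all_analysis.
From mathcomp Require Import ring complex.
(* The notations of mpoly clash with those of mathcomp-analysis. *)
From mathcomp Require Import -(notations) mpoly.

Set Implicit Arguments.
Unset Strict Implicit.
Unset Printing Implicit Defensive.

Import Order.TTheory GRing.Theory Num.Theory.
Import numFieldNormedType.Exports.

Local Open Scope classical_set_scope.
Local Open Scope ring_scope.

Section LieAlgebra.
Variables (K : fieldType) (L : lmodType K) (br : L -> L -> L).

Record is_lie_bracket : Prop := IsLieBracket {
  lie_linearl : forall y a x x', br (a *: x + x') y = a *: br x y + br x' y ;
  lie_linearr : forall x a y y', br x (a *: y + y') = a *: br x y + br x y' ;
  lie_alternating : forall x, br x x = 0 ;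
  lie_jacobi : forall x y z, br x (br y z) + br y (br z x) + br z (br x y) = 0
}.

Definition subspace (W : set L) : Prop :=
  W 0 /\ forall a u v, W u -> W v -> W (a *: u + v).

Definition linear_span (A : set L) : set L :=
  \bigcap_(W in [set W | subspace W /\ A `<=` W]) W.

Definition lie_ideal (I : set L) : Prop :=
  subspace I /\ forall x y, I y -> I (br x y).

Definition bracket_span (A B : set L) : set L :=
  linear_span [set br x y | x in A & y in B].

Definition lie_center : set L := [set x | forall y, br x y = 0].

Definition lie_derived : set L := bracket_span setT setT.

Definition essentially_simple : Prop :=
  forall I, lie_ideal I -> I `<=` lie_center \/ lie_derived `<=` I.

Definition lie_solvable (I : set L) : Prop :=
  exists k, iter k (fun W => bracket_span W W) I `<=` [set 0].

Definition lie_semisimple : Prop :=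
  forall I, lie_ideal I -> lie_solvable I -> I `<=` [set 0].

End LieAlgebra.

Section Killing.
Variables (R : realType) (g : vectType R) (br : g -> g -> g).

Definition ad_mx (x : g) : 'M[R]_(\dim {:g}) :=
  passmx.mxof (vbasis {:g}) (vbasis {:g}) (linfun (br x)).

Definition killing (x y : g) : R := \tr (ad_mx x *m ad_mx y).

Definition ad_semisimple (x : g) : Prop :=
  diagonalizable (map_mx (real_complex R) (ad_mx x)).

End Killing.

(* Continuous k-fold differentiability on an open set U; only the values of   *)
(* f on U matter.                                                             *)
Fixpoint differentiable_upto (R : realType) (V W : normedModType R) (k : nat)
    (U : set V) (f : V -> W) : Prop :=
  match k with
  | 0 => forall x, U x -> {for x, continuous f}
  | k'.+1 => (forall x, U x -> differentiable f x) /\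
             (forall v, differentiable_upto k' U (fun x => 'D_v f x))
  end.

Definition smooth_on (R : realType) (V W : normedModType R)
    (U : set V) (f : V -> W) : Prop :=
  open U /\ forall k, differentiable_upto k U f.

HB.mixin Record isTopGroup G of Topological G & Group G := {
  mulg_continuous : continuous (fun p : G * G => (p.1 * p.2)%g) ;
  invg_continuous : continuous (fun x : G => (x^-1)%g)
}.

#[short(type="topGroupType")]
HB.structure Definition TopGroup := {G of Topological G & Group G & isTopGroup G}.

Record chart (R : realType) (n : nat) (T : topologicalType) := Chart {
  chart_dom : set T ;
  chart_to : T -> 'rV[R]_n ;
  chart_from : 'rV[R]_n -> T ;
  chart_dom_open : open chart_dom ;
  chart_cod_open : open (chart_to @` chart_dom) ;
  chart_toK : forall x, chart_dom x -> chart_from (chart_to x) = x ;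
  chart_to_continuous : {within chart_dom, continuous chart_to} ;
  chart_from_continuous :
    {within chart_to @` chart_dom, continuous chart_from}
}.

Definition chart_cod (R : realType) (n : nat) (T : topologicalType)
  (c : chart R n T) : set 'rV[R]_n := chart_to c @` chart_dom c.

HB.mixin Record isLieGroup (R : realType) (n : nat) G of TopGroup G := {
  lie_atlas : set (chart R n G) ;
  lie_hausdorff : hausdorff_space G ;
  lie_second_countable : @second_countable G ;
  lie_atlas_cover : forall x : G, exists2 c, lie_atlas c & chart_dom c x ;
  lie_atlas_compatible : forall c d, lie_atlas c -> lie_atlas d ->
    smooth_on (chart_to c @` (chart_dom c `&` chart_dom d))
              (chart_to d \o chart_from c) ;
  lie_mul_smooth : forall a b c, lie_atlas a -> lie_atlas b -> lie_atlas c ->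
    smooth_on
      [set p : 'rV[R]_n * 'rV[R]_n | [/\ chart_cod a p.1, chart_cod b p.2 &
         chart_dom c (chart_from a p.1 * chart_from b p.2)%g]]
      (fun p => chart_to c (chart_from a p.1 * chart_from b p.2)%g) ;
  lie_inv_smooth : forall a c, lie_atlas a -> lie_atlas c ->
    smooth_on
      [set u | chart_cod a u /\ chart_dom c (chart_from a u)^-1%g]
      (fun u => chart_to c (chart_from a u)^-1%g)
}.

#[short(type="lieGroupType")]
HB.structure Definition LieGroup (R : realType) (n : nat) :=
  {G of TopGroup G & isLieGroup R n G}.

Section AdjointInChart.
Variables (R : realType) (n : nat) (G : lieGroupType R n) (c : chart R n G).

(* The differential at 1 of the conjugation y |-> x y x^-1, where the tangent *)
(* space at 1 is identified with R^n by means of a chart c around 1.          *)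
Definition Ad_chart (x : G) (v : 'rV[R]_n) : 'rV[R]_n :=
  'D_v (fun u => chart_to c (x * chart_from c u * x^-1)%g) (chart_to c 1%g).

(* The bracket [v, w] = ad(v)(w) of the Lie algebra of G, where ad is the     *)
(* differential at 1 of Ad.                                                   *)
Definition bracket_chart (v w : 'rV[R]_n) : 'rV[R]_n :=
  'D_v (fun u => Ad_chart (chart_from c u) w) (chart_to c 1%g).

End AdjointInChart.

(* An identification of (g, br) with the Lie algebra T_1 G of G, the latter   *)
(* being read in some chart around 1.                                         *)
Record lie_algebra_of (R : realType) (g : vectType R) (br : g -> g -> g)
    (G : lieGroupType R (\dim {:g})) := LieAlgebraOf {
  la_chart : chart R (\dim {:g}) G ;
  la_to : {linear g -> 'rV[R]_(\dim {:g})} ;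
  la_from : 'rV[R]_(\dim {:g}) -> g ;
  la_chart_atlas : lie_atlas la_chart ;
  la_chart1 : chart_dom la_chart 1%g ;
  la_toK : cancel la_to la_from ;
  la_fromK : cancel la_from la_to ;
  la_bracket : forall x y,
    la_to (br x y) = bracket_chart la_chart (la_to x) (la_to y)
}.

(* Simply connected: connected, with every loop contractible. *)
Definition one_connected (R : realType) (T : topologicalType) : Prop :=
  connected [set: T] /\
  forall gamma : R -> T,
    {within `[0, 1], continuous gamma} -> gamma 0 = gamma 1 ->
    exists H : R * R -> T,
      [/\ {within `[0, 1] `*` `[0, 1], continuous H},
          forall s, s \in `[0, 1] -> H (s, 0) = gamma s,
          forall s, s \in `[0, 1] -> H (s, 1) = gamma 0 &
          forall t, t \in `[0, 1] ->
            H (0, t) = gamma 0 /\ H (1, t) = gamma 0].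


Section Coadjoint.
Variables (R : realType) (g : vectType R) (br : g -> g -> g).
Variables (G : lieGroupType R (\dim {:g})) (la : lie_algebra_of br G).

Definition Ad (a : G) (x : g) : g :=
  la_from la (Ad_chart (la_chart la) a (la_to la x)).

Definition coAd (a : G) (xi : 'Hom(g, R^o)) : 'Hom(g, R^o) :=
  linfun (fun x => xi (Ad a^-1%g x) : R^o).

Definition coadjoint_orbit (O : set 'Hom(g, R^o)) : Prop :=
  exists xi, O = [set coAd a xi | a in [set: G]].

End Coadjoint.

(* Every point of O is of the form B(x, -), B the Killing form, with x a       *)
(* semisimple element.                                                        *)
Definition semisimple_orbit (R : realType) (g : vectType R)
    (br : g -> g -> g) (O : set 'Hom(g, R^o)) : Prop :=
  forall xi, O xi ->
    exists2 x, (forall y, xi y = killing br x y) & ad_semisimple br x.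

Section SymmetricAlgebra.
Variables (R : realType) (g : vectType R).

(* S(g), the i-th variable being the i-th vector of the basis of g. *)
Definition Sym := mpoly (\dim {:g}) R.

Definition sym_inj (x : g) : Sym :=
  \sum_(i < \dim {:g})
     coord (vbasis {:g}) i x *: mpolyX R (mnm1 i).

Definition sym_eval (f : Sym) (xi : 'Hom(g, R^o)) : R :=
  meval (fun i => xi (vbasis {:g})`_i) f.

Variable br : g -> g -> g.

(* Leibniz's rule on the variables; see poisson_sym_inj, poissonMl, poissonC. *)
Definition poisson (f h : Sym) : Sym :=
  \sum_(i < \dim {:g}) \sum_(j < \dim {:g})
     mderiv i f * mderiv j h *
     sym_inj (br (vbasis {:g})`_i (vbasis {:g})`_j).

Lemma sym_inj_basis (i : 'I_(\dim {:g})) :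
  sym_inj (vbasis {:g})`_i = mpolyX R (mnm1 i).
Proof.
rewrite /sym_inj (bigD1 i)//= big1 => [|j ji].
  by rewrite coord_free ?(basis_free (vbasisP _))// eqxx scale1r addr0.
rewrite coord_free ?(basis_free (vbasisP _))//.
by rewrite eq_sym (negPf ji) scale0r.
Qed.

Lemma sym_evalX (x : g) xi : sym_eval (sym_inj x) xi = xi x.
Proof.
rewrite /sym_eval /sym_inj raddf_sum /= [in RHS](coord_vbasis (memvf x)).
rewrite linear_sum /=; apply: eq_bigr => i _.
by rewrite mevalZ mevalXU linearZ.
Qed.

Lemma sym_injZD a x y : sym_inj (a *: x + y) = a *: sym_inj x + sym_inj y.
Proof.
rewrite /sym_inj scaler_sumr -big_split /=; apply: eq_bigr => i _.
by rewrite linearP scalerDl scalerA.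
Qed.

Lemma mderiv_sym_inj i x :
  mderiv i (sym_inj x) = mpolyC _ (coord (vbasis {:g}) i x).
Proof.
rewrite /sym_inj raddf_sum /= (bigD1 i)//= big1 => [|j ji].
  rewrite addr0 mderivZ mderivX mnm1E eqxx -mul_mpolyC.
  rewrite (_ : mnm_sub _ _ = mnm0); last first.
    by apply/mnmP => k; rewrite mnmBE subnn mnm0E.
  by rewrite mpolyX0 scale1r mulr1.
by rewrite mderivZ mderivX mnm1E (negPf ji) scale0r scaler0.
Qed.

Lemma poisson_sym_inj x y : is_lie_bracket br ->
  poisson (sym_inj x) (sym_inj y) = sym_inj (br x y).
Proof.
move=> brL; have [brl brr _ _] := brL.
pose symL := GRing.isLinear.Build _ _ _ _ (sym_inj : g -> Sym) sym_injZD.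
pose S : {linear g -> Sym} := HB.pack (sym_inj : g -> Sym) symL.
pose BL y : {linear g -> g} := HB.pack (br^~ y)
  (GRing.isLinear.Build _ _ _ _ (br^~ y) (brl y)).
pose BR x : {linear g -> g} := HB.pack (br x)
  (GRing.isLinear.Build _ _ _ _ (br x) (brr x)).
have El (c : 'I_(\dim {:g}) -> R) (b : 'I_(\dim {:g}) -> g) v :
    sym_inj (br (\sum_i c i *: b i) v) = \sum_i c i *: sym_inj (br (b i) v).
  rewrite -[LHS]/((S \o BL v) _) linear_sum.
  by apply: eq_bigr => i _; rewrite linearZ.
have Er (c : 'I_(\dim {:g}) -> R) (b : 'I_(\dim {:g}) -> g) u :
    sym_inj (br u (\sum_i c i *: b i)) = \sum_i c i *: sym_inj (br u (b i)).
  rewrite -[LHS]/((S \o BR u) _) linear_sum.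
  by apply: eq_bigr => i _; rewrite linearZ.
rewrite /poisson [x in RHS](coord_vbasis (memvf x)) El.
apply: eq_bigr => i _.
rewrite [y in RHS](coord_vbasis (memvf y)) Er scaler_sumr.
apply: eq_bigr => j _.
by rewrite !mderiv_sym_inj -mulrA !mul_mpolyC.
Qed.

Lemma poissonMl f1 f2 h :
  poisson (f1 * f2) h = f1 * poisson f2 h + poisson f1 h * f2.
Proof.
rewrite /poisson mulr_sumr mulr_suml -big_split; apply: eq_bigr => i _ /=.
rewrite mulr_sumr mulr_suml -big_split; apply: eq_bigr => j _ /=.
rewrite mderivM; ring.
Qed.

Lemma poissonC f h : is_lie_bracket br -> poisson h f = - poisson f h.
Proof.
move=> [brl brr alt _].
have brN x y : br y x = - br x y.
  apply/eqP; rewrite -addr_eq0; apply/eqP.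
  have := alt (x + y); have := brl (x + y) 1 x y; rewrite !scale1r => ->.
  have := brr x 1 x y; have := brr y 1 x y; rewrite !scale1r => -> ->.
  by rewrite !alt add0r addr0 addrC.
rewrite /poisson exchange_big -sumrN; apply: eq_bigr => i _ /=.
rewrite -sumrN; apply: eq_bigr => j _; rewrite brN.
have -> : sym_inj (- br (vbasis {:g})`_i (vbasis {:g})`_j) =
    - sym_inj (br (vbasis {:g})`_i (vbasis {:g})`_j).
  rewrite /sym_inj -sumrN; apply: eq_bigr => k _.
  by rewrite linearN scaleNr.
by rewrite mulrN [mderiv j h * _]mulrC.
Qed.

End SymmetricAlgebra.

Section OrbitPolynomials.
Variables (R : realType) (g : vectType R) (O : set 'Hom(g, R^o)).

Definition sym_restrict (f : Sym g) : set_type O -> R^o :=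
  fun xi => sym_eval f (val xi).

Definition polynomial_on : {pred (set_type O -> R^o)} :=
  fun F => `[< exists f, F = sym_restrict f >].

Fact polynomial_on_submod : GRing.submod_closed polynomial_on.
Proof.
split.
  apply/asboolP; exists 0; apply/funext => xi.
  by rewrite /sym_restrict /sym_eval meval0.
move=> a _ _ /asboolP[f ->] /asboolP[h ->]; apply/asboolP.
exists (a *: f + h); apply/funext => xi.
by rewrite /sym_restrict /sym_eval mevalD mevalZ.
Qed.

HB.instance Definition _ := GRing.isSubmodClosed.Build R (set_type O -> R^o)
  polynomial_on polynomial_on_submod.

(* P(O), the space of the restrictions to O of polynomial functions. *)
Record orbit_poly := OrbitPoly {
  orbit_poly_fun :> set_type O -> R^o ;
  orbit_polyP : orbit_poly_fun \in polynomial_on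
}.

HB.instance Definition _ := [isSub for orbit_poly_fun].
HB.instance Definition _ := [Choice of orbit_poly by <:].
HB.instance Definition _ := [SubChoice_isSubLmodule of orbit_poly by <:].

Definition to_orbit_poly (f : Sym g) : orbit_poly :=
  OrbitPoly (asboolT (ex_intro _ f erefl : exists f', _ = sym_restrict f')).

Definition orbit_lift (F : orbit_poly) : Sym g :=
  projT1 (cid (asboolW (orbit_polyP F))).

Variable br : g -> g -> g.

(* When O is a coadjoint orbit, the polynomials vanishing on O form a Poisson *)
(* ideal, so that this does not depend on the choice of the lifts to S(g).    *)
Definition orbit_poisson (F H : orbit_poly) : orbit_poly :=
  to_orbit_poly (poisson br (orbit_lift F) (orbit_lift H)).

End OrbitPolynomials.

(* Main.v *)
(* If O is semisimple, a separable polynomial q with q(0) = 0 annihilates     *)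
(* ad x for all x in O (g* being identified with g). Differentiating          *)
(* q(ad x) = 0 shows that, to first order along the diagonal of O x O, the    *)
(* vector field joining two points of O is Hamiltonian in the second point.   *)
(* This Euler field acts on m^r / m^(r+1) as multiplication by r, where m is  *)
(* the ideal of the diagonal; hence a Poisson ideal K of polynomials f(X) is  *)
(* contained in m^r modulo K(p) for every r, and Krull's intersection theorem *)
(* yields, for f in K, a decomposition 1 = h + k with h f = 0 on O and k in   *)
(* K. Iterating, noetherianity produces an element of K whose values on O are *)
(* 0 or 1; it is constant as G is connected. So the Poisson algebra P(O) has  *)
(* no proper nonzero Poisson ideal, which forces it to be essentially simple. *)
(*                                                                            *)
(* Conversely let x = s + n be a Jordan decomposition of a point of O. As     *)
(* [h, s] = 0 and [h, n] = n for some complex h, the polynomials vanishing on *)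
(* O vanish on the line s + t n. Those all of whose iterated Hamiltonian      *)
(* derivatives are O(t^2) on this line make up a Lie ideal of P(O). If it     *)
(* contains the derived ideal then n = 0. It contains the products of two     *)
(* entries of q(ad x), where q is separable and vanishes at 0 and at the      *)
(* eigenvalues of ad x; if these products are central then q(ad x)            *)
(* commutes with ad g, so q(ad x) = 0 by nondegeneracy of the Killing form.   *)

From HB Require Import structures.
From mathcomp Require Import all_boot all_order all_algebra all_field.
From mathcomp Require Import all_classical all_reals all_analysis.
From mathcomp Require Import ring lra zify.
From mathcomp Require Import -(notations) mpoly.
Require Import Defs.

Set Implicit Arguments.
Unset Strict Implicit.
Unset Printing Implicit Defensive.

Import Order.TTheory GRing.Theory Num.Theory.
Import passmx.

Local Open Scope classical_set_scope.
Local Open Scope ring_scope.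

(** * Noetherian rings *)

(** The dual is identified with the Lie algebra by the Killing form, nondegenerate by Cartan's
    criterion ([killing_mx_unit]). A point x of the dual is semisimple exactly when q(ad x) = 0 for
    some separable q with q(0) = 0.

    From semisimple to essentially simple, the geometric half is [poisson_ideal_trivial]: a Poisson
    ideal J containing the polynomials that vanish on O either consists of these or contains 1. On
    pairs of points of O let V be the displacement and m the ideal of the diagonal. Differentiating
    q(ad x) = 0 ([tangent_relation_at]) shows that V is orthogonal to the centralizer to first
    order, so V is a Hamiltonian field to first order ([tangent_hamiltonian]). The resulting
    derivation acts as r on m^r / m^(r+1) ([euler_derivation]), so a member of J at the second point
    lies in every m^r modulo J at the first point ([moving_deep]). Krull's theorem turns this into a
    decomposition of 1 ([split_unit]); iterating it in a noetherian ring gives a member of J with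
    values 0 and 1 on O, which is constant by connectedness. The algebraic half is
    [poisson_simple_essentially_simple]: a Lie ideal I yields a Poisson ideal K containing {I, I}.
    If K contains 1, then I contains all brackets; if K vanishes on O, then {a, {a, -}} = 0 for a in
    I, and Leibniz's rule gives {a, c}^2 = 0.

    Conversely, write a point of O as x = s + v, its Jordan decomposition, with [h, s] = 0 and
    [h, v] = v ([jordan_flow]). Polynomials vanishing on O vanish on the line s + t v
    ([line_vanish]), so those whose iterated Hamiltonian derivatives are all of order 2 at t = 0
    define a Lie ideal of P(O) ([jordan_core]). If it contains the derived ideal then v = 0; if it
    is central then [central_annihilator] applies. Either way q(ad x) = 0 for a separable q, and x
    is semisimple. *)

Section Ideals.
Variable A : comNzRingType.

Record is_ideal (I : A -> Prop) : Prop := IsIdeal {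
  ideal0 : I 0 ;
  idealD : forall x y, I x -> I y -> I (x + y) ;
  idealMl : forall a x, I x -> I (a * x)
}.

Section Theory.
Variables (I : A -> Prop) (idI : is_ideal I).

Lemma idealN x : I x -> I (- x).
Proof. by move=> Ix; rewrite -mulN1r; apply: (idealMl idI). Qed.

Lemma idealB x y : I x -> I y -> I (x - y).
Proof. by move=> Ix Iy; apply: (idealD idI) => //; apply: idealN. Qed.

Lemma ideal_sum (T : Type) (r : seq T) (P : pred T) (F : T -> A) :
  (forall i, P i -> I (F i)) -> I (\sum_(i <- r | P i) F i).
Proof. by move=> IF; apply: big_ind => //; [case: idI | apply: (idealD idI)]. Qed.

End Theory.

(** The ascending chain condition on sequences: each use reads off one relation expressing a term by
    the earlier ones. *)
Definition noetherian : Prop :=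
  forall u : nat -> A, exists N, exists c : nat -> A,
    u N = \sum_(i < N) c i * u i.

End Ideals.

Lemma noetherian_field (F : fieldType) : noetherian F.
Proof.
move=> u; have [u0|u0] := eqVneq (u 0) 0.
  by exists 0, (fun=> 0); rewrite big_ord0.
by exists 1, (fun=> u 1 / u 0); rewrite big_ord1 divfK.
Qed.

Section HilbertBasis.
Variables (A : comNzRingType) (noethA : noetherian A).

Definition combination (s : seq {poly A}) (p : {poly A}) : Prop :=
  exists c : nat -> {poly A}, p = \sum_(i < size s) c i * s`_i.

Lemma combination_ideal s : is_ideal (combination s).
Proof.
split.
- by exists (fun=> 0); rewrite big1 // => i _; rewrite mul0r.
- move=> _ _ [c ->] [d ->]; exists (fun i => c i + d i).
  by rewrite -big_split; apply: eq_bigr => i _; rewrite mulrDl.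
- move=> a _ [c ->]; exists (fun i => a * c i).
  by rewrite mulr_sumr; apply: eq_bigr => i _; rewrite mulrA.
Qed.

Lemma combination_mem s p : p \in s -> combination s p.
Proof.
move=> sp; exists (fun i => (i == index p s)%:R).
have ip : (index p s < size s)%N by rewrite index_mem.
rewrite (bigD1 (Ordinal ip)) //= eqxx mul1r nth_index // big1 ?addr0 // => i.
by rewrite -val_eqE /= => /negPf ->; rewrite mul0r.
Qed.

Lemma combination_trans s t p : (forall x, x \in s -> combination t x) ->
  combination s p -> combination t p.
Proof.
move=> st [c ->]; apply: (ideal_sum (combination_ideal t)) => i _.
by apply: (idealMl (combination_ideal t)); apply: st; rewrite mem_nth.
Qed.

(** Hilbert's basis theorem. If no term of [u] depended on the earlier ones, the ideal [J] they span
    would have no finite generating list. Let [f k] have least degree in [J] outside the ideal of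
    the previous [f i]; a relation between the leading coefficients then produces an element of
    smaller degree that is still outside. *)
Lemma noetherian_poly : noetherian {poly A}.
Proof.
move=> u; apply: contrapT => bad.
pose J p := exists M, combination (mkseq u M) p.
have notcomb M : ~ combination (mkseq u M) (u M).
  move=> [c uM]; apply: bad; exists M, c; rewrite [LHS]uM size_mkseq.
  by apply: eq_bigr => i _; rewrite nth_mkseq.
have mkS M M' : (M <= M')%N -> forall x, x \in mkseq u M -> x \in mkseq u M'.
  move=> MM x /mapP[i]; rewrite mem_iota => /andP[_ iM] ->.
  by apply: map_f; rewrite mem_iota /=; apply: leq_trans iM MM.
have combS M M' p : (M <= M')%N ->
    combination (mkseq u M) p -> combination (mkseq u M') p.
  move=> MM; apply: combination_trans => x xM; apply: combination_mem.
  exact: mkS xM.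
have Jid : is_ideal J.
  split; first by exists 0; case: (combination_ideal (mkseq u 0)).
  - move=> x y [M xM] [M' yM']; exists (maxn M M').
    apply: (idealD (combination_ideal _)).
      exact: combS (leq_maxl _ _) xM.
    exact: combS (leq_maxr _ _) yM'.
  - by move=> a x [M xM]; exists M; apply: (idealMl (combination_ideal _)).
have nfg s : (forall x, x \in s -> J x) -> exists x, J x /\ ~ combination s x.
  move=> sJ.
  have [M sM] : exists M, forall x, x \in s -> combination (mkseq u M) x.
    elim: s sJ => [|x s IHs] sJ; first by exists 0.
    have [] := IHs; first by move=> y ys; apply: sJ; rewrite inE ys orbT.
    move=> M sM; have [M' xM'] := sJ x (mem_head _ _); exists (maxn M M') => y.
    rewrite inE => /orP[/eqP ->|/sM yM]; first exact: combS (leq_maxr _ _) xM'.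
    exact: combS (leq_maxl _ _) yM.
  exists (u M); split.
    by exists M.+1; apply: combination_mem; apply: map_f; rewrite mem_iota /=.
  by move=> sc; apply: (notcomb M); apply: combination_trans sc.
have pickP s : exists x, (forall y, y \in s -> J y) ->
    [/\ J x, ~ combination s x &
        forall y, J y -> ~ combination s y -> (size x <= size y)%N].
  have [sJ|nsJ] := pselect (forall y, y \in s -> J y); last by exists 0.
  have exd : exists d, `[< exists x, [/\ J x, ~ combination s x & size x = d] >].
    have [x [Jx nx]] := nfg s sJ; exists (size x); apply/asboolP.
    by exists x.
  case: (ex_minnP exd) => d /asboolP[x [Jx nx dx]] dmin.
  exists x => _; split=> // y Jy ny; rewrite dx; apply: dmin.
  by apply/asboolP; exists y.
pose pk s := projT1 (cid (pickP s)).
pose L := fix L k := if k is k'.+1 then rcons (L k') (pk (L k')) else [::].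
have LJ k y : y \in L k -> J y.
  elim: k y => [|k IHk] y //=; rewrite mem_rcons inE => /orP[/eqP ->|/IHk//].
  by rewrite /pk; case: cid => x /= /(_ IHk)[].
pose f k := pk (L k).
have fP k : [/\ J (f k), ~ combination (L k) (f k) &
    forall y, J y -> ~ combination (L k) y -> (size (f k) <= size y)%N].
  by rewrite /f /pk; case: cid => x /= /(_ (LJ k)).
have fL k i : (i < k)%N -> f i \in L k.
  elim: k => // k IHk; rewrite ltnS leq_eqVlt /= mem_rcons inE.
  by move=> /orP[/eqP ->|/IHk ->]; rewrite ?eqxx ?orbT.
have LS k i x : (i <= k)%N -> x \in L i -> x \in L k.
  elim: k => [|k IHk]; first by rewrite leqn0 => /eqP ->.
  rewrite leq_eqVlt => /orP[/eqP -> //|/IHk ixk /ixk xk].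
  by rewrite /= mem_rcons inE xk orbT.
have sizef i k : (i <= k)%N -> (size (f i) <= size (f k))%N.
  move=> ik; have [_ _ fmin] := fP i; have [Jk nk _] := fP k.
  apply: fmin => // /(combination_trans _) ck; apply: nk; apply: ck => x xi.
  by apply: combination_mem; apply: LS xi.
have [N [c aN]] := noethA (fun k => lead_coef (f k)).
have [JN nN minN] := fP N.
(* The degrees of the [f i] are nondecreasing, so the shifts are true differences and the leading
   term of [f N] cancels. *)
pose g := f N - \sum_(i < N) (c i *: 'X^(size (f N) - size (f i))) * f i.
have gN : ~ combination (L N) g.
  move=> cg; apply: nN; rewrite -(subrK (\sum_(i < N)
    (c i *: 'X^(size (f N) - size (f i))) * f i) (f N)).
  apply: (idealD (combination_ideal _)) => //.
  apply: (ideal_sum (combination_ideal _)) => i _.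
  by apply: (idealMl (combination_ideal _)); apply/combination_mem/fL.
have Jg : J g.
  apply: (idealB Jid) => //; apply: (ideal_sum Jid) => i _.
  by apply: (idealMl Jid); have [] := fP i.
have := minN _ Jg gN; apply/negP; rewrite -ltnNge.
have f0 i : f i != 0.
  apply/eqP => fi0; have [_ + _] := fP i; apply; rewrite fi0.
  by case: (combination_ideal (L i)).
have sN : (0 < size (f N))%N by rewrite lt0n size_poly_eq0.
rewrite -(prednK sN) ltnS; apply/leq_sizeP => j.
rewrite leq_eqVlt => /orP[/eqP <-|jN].
  rewrite coefB coef_sum -[X in X - _]/(lead_coef (f N)) aN.
  apply/eqP; rewrite subr_eq0; apply/eqP/eq_bigr => i _.
  rewrite -scalerAl coefZ coefXnM; congr (_ * _).
  have iN := sizef _ _ (ltnW (ltn_ord i)).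
  have si : (0 < size (f i))%N by rewrite lt0n size_poly_eq0.
  rewrite ifF; last first.
    by apply/negbTE; rewrite -leqNgt; move: iN si sN; lia.
  by rewrite lead_coefE; congr (_`_ _); move: iN si sN; lia.
rewrite prednK // in jN.
rewrite coefB coef_sum (nth_default _ jN) sub0r big1 ?oppr0 // => i _.
have iN := sizef _ _ (ltnW (ltn_ord i)).
rewrite -scalerAl coefZ coefXnM; case: ifP => _; first by rewrite mulr0.
have -> : (f i)`_(j - (size (f N) - size (f i))) = 0.
  by apply: nth_default; rewrite leq_subRL ?subnK //; apply: leq_trans jN; apply: leq_subr.
by rewrite mulr0.
Qed.

End HilbertBasis.

Section GeneratedSubring.
Variables (F B : comNzRingType) (phi : {rmorphism F -> B}).

Record is_subring_over (P : B -> Prop) : Prop := IsSubringOver {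
  subring_const : forall x, P (phi x) ;
  subring_add : forall x y, P x -> P y -> P (x + y) ;
  subring_mul : forall x y, P x -> P y -> P (x * y)
}.

Definition generated (z : seq B) (b : B) : Prop :=
  forall P, is_subring_over P -> (forall x, x \in z -> P x) -> P b.

End GeneratedSubring.

(** A finitely generated subalgebra is the image of an iterated polynomial ring. It stays a
    predicate on [B], accompanied by a noetherian source, instead of becoming a type. *)
Lemma noetherian_generated (F : fieldType) (B : comNzRingType)
    (phi : {rmorphism F -> B}) (z : seq B) :
  exists (A : comNzRingType) (psi : {rmorphism A -> B}),
    noetherian A /\ forall b, (exists a, psi a = b) <-> generated phi z b.
Proof.
elim: z => [|b z [A [psi [noethA psiP]]]].
  exists F, phi; split; first exact: noetherian_field.
  move=> b; split=> [[a <-] P [Pc _ _] _ //|gb].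
  apply: (gb (fun b => exists a, phi a = b)) => //.
  split; first by move=> x; exists x.
  - by move=> _ _ [x <-] [y <-]; exists (x + y); rewrite rmorphD.
  - by move=> _ _ [x <-] [y <-]; exists (x * y); rewrite rmorphM.
have cb : commr_rmorph psi b by move=> a; apply: mulrC.
exists {poly A}, (horner_morph cb); split; first exact: noetherian_poly.
move=> x; split=> [[p <-] P PS Pz|gx].
  elim/poly_ind: p => [|p c IHp].
    by rewrite rmorph0 -(rmorph0 phi); apply: (subring_const PS).
  rewrite rmorphD rmorphM /= horner_morphX horner_morphC.
  apply: (subring_add PS); first apply: (subring_mul PS) => //.
    by apply: Pz; rewrite mem_head.
  have [+ _] := psiP (psi c); apply => //; first by exists c.
  by move=> y yz; apply: Pz; rewrite inE yz orbT.
apply: (gx (fun x => exists p, horner_morph cb p = x)).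
  split.
  - move=> y; have [_ []] := psiP (phi y); first by move=> P [].
    by move=> a <-; exists a%:P; rewrite /= horner_morphC.
  - by move=> _ _ [p <-] [q <-]; exists (p + q); rewrite rmorphD.
  - by move=> _ _ [p <-] [q <-]; exists (p * q); rewrite rmorphM.
move=> y; rewrite inE => /orP[/eqP ->|yz].
  by exists 'X; rewrite /= horner_morphX.
have [_ []] := psiP y; first by move=> P _; apply.
by move=> a <-; exists a%:P; rewrite /= horner_morphC.
Qed.

Lemma generated_subring (F : fieldType) (B : comNzRingType)
  (phi : {rmorphism F -> B}) (z : seq B) : is_subring_over phi (generated phi z).
Proof.
split=> [x P [] //|x y gx gy P PS Pz|x y gx gy P PS Pz].
- by apply: (subring_add PS); [apply: gx|apply: gy].
- by apply: (subring_mul PS); [apply: gx|apply: gy].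
Qed.

Lemma generated_noetherian (F : fieldType) (B : comNzRingType)
    (phi : {rmorphism F -> B}) (z : seq B) (u : nat -> B) :
  (forall i, generated phi z (u i)) ->
  exists N, exists c : nat -> B,
    (forall i, generated phi z (c i)) /\ u N = \sum_(i < N) c i * u i.
Proof.
move=> gu; have [A [psi [noethA psiP]]] := noetherian_generated phi z.
have /choice[v vP] : forall i, exists a, psi a = u i by move=> i; apply/psiP.
have [N [c cN]] := noethA v.
exists N, (fun i => psi (c i)); split=> [i|]; first by apply/psiP; exists (c i).
rewrite -vP cN rmorph_sum; apply: eq_bigr => i _.
by rewrite rmorphM /= vP.
Qed.

(** * Powers of an ideal and Krull's intersection theorem *)

Section IdealPowers.
Variables (T : comNzRingType) (n : nat) (V : 'I_n -> T).

Fixpoint ideal_pow (r : nat) (a : T) : Prop :=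
  if r is r'.+1 then
    exists b : 'I_n -> T, (forall k, ideal_pow r' (b k)) /\
      a = \sum_k V k * b k
  else True.

Lemma ideal_pow_ideal r : is_ideal (ideal_pow r).
Proof.
elim: r => [|r IHr]; split=> //=.
- exists (fun=> 0); split; first by move=> _; case: IHr.
  by rewrite big1 // => i _; rewrite mulr0.
- move=> _ _ [b [bP ->]] [c [cP ->]]; exists (fun k => b k + c k); split.
    by move=> k; apply: (idealD IHr).
  by rewrite -big_split; apply: eq_bigr => k _; rewrite mulrDr.
- move=> a _ [b [bP ->]]; exists (fun k => a * b k); split.
    by move=> k; apply: (idealMl IHr).
  by rewrite mulr_sumr; apply: eq_bigr => k _; rewrite mulrCA.
Qed.

Lemma ideal_powS k r b : ideal_pow r b -> ideal_pow r.+1 (V k * b).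
Proof.
move=> rb; exists (fun i => if i == k then b else 0); split=> [i|].
  by case: eqP => // _; case: (ideal_pow_ideal r).
rewrite (bigD1 k) //= eqxx big1 ?addr0 // => i /negPf ->.
by rewrite mulr0.
Qed.

Lemma ideal_powW r a : ideal_pow r.+1 a -> ideal_pow r a.
Proof.
case=> b [bP ->]; apply: (ideal_sum (ideal_pow_ideal r)) => k _.
by apply: (idealMl (ideal_pow_ideal r)); apply: bP.
Qed.

Lemma ideal_pow_gt0 r a : ideal_pow r.+1 a -> ideal_pow 1 a.
Proof. by elim: r => // r IHr /ideal_powW/IHr. Qed.

Lemma ideal_powM r s a b :
  ideal_pow r a -> ideal_pow s b -> ideal_pow (r + s) (a * b).
Proof.
elim: r a => [|r IHr] a; first by move=> _; apply: (idealMl (ideal_pow_ideal s)).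
move=> [c [cP ->]] sb; rewrite addSn mulr_suml.
apply: (ideal_sum (ideal_pow_ideal _)) => k _.
by rewrite -mulrA; apply: ideal_powS; apply: IHr => //; apply: cP.
Qed.

(* Perdry's proof: apply the basis theorem to the Rees algebra, whose degree  *)
(* r part is the r-th power of the ideal.                                     *)
Lemma krull_intersection (F : fieldType) (phi : {rmorphism F -> T})
    (z : seq T) (I : T -> Prop) (f : T) :
  (forall t, generated phi z t) -> is_ideal I ->
  (forall r, exists c, ideal_pow r c /\ I (f - c)) ->
  exists a, ideal_pow 1 a /\ I ((1 - a) * f).
Proof.
move=> genT idI /choice[c cP].
pose phi' : {rmorphism F -> {poly T}} := polyC \o phi.
pose z' := [seq x%:P | x <- z] ++ [seq V k *: 'X | k <- enum 'I_n].
have gS := generated_subring phi' z'.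
have gC t : generated phi' z' t%:P.
  apply: (genT t (fun t => generated phi' z' t%:P)); first split.
  - exact: (subring_const gS).
  - by move=> x y gx gy; rewrite rmorphD; apply: (subring_add gS).
  - by move=> x y gx gy; rewrite rmorphM; apply: (subring_mul gS).
  - move=> x xz P _; apply; rewrite mem_cat; apply/orP; left.
    by apply: map_f.
have gR r a : ideal_pow r a -> generated phi' z' (a *: 'X^r).
  elim: r a => [|r IHr] a; first by rewrite expr0 alg_polyC.
  move=> [b [bP ->]]; rewrite scaler_suml.
  have g0 : generated phi' z' 0 by rewrite -(rmorph0 phi'); case: gS.
  apply: big_ind => //; first exact: (subring_add gS).
  move=> k _; have -> : (V k * b k) *: 'X^(r.+1) = (V k *: 'X) * (b k *: 'X^r) :> {poly T}.
    by rewrite -scalerAl -scalerAr scalerA exprS.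
  apply: (subring_mul gS); last by apply: IHr; apply: bP.
  move=> P _; apply; rewrite mem_cat; apply/orP; right.
  by apply: map_f; rewrite mem_enum.
(* Conversely, the generators of the Rees algebra have their coefficient of degree [j] in the [j]-th
   power, a property that sums and products keep. *)
have Rg p : generated phi' z' p -> forall j, ideal_pow j p`_j.
  move=> gp; apply: (gp (fun p => forall j, ideal_pow j p`_j)).
    split=> [x j|p' q pj qj j|p' q pj qj j].
    + rewrite coefC; case: eqP => [->//|_]; by case: (ideal_pow_ideal j).
    + by rewrite coefD; apply: (idealD (ideal_pow_ideal j)).
    + rewrite coefM; apply: (ideal_sum (ideal_pow_ideal j)) => i _.
      by rewrite -[X in ideal_pow X](subnKC (ltn_ord i : (i <= j)%N)); apply: ideal_powM.
  move=> q; rewrite mem_cat => /orP[] /mapP[x _ ->] j.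
    by rewrite coefC; case: eqP => [->//|_]; case: (ideal_pow_ideal j).
  rewrite coefZ coefX; case: eqP => [->|_].
    exact: ideal_powS.
  by rewrite mulr0; case: (ideal_pow_ideal j).
have [N [d [gd uN]]] := @generated_noetherian _ _ phi' z'
  (fun i => c i *: 'X^i) (fun i => gR _ _ (proj1 (cP i))).
(* The coefficient of degree [N] in the relation between the [c i *: 'X^i]. Every [N - i] is
   positive, so these coefficients lie in the ideal. *)
exists (\sum_(i < N) (d i)`_(N - i)); split.
  apply: (ideal_sum (ideal_pow_ideal 1)) => i _.
  have := Rg _ (gd i) (N - i)%N; rewrite -subnSK //; exact: ideal_pow_gt0.
have cN : c N = \sum_(i < N) (d i)`_(N - i) * c i.
  have := congr1 (fun p : {poly T} => p`_N) uN.
  rewrite coefZ coefXn eqxx mulr1 => ->; rewrite coef_sum; apply: eq_bigr => i _.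
  rewrite -scalerAr coefZ coefMXn ltnNge (ltnW (ltn_ord i)) /=.
  by rewrite mulrC.
have -> : (1 - \sum_(i < N) (d i)`_(N - i)) * f =
    (f - c N) - \sum_(i < N) (d i)`_(N - i) * (f - c i).
  rewrite [X in _ = _ - X](eq_bigr (fun i : 'I_N => (d i)`_(N - i) * f - (d i)`_(N - i) * c i));
    last by move=> i _; rewrite mulrBr.
  rewrite sumrB -cN -mulr_suml; ring.
apply: (idealB idI); first by have [] := cP N.
apply: (ideal_sum idI) => i _; apply: (idealMl idI); by have [] := cP i.
Qed.

End IdealPowers.

(** * Polynomials of a matrix *)

(** By the rank factorization, [A] has the trace of [row_base A *m col_base A], which is nilpotent
    and smaller unless [A] has full rank; in that case [A] is both invertible and nilpotent, hence
    zero. *)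
Lemma mxtrace_nilpotent (F : fieldType) n (A : 'M[F]_n) k : A ^+ k = 0 -> \tr A = 0.
Proof.
elim/ltn_ind: n k A => n IHn k A Ak.
have [rn|nr] := eqVneq (\rank A) n.
  have uA : A \in unitmx by rewrite -row_full_unit /row_full rn.
  suff A0 : A = 0 by rewrite A0 mxtrace0.
  elim: k Ak => [|k IHk] Ak; last first.
    apply: IHk; rewrite -[LHS]mul1mx -(mulVmx uA) -mulmxA.
    by rewrite -[A *m _]/(A * A ^+ k) -exprS Ak mulmx0.
  by rewrite -[LHS]mulmx1 -[1%:M]/(A ^+ 0) Ak mulmx0.
rewrite -[in LHS](mulmx_base A) mxtrace_mulC.
apply: (IHn (\rank A) _ k); first by rewrite ltn_neqAle nr rank_leq_row.
have powE j : (row_base A *m col_base A) ^+ j *m row_base A = row_base A *m A ^+ j.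
  elim: j => [|j IHj]; first by rewrite mul1mx mulmx1.
  rewrite exprSr -[_ * _]/(_ *m _) -mulmxA.
  rewrite -[X in _ *m X]mulmxA mulmx_base mulmxA IHj -mulmxA.
  by rewrite -[A ^+ j *m A]/(A ^+ j * A) -exprSr.
apply: (row_free_inj (row_base_free A)).
by rewrite powE Ak mulmx0 mul0mx.
Qed.

(** Idempotence forces [row_base A *m col_base A = 1%:M], a matrix whose size is the rank. *)
Lemma mxtrace_idempotent (F : fieldType) n (A : 'M[F]_n) :
  A *m A = A -> \tr A = (\rank A)%:R.
Proof.
move=> AA; rewrite -[in LHS](mulmx_base A) mxtrace_mulC.
suff -> : row_base A *m col_base A = 1%:M by rewrite mxtrace1.
apply: (row_free_inj (row_base_free A)); rewrite mul1mx.
apply: (row_full_inj (col_base_full A)).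
have := AA; rewrite -{1 2 3}(mulmx_base A).
by move: (row_base A) (col_base A) => r c; rewrite !mulmxA.
Qed.

(* [horner_mx] for square matrices of possibly zero size. *)
Section PolynomialMatrix.
Variables (B : comNzRingType) (n : nat).
Implicit Types (A M : 'M[B]_n) (p q : {poly B}).

Definition polymx A p : 'M[B]_n := \sum_(i < size p) p`_i *: A ^+ i.

End PolynomialMatrix.

Section PolynomialMatrixTheory.
Variables (B : comNzRingType).

Lemma polymxE n (A : 'M[B]_n.+1) p : polymx A p = horner_mx A p.
Proof.
rewrite /polymx -[in RHS](coefK p) poly_def rmorph_sum /=.
apply: eq_bigr => i _.
by rewrite -mul_polyC rmorphM rmorphXn /= horner_mx_C horner_mx_X -[RHS]/(_ *m _) mul_scalar_mx.
Qed.

Variable n : nat.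
Implicit Types (A M : 'M[B]_n) (p q : {poly B}).

Lemma polymxD A p q : polymx A (p + q) = polymx A p + polymx A q.
Proof.
case: n A => [|m] A; first by rewrite [LHS]flatmx0 [RHS]flatmx0.
by rewrite !polymxE rmorphD.
Qed.

Lemma polymxM A p q : polymx A (p * q) = polymx A p *m polymx A q.
Proof.
case: n A => [|m] A; first by rewrite [LHS]flatmx0 [RHS]flatmx0.
by rewrite !polymxE rmorphM.
Qed.

Lemma polymxC A c : polymx A c%:P = c%:M.
Proof.
case: n A => [|m] A; first by rewrite [LHS]flatmx0 [RHS]flatmx0.
by rewrite polymxE horner_mx_C.
Qed.

Lemma polymxX A : polymx A 'X = A.
Proof.
case: n A => [|m] A; first by rewrite [LHS]flatmx0 [RHS]flatmx0.
by rewrite polymxE horner_mx_X.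
Qed.

Lemma polymx0 A : polymx A 0 = 0.
Proof. by rewrite polymxC raddf0. Qed.

Lemma polymx1 A : polymx A 1 = 1%:M.
Proof. exact: polymxC. Qed.

Lemma polymxZ A c p : polymx A (c *: p) = c *: polymx A p.
Proof. by rewrite -mul_polyC polymxM polymxC mul_scalar_mx. Qed.

Lemma polymxB A p q : polymx A (p - q) = polymx A p - polymx A q.
Proof. by rewrite polymxD -scaleN1r polymxZ scaleN1r. Qed.

Lemma polymx_exp A p k : polymx A (p ^+ k) = polymx A p ^+ k.
Proof.
elim: k => [|k IHk]; first by rewrite !expr0 polymx1.
by rewrite !exprS polymxM IHk.
Qed.

Lemma polymx_sum A (I : Type) (r : seq I) (P : pred I) (F : I -> {poly B}) :
  polymx A (\sum_(i <- r | P i) F i) = \sum_(i <- r | P i) polymx A (F i).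
Proof.
by elim/big_rec2: _ => [|i x y _ <-]; rewrite ?polymx0 ?polymxD.
Qed.

Lemma polymx_comm A M p : A *m M = M *m A -> polymx A p *m M = M *m polymx A p.
Proof.
move=> AM; elim/poly_ind: p => [|p c IHp]; first by rewrite polymx0 mul0mx mulmx0.
rewrite polymxD polymxM polymxX polymxC mulmxDl mulmxDr -mulmxA AM mulmxA IHp.
by rewrite -mulmxA mul_scalar_mx mul_mx_scalar.
Qed.

Lemma polymxCC A p q : polymx A p *m polymx A q = polymx A q *m polymx A p.
Proof. by rewrite -!polymxM mulrC. Qed.

End PolynomialMatrixTheory.

Lemma map_polymx (B B' : comNzRingType) (f : {rmorphism B -> B'}) n
    (A : 'M[B]_n) p :
  map_mx f (polymx A p) = polymx (map_mx f A) (map_poly f p).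
Proof.
case: n A => [|m] A; first by rewrite [LHS]flatmx0 [RHS]flatmx0.
by rewrite !polymxE map_horner_mx.
Qed.

Section Spectral.
Variable F : fieldType.

Lemma polymx_coprime n (A : 'M[F]_n) m (u : 'M[F]_(m, n)) p q : coprimep p q ->
  u *m polymx A p = 0 -> u *m polymx A q = 0 -> u = 0.
Proof.
move=> /Bezout_coprimepP[[a b]] /=.
rewrite -size_poly_eq1 => /size_poly1P[c c0 abc] up uq.
have : u *m polymx A (a * p + b * q) = 0.
  rewrite polymxD (mulrC a) (mulrC b) !polymxM mulmxDr !mulmxA up uq !mul0mx.
  by rewrite addr0.
rewrite abc polymxC mul_mx_scalar => /eqP; rewrite scaler_eq0 (negPf c0) /=.
by move/eqP.
Qed.

(** The Chinese remainder theorem in the form of a partition of unity modulo [P]. A new factor [Q]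
    is coprime to the old product, and the relation [a * P + b * Q = 1] splits off its
    idempotent. *)
Lemma chinese_idempotents (s : seq F) (N : nat) : uniq s ->
  let P := \prod_(l <- s) ('X - l%:P) ^+ N in
  exists e : F -> {poly F}, P %| \sum_(l <- s) e l - 1 /\
    forall l, l \in s -> P %| ('X - l%:P) ^+ N * e l.
Proof.
elim: s => [_|m s IHs] /=.
  by exists (fun=> 0); rewrite !big_nil dvd1p; split.
move=> /andP[ms us]; have [e [e1 eP]] := IHs us; rewrite big_cons.
set P := \prod_(l <- s) _ in e1 eP *; set Q := _ ^+ N.
have cQP : coprimep Q P.
  rewrite /P; elim: (s) (ms) => [|l s' IH]; first by rewrite big_nil coprimep1.
  rewrite inE negb_or big_cons coprimepMr => /andP[ml /IH ->]; rewrite andbT.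
  apply: coprimep_expl; apply: coprimep_expr.
  by rewrite coprimep_XsubC root_XsubC eq_sym.
have [a [b ab]] : exists a b, a * P + b * Q = 1.
  have /Bezout_coprimepP[[u v]] := cQP.
  rewrite /= -size_poly_eq1 => /size_poly1P[c c0 uvc].
  exists (c^-1 *: v), (c^-1 *: u); rewrite -!scalerAl -scalerDr addrC uvc.
  by rewrite -mul_polyC -polyCM mulVf.
exists (fun l => if l == m then a * P else b * Q * e l); split.
  rewrite big_cons eqxx.
  have -> : \sum_(l <- s) (if l == m then a * P else b * Q * e l) =
      b * Q * \sum_(l <- s) e l.
    rewrite mulr_sumr; apply: eq_big_seq => l ls.
    by case: eqP ls => // ->; rewrite (negPf ms).
  have /dvdpP[c cE] := e1.
  have -> : a * P + b * Q * (\sum_(l <- s) e l) - 1 = b * c * (Q * P).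
    rewrite -ab (_ : \sum_(l <- s) e l = c * P + 1); first by ring.
    by rewrite -cE subrK.
  exact: dvdp_mull.
move=> l; rewrite inE => /orP[/eqP ->|ls].
  by rewrite eqxx mulrCA dvdp_mull.
rewrite ifF; last by apply/eqP => lm; rewrite -lm ls in ms.
have /dvdpP[c cE] := eP l ls.
have -> : ('X - l%:P) ^+ N * (b * Q * e l) = b * c * (Q * P).
  by rewrite mulrCA cE; ring.
exact: dvdp_mull.
Qed.

End Spectral.

Section ClosedSpectral.
Variables (C : closedFieldType) (n : nat) (A : 'M[C]_n).

Lemma coprimep_XsubC_exp (l m : C) i j : l != m ->
  coprimep (('X - l%:P) ^+ i) (('X - m%:P) ^+ j).
Proof.
move=> lm; apply: coprimep_expl; apply: coprimep_expr.
by rewrite coprimep_XsubC root_XsubC eq_sym.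
Qed.

Lemma polymx_XsubC_exp l k : polymx A (('X - l%:P) ^+ k) = (A - l%:M) ^+ k.
Proof. by rewrite polymx_exp polymxB polymxX polymxC. Qed.

(** Projections onto the generalized eigenspaces, as polynomials in [A]. The exponent [N] counts all
    roots, so it bounds each multiplicity and Cayley-Hamilton applies. *)
Lemma spectral_idempotents : exists (s : seq C) (e : C -> 'M[C]_n) (N : nat),
  [/\ uniq s, forall l, l \in s -> root (char_poly A) l,
      \sum_(l <- s) e l = 1%:M,
      forall l, l \in s -> exists p, e l = polymx A p &
      forall l, l \in s -> e l *m (A - l%:M) ^+ N = 0].
Proof.
have [rs rsP] := closed_field_poly_normal (char_poly A).
rewrite (eqP (char_poly_monic A)) scale1r in rsP.
set N := size rs.
have [e [e1 eP]] := chinese_idempotents N (undup_uniq rs).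
set P := \prod_(l <- undup rs) ('X - l%:P) ^+ N in e1 eP.
have polyP p : P %| p -> polymx A p = 0.
  suff chiP : char_poly A %| P.
    move=> /(dvdp_trans chiP)/dvdpP[q ->]; rewrite polymxM.
    suff -> : polymx A (char_poly A) = 0 by rewrite mulmx0.
    case: (n) A => [|m] A'; first by rewrite [LHS]flatmx0.
    by rewrite polymxE Cayley_Hamilton.
  rewrite rsP /P -prodr_undup_exp_count.
  apply: (big_ind2 (fun p q => p %| q)); first exact: dvdpp.
    by move=> a b c d; apply: dvdp_mul.
  by move=> l _; apply: dvdp_exp2l; apply: count_size.
exists (undup rs), (fun l => polymx A (e l)), N; split.
- exact: undup_uniq.
- by move=> l; rewrite mem_undup rsP root_prod_XsubC.
- rewrite -polymx_sum; apply/eqP; rewrite -subr_eq0 -(polymx1 A) -polymxB.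
  by rewrite polyP.
- by move=> l _; exists (e l).
- move=> l ls; rewrite -polymx_XsubC_exp -polymxM.
  by apply: polyP; rewrite mulrC; apply: eP.
Qed.

(** Kernels of powers of distinct ['X - l%:P] meet trivially. The second conclusion is a functional
    calculus: weighting the projections by [phi] gives a matrix acting as the scalar [phi l] on
    generalized eigenvectors for [l]. *)
Lemma spectral_orthogonal (s : seq C) (e : C -> 'M[C]_n) (N : nat) :
    uniq s -> \sum_(l <- s) e l = 1%:M ->
    (forall l, l \in s -> exists p, e l = polymx A p) ->
    (forall l, l \in s -> e l *m (A - l%:M) ^+ N = 0) ->
  (forall l m, l \in s -> m \in s -> e l *m e m = if l == m then e l else 0) /\
  forall k (u : 'M[C]_(k, n)) l a, u *m (A - l%:M) ^+ a = 0 ->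
    forall phi : C -> C, u *m (\sum_(m <- s) phi m *: e m) = phi l *: u.
Proof.
move=> us e1 eP eN.
have orth k (u : 'M[C]_(k, n)) l m a : u *m (A - l%:M) ^+ a = 0 -> m \in s ->
    m != l -> u *m e m = 0.
  move=> ua ms ml; apply: (@polymx_coprime _ _ A _ _ _ _ (@coprimep_XsubC_exp l m a N _)).
    by rewrite eq_sym.
    have [p ->] := eP m ms.
    by rewrite -mulmxA polymxCC mulmxA polymx_XsubC_exp ua mul0mx.
  by rewrite -mulmxA polymx_XsubC_exp eN ?mulmx0.
have calc k (u : 'M[C]_(k, n)) l a : u *m (A - l%:M) ^+ a = 0 ->
    forall phi : C -> C, u *m (\sum_(m <- s) phi m *: e m) = phi l *: u.
  move=> ua phi; rewrite -[in RHS](mulmx1 u) -e1 !mulmx_sumr scaler_sumr.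
  apply: eq_big_seq => m ms; rewrite -scalemxAr.
  have [->//|ml] := eqVneq m l.
  by rewrite (orth _ _ _ _ _ ua) // !scaler0.
split=> [l m ls ms|]; last exact: calc.
have [<-|lm] := eqVneq l m; last first.
  by apply: (orth _ _ l m N) => //; [apply: eN|rewrite eq_sym].
rewrite -[RHS]mulmx1 -e1 mulmx_sumr (bigD1_seq l) //= big_seq_cond.
rewrite big1 ?addr0 // => m' /andP[m's m'l].
by apply: (orth _ _ _ _ N (eN l ls)).
Qed.

End ClosedSpectral.

(** * Lie algebras in coordinates *)

Section StructureMatrices.
Variables (B : comNzRingType) (n : nat) (A : 'I_n -> 'M[B]_n).
Implicit Types (u v : 'rV[B]_n) (M : 'M[B]_n).

(* [u, v] = v *m adm u, so that ad is an antihomomorphism. *)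
Definition adm u : 'M[B]_n := \sum_i u 0 i *: A i.

(** Antisymmetry and the Jacobi identity on basis vectors: [row j (A i)] is the bracket of the
    [i]-th with the [j]-th one. *)
Record lie_structure : Prop := LieStructure {
  lie_structure_anti : forall i j, row j (A i) = - row i (A j) ;
  lie_structure_br : forall i j,
    adm (row j (A i)) = A j *m A i - A i *m A j
}.

Definition killing_mx : 'M[B]_n := \matrix_(i, j) \tr (A i *m A j).

Definition is_derivation M : Prop :=
  forall u, adm (u *m M) = adm u *m M - M *m adm u.

Lemma admD u v : adm (u + v) = adm u + adm v.
Proof.
by rewrite /adm -big_split; apply: eq_bigr => i _; rewrite mxE scalerDl.
Qed.

Lemma admZ a u : adm (a *: u) = a *: adm u.
Proof. by rewrite /adm scaler_sumr; apply: eq_bigr => i _; rewrite mxE scalerA. Qed.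

Lemma adm0 : adm 0 = 0.
Proof. by rewrite -(scale0r 0) admZ scale0r. Qed.

Lemma admN u : adm (- u) = - adm u.
Proof. by rewrite -!scaleN1r admZ. Qed.

Lemma admB u v : adm (u - v) = adm u - adm v.
Proof. by rewrite admD admN. Qed.

Lemma adm_sum (I : Type) (r : seq I) (P : pred I) (F : I -> 'rV[B]_n) :
  adm (\sum_(i <- r | P i) F i) = \sum_(i <- r | P i) adm (F i).
Proof. by elim/big_rec2: _ => [|i x y _ <-]; rewrite ?adm0 ?admD. Qed.

Lemma adm_delta i : adm (delta_mx 0 i) = A i.
Proof.
rewrite /adm (bigD1 i) //= mxE !eqxx scale1r big1 ?addr0 // => j /negPf ji.
by rewrite mxE ji andbF scale0r.
Qed.

Lemma tr_admM u v :
  \tr (adm u *m adm v) = (u *m killing_mx *m v^T) 0 0.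
Proof.
rewrite -mulmxA mxE mulmx_suml raddf_sum; apply: eq_bigr => i _ /=.
rewrite -scalemxAl mxtraceZ; congr (_ * _).
rewrite mulmx_sumr raddf_sum mxE; apply: eq_bigr => j _ /=.
by rewrite -scalemxAr mxtraceZ !mxE mulrC.
Qed.

(** Derivations are skew for the Killing form, by cyclicity of the trace. *)
Lemma derivation_killing M u v : is_derivation M ->
  \tr (adm (u *m M) *m adm v) = - \tr (adm u *m adm (v *m M)).
Proof.
move=> dM; rewrite !dM mulmxBl mulmxBr !raddfB /= opprK addrC.
rewrite -[M *m _ *m _]mulmxA [\tr (M *m _)]mxtrace_mulC.
by rewrite !mulmxA.
Qed.

Hypothesis LA : lie_structure.

Lemma mul_adm_anti u v : v *m adm u = - (u *m adm v).
Proof.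
rewrite [u in LHS]matrix_sum_delta [v in LHS]matrix_sum_delta !big_ord1.
rewrite [u in RHS]matrix_sum_delta [v in RHS]matrix_sum_delta !big_ord1.
rewrite !adm_sum !mulmx_suml -sumrN.
rewrite (eq_bigr (fun i => \sum_j u 0 j *: (v 0 i *: row i (A j)))); last first.
  move=> i _; rewrite mulmx_sumr; apply: eq_bigr => j _.
  by rewrite admZ adm_delta -scalemxAl -scalemxAr -rowE scalerA mulrC -scalerA.
rewrite exchange_big; apply: eq_bigr => j _ /=; rewrite mulmx_sumr -sumrN.
apply: eq_bigr => i _; rewrite admZ adm_delta -scalemxAl -scalemxAr -rowE.
by rewrite (lie_structure_anti LA) !scalerN.
Qed.

Lemma adm_br u v : adm (v *m adm u) = adm v *m adm u - adm u *m adm v.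
Proof.
rewrite [v in LHS]matrix_sum_delta big_ord1 mulmx_suml adm_sum.
rewrite [v in RHS]matrix_sum_delta big_ord1 adm_sum mulmx_suml mulmx_sumr -sumrB.
apply: eq_bigr => j _; rewrite !admZ -!scalemxAl admZ -scalemxAr -scalerBr.
congr (_ *: _); rewrite adm_delta.
rewrite [u in LHS]matrix_sum_delta big_ord1 adm_sum mulmx_sumr adm_sum.
rewrite [u in RHS]matrix_sum_delta big_ord1 adm_sum mulmx_suml mulmx_sumr -sumrB.
apply: eq_bigr => i _; rewrite !admZ -!scalemxAr -scalemxAl -scalerBr !admZ.
by rewrite !adm_delta -rowE (lie_structure_br LA).
Qed.

Lemma adm_derivation u : is_derivation (adm u).
Proof. by move=> v; apply: adm_br. Qed.

Lemma adm_killing u : adm u *m killing_mx = - (killing_mx *m (adm u)^T).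
Proof.
apply/matrixP => i j.
have entryE (M : 'M[B]_n) :
    M i j = ((delta_mx 0 i : 'rV_n) *m M *m (delta_mx 0 j : 'rV_n)^T) 0 0.
  by rewrite trmx_delta -colE -rowE !mxE.
have := derivation_killing (delta_mx 0 i) (delta_mx 0 j) (adm_derivation u).
rewrite !tr_admM trmx_mul => E.
rewrite [LHS]entryE mulmxA E [RHS]mxE; congr (- _).
by rewrite [RHS]entryE !mulmxA.
Qed.


End StructureMatrices.

Lemma map_adm (B B' : comNzRingType) (f : {rmorphism B -> B'}) n
    (A : 'I_n -> 'M[B]_n) u :
  map_mx f (adm A u) = adm (fun i => map_mx f (A i)) (map_mx f u).
Proof.
rewrite /adm raddf_sum; apply: eq_bigr => i _ /=.
by rewrite map_mxZ mxE.
Qed.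

Lemma map_killing_mx (B B' : comNzRingType) (f : {rmorphism B -> B'}) n
    (A : 'I_n -> 'M[B]_n) :
  map_mx f (killing_mx A) = killing_mx (fun i => map_mx f (A i)).
Proof. by apply/matrixP => i j; rewrite !mxE -map_mxM trace_map_mx. Qed.

Lemma map_lie_structure (B B' : comNzRingType) (f : {rmorphism B -> B'}) n
    (A : 'I_n -> 'M[B]_n) :
  lie_structure A -> lie_structure (fun i => map_mx f (A i)).
Proof.
case=> antiA brA; split=> i j; first by rewrite -!map_row antiA map_mxN.
by rewrite -map_row -map_adm brA map_mxB !map_mxM.
Qed.

(** * Generalized weights and derivations over an algebraically closed field *)

Section ClosedLie.
Variables (C : numClosedFieldType) (n : nat) (A : 'I_n -> 'M[C]_n).
Hypothesis LA : lie_structure A.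

(** Weights add under the bracket: [ad z - (l + m)] applied to the bracket of [u] and [v] is a sum
    of two brackets, in which either [a] or [b] has decreased. *)
Lemma genspace_br z (u v : 'rV[C]_n) l m a b :
  u *m (adm A z - l%:M) ^+ a = 0 -> v *m (adm A z - m%:M) ^+ b = 0 ->
  v *m adm A u *m (adm A z - (l + m)%:M) ^+ (a + b) = 0.
Proof.
elim: a b u v => [|a IHa] b.
  by move=> u v; rewrite mulmx1 => -> _; rewrite adm0 mulmx0 mul0mx.
elim: b => [|b IHb] u v ua vb.
  by move: vb; rewrite mulmx1 => ->; rewrite !mul0mx.
have pS k (M : 'M[C]_n) (w : 'rV_n) : w *m M ^+ k.+1 = w *m M *m M ^+ k.
  by rewrite exprS -mulmxA.
rewrite addSn pS.
have -> : v *m adm A u *m (adm A z - (l + m)%:M) =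
    v *m adm A (u *m (adm A z - l%:M)) + v *m (adm A z - m%:M) *m adm A u.
  rewrite !mulmxBr !mulmxBl admB (adm_br LA) !mul_mx_scalar admZ !mulmxBr.
  rewrite -scalemxAr -scalemxAl scalerDl !mulmxA opprD.
  by rewrite addrA [RHS]addrA [in RHS](addrAC _ _ (v *m adm A z *m adm A u)) subrK.
rewrite mulmxDl IHa -?pS // add0r.
by rewrite addnS -addSn IHb // -pS.
Qed.

(** Since weights add under the bracket, additivity of [phi] is the derivation rule. It serves with
    complex conjugation and with the identity. *)
Lemma functional_derivation z (s : seq C) (e : C -> 'M[C]_n) N :
    uniq s -> \sum_(l <- s) e l = 1%:M ->
    (forall l, l \in s -> exists p, e l = polymx (adm A z) p) ->
    (forall l, l \in s -> e l *m (adm A z - l%:M) ^+ N = 0) ->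
  forall phi : C -> C, (forall x y, phi (x + y) = phi x + phi y) ->
  is_derivation A (\sum_(m <- s) phi m *: e m).
Proof.
move=> us e1 eP eN phi phiD.
have [_ calc] := spectral_orthogonal us e1 eP eN.
have calcM := fun k w l a h => calc k w l a h phi.
move: (\sum_(m <- s) _) calcM => M calcM {calc}.
suff brM (u v : 'rV[C]_n) :
    v *m adm A u *m M = v *m adm A (u *m M) + v *m M *m adm A u.
  move=> u; apply/row_matrixP => i; rewrite [LHS]rowE [RHS]rowE.
  by rewrite mulmxBr !mulmxA brM addrK.
have decomp (w : 'rV[C]_n) : w = \sum_(l <- s) w *m e l.
  by rewrite -mulmx_sumr e1 mulmx1.
rewrite {1 2 3}(decomp u) mulmx_suml !adm_sum !mulmx_sumr mulmx_suml -big_split.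
apply: eq_big_seq => l ls /=.
rewrite {1 2 3}(decomp v) !mulmx_suml -big_split.
apply: eq_big_seq => m ms /=.
have ul : u *m e l *m (adm A z - l%:M) ^+ N = 0 by rewrite -mulmxA eN ?mulmx0.
have vm : v *m e m *m (adm A z - m%:M) ^+ N = 0 by rewrite -mulmxA eN ?mulmx0.
rewrite (calcM _ _ _ _ (genspace_br ul vm)) (calcM _ _ _ _ ul) (calcM _ _ _ _ vm).
by rewrite admZ -scalemxAr -scalemxAl -scalerDl phiD.
Qed.

(** For the derivation given by complex conjugation, the trace is the sum of the
    [|l|^2 * \rank (e l)]. These terms are nonnegative, so only the eigenvalue 0 remains. *)
Lemma trace_derivation_nilpotent z :
  (forall M, is_derivation A M -> \tr (M *m adm A z) = 0) ->
  exists N, adm A z ^+ N = 0.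
Proof.
move=> trM; set Z := adm A z.
have [s [e [N [us rs e1 eP eN]]]] := spectral_idempotents Z.
have dM := functional_derivation us e1 eP eN (rmorphD Num.conj).
have [orth _] := spectral_orthogonal us e1 eP eN.
have trE l : l \in s -> \tr (e l *m Z) = l * (\rank (e l))%:R.
  move=> ls; have ee := orth l l ls ls; rewrite eqxx in ee.
  rewrite -(subrK l%:M Z) mulmxDr raddfD /= mul_mx_scalar mxtraceZ.
  rewrite (mxtrace_idempotent ee) (@mxtrace_nilpotent _ _ _ N.+1) ?add0r //.
  have [p eE] := eP l ls.
  have comm : GRing.comm (e l) (Z - l%:M).
    rewrite /GRing.comm eE; apply: polymx_comm.
    by rewrite mulmxBr mulmxBl mul_mx_scalar mul_scalar_mx.
  rewrite -[_ *m _]/(_ * _) exprMn_comm // !exprSr mulrA.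
  by rewrite -(mulrA _ (e l)) -[e l * _]/(e l *m _) eN // mulr0 mul0r.
have := trM _ dM; rewrite mulmx_suml raddf_sum /=.
rewrite big_seq (eq_bigr (fun l => `|l| ^+ 2 * (\rank (e l))%:R)); last first.
  by move=> l ls; rewrite -scalemxAl mxtraceZ trE // normCKC mulrA.
move=> /eqP; rewrite psumr_eq0; last first.
  by move=> l _; rewrite mulr_ge0 ?exprn_ge0 ?ler0n.
move=> /allP s0; exists N; rewrite -[LHS]mul1mx -e1 mulmx_suml.
apply: big1_seq => l /andP[_ ls].
have := s0 l ls; rewrite ls /= mulf_eq0 expf_eq0 /= normr_eq0 pnatr_eq0 mxrank_eq0.
move=> /orP[/eqP l0|/eqP ->]; last by rewrite mul0mx.
by have := eN l ls; rewrite l0 raddf0 subr0.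
Qed.

End ClosedLie.

Section NondegenerateKilling.
Variables (F : fieldType) (n : nat) (A : 'I_n -> 'M[F]_n).
Hypotheses (LA : lie_structure A) (Ku : killing_mx A \in unitmx).

Lemma row_killing_eq0 (c : 'rV[F]_n) :
  (forall v : 'rV[F]_n, (c *m v^T) 0 0 = 0) -> c = 0.
Proof.
move=> c0; apply/rowP => i; have := c0 (delta_mx 0 i).
by rewrite trmx_delta -colE !mxE.
Qed.

Lemma killing_nondegenerate (u : 'rV[F]_n) :
  (forall v, \tr (adm A u *m adm A v) = 0) -> u = 0.
Proof.
move=> u0; have: u *m killing_mx A = 0.
  by apply: row_killing_eq0 => v; rewrite -tr_admM.
by move/(congr1 (mulmx^~ (invmx (killing_mx A)))); rewrite mulmxK // mul0mx.
Qed.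

Lemma adm_inj (u : 'rV[F]_n) : adm A u = 0 -> u = 0.
Proof. by move=> u0; apply: killing_nondegenerate => v; rewrite u0 mul0mx mxtrace0. Qed.

Lemma tr_derivation_br M (u v : 'rV[F]_n) : is_derivation A M ->
  \tr (M *m adm A (v *m adm A u)) = \tr (adm A (u *m M) *m adm A v).
Proof.
move=> dM; rewrite dM (adm_br LA) mulmxBr mulmxBl !raddfB /= !mulmxA.
by rewrite [\tr (M *m adm A v *m _)]mxtrace_mulC mulmxA.
Qed.

(** Nondegeneracy represents the functional [v |-> \tr (M *m adm A v)] by some [d]. The derivation
    [M - adm A d] is then trace-orthogonal to every [ad v], and [tr_derivation_br] makes its values
    orthogonal to the whole algebra. *)
Lemma derivation_inner M : is_derivation A M -> exists d, adm A d = M.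
Proof.
move=> dM; pose c : 'rV[F]_n := \row_i \tr (M *m A i).
pose d := c *m invmx (killing_mx A).
have trE v : \tr ((M - adm A d) *m adm A v) = 0.
  rewrite mulmxBl raddfB /= tr_admM /d mulmxKV //.
  apply/eqP; rewrite subr_eq0; apply/eqP.
  rewrite /adm mulmx_sumr raddf_sum mxE; apply: eq_bigr => i _ /=.
  by rewrite -scalemxAr mxtraceZ [v^T _ _]mxE [c _ _]mxE mulrC.
exists d; apply/esym/eqP; rewrite -subr_eq0; apply/eqP.
have dE : is_derivation A (M - adm A d).
  move=> u; rewrite mulmxBr admB dM (adm_br LA) mulmxBr mulmxBl.
  by rewrite !opprD !opprK addrACA.
apply/row_matrixP => i; rewrite row0 rowE; apply: killing_nondegenerate => v.
by rewrite -tr_derivation_br.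
Qed.

(** Invariance of the Killing form: the image of [ad x] is the orthogonal of the centralizer of
    [x]. *)
Lemma adm_cokernel (x c : 'rV[F]_n) :
    (forall y : 'rV[F]_n, adm A x *m adm A y = adm A y *m adm A x ->
       \tr (adm A c *m adm A y) = 0) ->
  (c <= adm A x)%MS.
Proof.
move=> c0; rewrite submxE; apply/eqP/matrixP => i j; rewrite ord1 [RHS]mxE.
(* The Killing dual of a column of the cokernel matrix: it centralizes [x], and pairing with it
   reads off one coordinate of [c *m cokermx (adm A x)]. *)
pose y := (invmx (killing_mx A) *m (cokermx (adm A x) *m delta_mx j 0 : 'cV_n))^T.
have yE : killing_mx A *m y^T = (cokermx (adm A x) *m delta_mx j 0 : 'cV_n).
  by rewrite trmxK mulKVmx.
have -> : (c *m cokermx (adm A x)) 0 j = \tr (adm A c *m adm A y).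
  by rewrite tr_admM -mulmxA yE [c *m (_ *m delta_mx _ _)]mulmxA -colE [RHS]mxE.
apply: c0; have yx : y *m adm A x = 0.
  apply: trmx_inj; rewrite trmx_mul trmx0.
  apply: (can_inj (mulKmx Ku)).
  apply: oppr_inj; rewrite mulmxA mulmx0 oppr0 -mulNmx -adm_killing //.
  by rewrite -mulmxA yE [adm A x *m (_ *m delta_mx _ _)]mulmxA mulmx_coker mul0mx.
by apply/eqP; rewrite -subr_eq0 -opprB -(adm_br LA) yx adm0 oppr0.
Qed.

End NondegenerateKilling.

(** * Jordan decomposition inside the Lie algebra *)

Section JordanDecomposition.
Variables (C : numClosedFieldType) (n : nat) (A : 'I_n -> 'M[C]_n).
Hypotheses (LA : lie_structure A) (Ku : killing_mx A \in unitmx).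

(** The commutator with [H] is a derivation sending [X] to [N], and [N] commutes with [X]. *)
Lemma polymx_bracket (X H N : 'M[C]_n) p :
  X *m H - H *m X = N -> X *m N = N *m X ->
  polymx X p *m H - H *m polymx X p = polymx X p^`() *m N.
Proof.
move=> XH XN; elim/poly_ind: p => [|p c IHp].
  by rewrite deriv0 !polymx0 !mul0mx mulmx0 subr0.
rewrite derivD derivC addr0 derivM derivX mulr1 !polymxD !polymxM polymxX.
rewrite polymxC mulmxDl mulmxDr mul_mx_scalar mul_scalar_mx opprD addrACA subrr addr0.
rewrite mulmxDl -[Z in _ = Z + _]mulmxA XN [Z in _ = Z + _]mulmxA -IHp mulmxBl -XH mulmxBr.
by rewrite !mulmxA [RHS]addrC addrA subrK.
Qed.

(* The element h integrates to the flow s + n |-> s + exp(t) n, which is why  *)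
(* s lies in the Zariski closure of every orbit containing s + n.             *)
Lemma jordan_flow (x : 'rV[C]_n) : exists s h : 'rV[C]_n,
  [/\ s *m adm A h = 0, (x - s) *m adm A h = x - s &
      forall q : {poly C}, (forall l, root (char_poly (adm A x)) l -> root q l) ->
        polymx (adm A s) q = 0].
Proof.
set X := adm A x.
have [ev [e [N [us rs e1 eP eN]]]] := spectral_idempotents X.
have [orth calc] := spectral_orthogonal us e1 eP eN.
(* The semisimple part of [ad x] is a derivation, hence equals [ad s] for some [s]. *)
have dS := functional_derivation LA us e1 eP eN (phi := id) (fun _ _ => erefl).
have [s sE] := derivation_inner LA Ku dS.
have eS l : l \in ev -> e l *m adm A s = l *: e l.
  by move=> ls; rewrite sE (calc _ _ _ _ (eN l ls)).
have XSP : exists p, adm A s = polymx X p.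
  have /choice[f fP] : forall l, exists p, l \in ev -> e l = polymx X p.
    by move=> l; have [/eP[p ->]|_] := boolP (l \in ev); [exists p|exists 0].
  exists (\sum_(l <- ev) l *: f l); rewrite sE polymx_sum; apply: eq_big_seq => l ls.
  by rewrite polymxZ fP.
have [pS SE] := XSP.
pose c := x - s; have cE : adm A c = polymx X ('X - pS).
  by rewrite admB polymxB polymxX SE.
have cN : adm A c ^+ N = 0.
  rewrite -[LHS]mul1mx -e1 mulmx_suml big1_seq // => l /andP[_ ls].
  suff -> k : e l *m adm A c ^+ k = e l *m (X - l%:M) ^+ k by apply: eN.
  have comm : adm A c *m (X - l%:M) ^+ k = (X - l%:M) ^+ k *m adm A c.
    by rewrite -polymx_XsubC_exp cE polymxCC.
  elim: k comm => // k IHk comm; rewrite exprSr -[_ * _]/(_ *m _) mulmxA.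
  rewrite IHk; last by rewrite -polymx_XsubC_exp cE polymxCC.
  rewrite -mulmxA -polymx_XsubC_exp cE polymxCC -cE polymx_XsubC_exp mulmxA.
  have -> : e l *m adm A c = e l *m (X - l%:M).
    by rewrite admB !mulmxBr eS // mul_mx_scalar.
  by rewrite -mulmxA exprS.
(* For [y] centralizing [x], the nilpotent [ad c] commutes with [ad y], so their product has trace
   zero. Hence [c] is orthogonal to the centralizer of [x]. *)
have [h' hE] : exists h', c = h' *m X.
  apply/submxP; apply: (adm_cokernel LA Ku) => y Xy.
  apply: (@mxtrace_nilpotent _ _ _ N).
  rewrite -[_ *m _]/(_ * _) exprMn_comm ?cN ?mul0r //.
  by rewrite /GRing.comm cE; apply: polymx_comm.
pose h := - h'; exists s, h.
have xh : x *m adm A h = c.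
  by rewrite (mul_adm_anti LA) mulNmx opprK hE.
have XH : X *m adm A h - adm A h *m X = adm A c.
  by rewrite -(adm_br LA) xh.
have Xc : X *m adm A c = adm A c *m X.
  by rewrite cE polymx_comm.
(* The commutator [d] of [e l] with [ad h] commutes with [e l], and differentiating the idempotent
   gives [d = 2 (e l) d]; thus [d = 0]. This is why [h] centralizes [s]. *)
have eH l : l \in ev -> e l *m adm A h = adm A h *m e l.
  move=> ls; have [p eE] := eP l ls.
  have := polymx_bracket p XH Xc; rewrite -eE.
  set d := _ *m adm A c => dE.
  have ed : e l *m d = d *m e l.
    by rewrite /d cE -polymxM eE polymxCC.
  have ee := orth l l ls ls; rewrite eqxx in ee.
  have d2 : d = e l *m d + e l *m d.
    rewrite {2}ed -dE mulmxBr mulmxBl !mulmxA ee.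
    by rewrite addrA subrK -!mulmxA ee.
  have ed0 : e l *m d = 0.
    have := congr1 (mulmx (e l)) d2; rewrite mulmxDr !mulmxA ee.
    by move/eqP; rewrite -subr_eq0 opprD addNKr oppr_eq0 => /eqP.
  by apply/eqP; rewrite -subr_eq0 dE d2 ed0 addr0.
have sh : s *m adm A h = 0.
  apply: (adm_inj Ku); rewrite (adm_br LA) sE mulmx_suml mulmx_sumr.
  rewrite -sumrB big1_seq // => l /andP[_ ls].
  by rewrite -scalemxAl -scalemxAr eH ?subrr.
split=> //; first by rewrite mulmxBl xh sh subr0.
move=> q rq; rewrite -[LHS]mul1mx -e1 mulmx_suml big1_seq // => l /andP[_ ls].
suff eq p : e l *m polymx (adm A s) p = p.[l] *: e l.
  by rewrite eq (rootP (rq l (rs l ls))) scale0r.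
elim/poly_ind: p => [|p a IHp]; first by rewrite polymx0 mulmx0 horner0 scale0r.
rewrite polymxD polymxM polymxX polymxC mulmxDr mulmxA IHp -scalemxAl eS //.
by rewrite hornerD hornerM hornerX hornerC mul_mx_scalar scalerA -scalerDl.
Qed.

End JordanDecomposition.

Section MpolyGeneration.
Variables (n : nat) (R : comNzRingType).

Lemma mpoly_gen_ind (P : mpoly n R -> Prop) :
  (forall c, P (mpolyC n c)) -> (forall i, P (mpolyX R (mnm1 i))) ->
  (forall p q, P p -> P q -> P (p + q)) ->
  (forall p q, P p -> P q -> P (p * q)) -> forall p, P p.
Proof.
move=> PC PX PD PM p; rewrite [p]mpolyE.
have P0 : P 0 by rewrite -[0](@mpolyC0 n R).
have P1 : P 1 by rewrite -[1](@mpolyC1 n R).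
apply: big_ind => // m _; rewrite -mul_mpolyC; apply: (PM) => //.
rewrite mpolyXE_id; apply: big_ind => // i _.
by move: (fun_of_multinom m i) => k; elim: k => [|k IHk]; rewrite ?expr0 // exprS; apply: PM.
Qed.

Lemma mderivXU (i j : 'I_n) :
  mderiv i (mpolyX R (mnm1 j)) = (i == j)%:R.
Proof.
rewrite mderivX mnm1E eq_sym; case: eqP => [->|_]; last by rewrite scale0r.
rewrite (_ : mnm_sub _ _ = mnm0) ?mpolyX0 ?scale1r //.
by apply/mnmP => k; rewrite mnmBE subnn mnm0E.
Qed.

End MpolyGeneration.

(** * Hamiltonian derivations *)

Section CoordinatePoisson.
Variables (R : fieldType) (n : nat) (A : 'I_n -> 'M[R]_n).
Hypotheses (LA : lie_structure A) (Ku : killing_mx A \in unitmx).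
Local Notation S := (mpoly n R).
Local Notation X i := (mpolyX R (mnm1 i) : S).
Local Notation toS := (@mpolyC n R).
Local Notation K := (killing_mx A).

(** The bracket of the [i]-th and [j]-th basis vectors, as a linear function on the dual. *)
Definition struct_poly (i j : 'I_n) : S := \sum_k A i j k *: X k.

(** The Hamiltonian derivation of the [i]-th coordinate function; see [poisson_ham]. *)
Definition ham (i : 'I_n) (f : S) : S := \sum_j mderiv j f * struct_poly i j.

Lemma ham0 i : ham i 0 = 0.
Proof. by rewrite /ham big1 // => j _; rewrite mderiv0 mul0r. Qed.

Lemma hamC i c : ham i (mpolyC n c) = 0.
Proof. by rewrite /ham big1 // => j _; rewrite mderivC mul0r. Qed.

Lemma hamX i k : ham i (X k) = struct_poly i k.
Proof.
rewrite /ham (bigD1 k) //= big1 => [|j /negPf jk].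
  by rewrite mderivXU eqxx mul1r addr0.
by rewrite mderivXU jk mul0r.
Qed.

(** The generic point of the dual, carried to the Lie algebra by the Killing form; [pt_vec] is its
    value at one point. *)
Definition gen_vec : 'rV[S]_n := (\row_k X k) *m map_mx toS (invmx K).
Definition gen_ad : 'M[S]_n := adm (fun i => map_mx toS (A i)) gen_vec.

Definition pt_vec (p : 'I_n -> R) : 'rV[R]_n := (\row_k p k) *m invmx K.

Lemma gen_adE p : map_mx (meval p) gen_ad = adm A (pt_vec p).
Proof.
rewrite /gen_ad map_adm.
have mevalmapK m (M : 'M[R]_(m, n)) : map_mx (meval p) (map_mx toS M) = M.
  by apply/matrixP => i j; rewrite !mxE /= mevalC.
congr (adm _ _); first by apply/funext => i; apply: mevalmapK.
rewrite map_mxM mevalmapK /pt_vec; congr (_ *m _).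
by apply/rowP => k; rewrite !mxE /= mevalXU.
Qed.

Lemma hamD i f h : ham i (f + h) = ham i f + ham i h.
Proof.
by rewrite /ham -big_split; apply: eq_bigr => j _; rewrite mderivD mulrDl.
Qed.

Lemma hamM i f h : ham i (f * h) = ham i f * h + f * ham i h.
Proof.
rewrite /ham mulr_suml mulr_sumr -big_split; apply: eq_bigr => j _ /=.
by rewrite mderivM; ring.
Qed.

(** By invariance of the Killing form, both sides are the generic point evaluated at the bracket of
    the [j]-th and [i]-th basis vectors. *)
Lemma gen_ad_killing j i :
  (gen_ad *m map_mx toS K) j i = - struct_poly i j.
Proof.
pose AS i := map_mx toS (A i).
have LAS : lie_structure AS by exact: (map_lie_structure (@mpolyC n R) LA).
have ->: (gen_ad *m map_mx toS K) j i =
    ((delta_mx 0 j : 'rV_n) *m gen_ad *m map_mx toS K) 0 i.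
  by rewrite -mulmxA -rowE [RHS]mxE.
have AK : map_mx toS (invmx K) *m (AS j *m map_mx toS K) = - (AS j)^T.
  have AK : A j *m K = - (K *m (A j)^T).
    by have := adm_killing LA (delta_mx 0 j); rewrite adm_delta.
  by rewrite -!map_mxM AK mulmxN mulKmx // map_mxN map_trmx.
have -> : (delta_mx 0 j : 'rV_n) *m gen_ad *m map_mx toS K =
    (\row_k X k) *m (AS j)^T.
  rewrite /gen_ad (mul_adm_anti LAS) adm_delta /gen_vec !mulNmx -!mulmxA AK.
  by rewrite mulmxN opprK.
rewrite mxE -sumrN; apply: eq_bigr => k _.
rewrite !mxE -mul_mpolyC mulrC -mulNr -mpolyCN; congr (mpolyC _ _ * _).
have /rowP/(_ k) := lie_structure_anti LA i j.
by rewrite !mxE => ->; rewrite opprK.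
Qed.

(** * Conormal space of a semisimple orbit *)

Section TangentSpace.
Variables (q q1 al be : {poly R}).
Hypotheses (qE : q = 'X * q1) (bez : al * q + be * q^`() = 1).

Definition mapq (p : {poly R}) : {poly S} := map_poly toS p.

(** On a matrix annihilated by [q], this polynomial gives the projection onto the kernel: it is 1 at
    0 and vanishes at the other roots of [q]. *)
Definition proj_ker : {poly R} := (q1.[0])^-1 *: q1.

Definition gen_min : 'M[S]_n := polymx gen_ad (mapq q).
Definition gen_ker : 'M[S]_n := polymx (- gen_ad) (mapq proj_ker).
(** The weights that recombine the partial derivatives of [gen_min] into row [j] of [gen_ker]; see
    [tangent_relation_at]. *)
Definition gen_W (j : 'I_n) : 'M[S]_n :=
  polymx gen_ad (mapq be) *m adm (fun i => map_mx toS (A i)) (row j gen_ker).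

Lemma map_meval_polymx p (M : 'M[S]_n) h :
  map_mx (meval p) (polymx M (mapq h)) = polymx (map_mx (meval p) M) h.
Proof.
rewrite map_polymx; congr polymx; rewrite /mapq -map_poly_comp.
by rewrite (eq_map_poly (g := idfun)) ?map_poly_id // => c /=; rewrite mevalC.
Qed.

(** The transpose of [ad u] for the Killing form is [- ad u]. *)
Lemma polymx_opp (u : 'rV[R]_n) :
  polymx (adm A u) q = 0 -> polymx (- adm A u) q = 0.
Proof.
set Y := adm A u => q0.
have YK := adm_killing LA u; rewrite -/Y in YK.
have E h : polymx Y h *m K = K *m (polymx (- Y) h)^T.
  elim/poly_ind: h => [|h c IH]; first by rewrite !polymx0 trmx0 mul0mx mulmx0.
  rewrite !polymxD !polymxM !polymxX !polymxC linearD /= trmx_mul tr_scalar_mx.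
  rewrite mulmxDl mulmxDr mul_scalar_mx mul_mx_scalar; congr (_ + _).
  rewrite polymx_comm // -mulmxA IH mulmxA YK.
  by rewrite [(- Y)^T]raddfN /= !mulNmx mulmxN mulmxA.
have := E q; rewrite q0 mul0mx => /esym/(congr1 (mulmx (invmx K))).
by rewrite mulKmx // mulmx0 => /(congr1 trmx); rewrite trmxK trmx0.
Qed.

Section AtPoint.
Variable p : 'I_n -> R.
Let Y := adm A (pt_vec p).
Hypothesis q0 : polymx Y q = 0.

Lemma ker_row_comm (y : 'rV[R]_n) :
  adm A (y *m polymx (- Y) proj_ker) *m Y = Y *m adm A (y *m polymx (- Y) proj_ker).
Proof.
apply/eqP; rewrite -subr_eq0 -(adm_br LA) -mulmxA.
suff -> : polymx (- Y) proj_ker *m Y = 0 by rewrite mulmx0 adm0.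
have := polymx_opp q0; rewrite qE polymxM polymxX mulNmx => /eqP.
rewrite oppr_eq0 => /eqP Yq; rewrite polymxZ -scalemxAl.
by rewrite polymx_comm ?Yq ?scaler0 // mulNmx mulmxN.
Qed.

(** Under the trace against a matrix commuting with [Y], a polynomial in [ad x] is differentiated as
    in one commuting variable. The vector [row k (invmx K)] is the [k]-th partial derivative of
    [gen_vec]. *)
Lemma tr_mderiv_polymx k (h : {poly R}) (W : 'M[R]_n) : Y *m W = W *m Y ->
  \tr (map_mx (fun f => meval p (mderiv k f)) (polymx gen_ad (mapq h)) *m W) =
  \tr (polymx Y h^`() *m adm A (row k (invmx K)) *m W).
Proof.
set d := fun f => _.
have dD f f2 : d (f + f2) = d f + d f2 by rewrite /d mderivD mevalD.
have dC c : d (mpolyC n c) = 0 by rewrite /d mderivC meval0.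
have d0 : d 0 = 0 by rewrite -(dC 0) mpolyC0.
have dsum (F : 'I_n -> S) : d (\sum_i F i) = \sum_i d (F i).
  by elim/big_rec2: _ => [|l x z _ <-]; rewrite ?d0 ?dD.
have dMC f c : d (f * mpolyC n c) = d f * c.
  by rewrite /d mderivM mderivC mulr0 addr0 mevalM mevalC.
have dM (M N : 'M[S]_n) : map_mx d (M *m N) =
    map_mx d M *m map_mx (meval p) N + map_mx (meval p) M *m map_mx d N.
  apply/matrixP => i j; rewrite !mxE dsum -big_split; apply: eq_bigr => l _ /=.
  by rewrite /d mderivM mevalD !mevalM !mxE.
have dX : map_mx d gen_ad = adm A (row k (invmx K)).
  apply/matrixP => i j; rewrite /gen_ad /adm mxE !summxE dsum.
  apply: eq_bigr => l _; rewrite !mxE dMC dsum; congr (_ * _).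
  rewrite (bigD1 k) //= big1 => [|m /negPf mk].
    by rewrite !mxE dMC /d mderivXU eqxx meval1 mul1r addr0.
  by rewrite !mxE dMC /d mderivXU eq_sym mk meval0 mul0r.
elim/poly_ind: h W => [|h c IH] W YW.
  rewrite deriv0 !polymx0 mul0mx mul0mx.
  rewrite (_ : map_mx d _ = 0) ?mul0mx //.
  by apply/matrixP => i j; rewrite /mapq rmorph0 polymx0 !mxE d0.
have -> : map_mx d (polymx gen_ad (mapq (h * 'X + c%:P))) =
    map_mx d (polymx gen_ad (mapq h)) *m Y +
    polymx Y h *m adm A (row k (invmx K)).
  rewrite /mapq rmorphD rmorphM /= map_polyX map_polyC /=.
  rewrite polymxD polymxM polymxX polymxC -dX.
  have -> : map_mx d (polymx gen_ad (map_poly toS h) *m gen_ad + (mpolyC n c)%:M) =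
      map_mx d (polymx gen_ad (map_poly toS h) *m gen_ad).
    by apply/matrixP => i j; rewrite !mxE dD; case: (i == j); rewrite ?mulr1n ?mulr0n ?dC ?d0 addr0.
  by rewrite dM gen_adE -/Y map_meval_polymx gen_adE.
rewrite mulmxDl raddfD /= -mulmxA IH; last by rewrite -mulmxA -YW.
rewrite derivD derivM derivX mulr1 derivC addr0 polymxD polymxM polymxX.
rewrite !mulmxDl raddfD /=; congr (_ + _).
rewrite YW (polymx_comm h^`() (erefl (Y *m Y))) mulmxA mxtrace_mulC.
by rewrite !mulmxA.
Qed.

Lemma tangent_relation_at j k :
  meval p (gen_ker j k) = \sum_a \sum_b
    meval p (mderiv k (gen_min a b)) * meval p (gen_W j b a).
Proof.
pose y0 : 'rV[R]_n := delta_mx 0 j *m polymx (- Y) proj_ker.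
have kerE : map_mx (meval p) gen_ker = polymx (- Y) proj_ker.
  by rewrite map_meval_polymx map_mxN gen_adE.
have WE : map_mx (meval p) (gen_W j) = polymx Y be *m adm A y0.
  rewrite map_mxM map_meval_polymx gen_adE map_adm map_row kerE rowE.
  congr (_ *m adm _ _); apply/funext => i.
  by apply/matrixP => a b; rewrite !mxE /= mevalC.
have y0Y : adm A y0 *m Y = Y *m adm A y0 := ker_row_comm (delta_mx 0 j).
have comm : Y *m (polymx Y be *m adm A y0) = polymx Y be *m adm A y0 *m Y.
  by rewrite mulmxA -(polymx_comm be (erefl (Y *m Y))) -!mulmxA y0Y.
have E := tr_mderiv_polymx k q comm.
have -> : \sum_a \sum_b meval p (mderiv k (gen_min a b)) * meval p (gen_W j b a) =
    \tr (map_mx (fun f => meval p (mderiv k f)) gen_min *m map_mx (meval p) (gen_W j)).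
  apply: eq_bigr => a _; rewrite mxE; apply: eq_bigr => b _.
  by rewrite !mxE.
have y0k : meval p (gen_ker j k) = y0 0 k.
  by rewrite /y0 -kerE -rowE !mxE.
have q'y0 : polymx Y q^`() *m adm A y0 = adm A y0 *m polymx Y q^`().
  by apply: polymx_comm.
have beq : polymx Y be *m polymx Y q^`() = 1%:M.
  have := congr1 (polymx Y) bez; rewrite polymxD !polymxM q0 mulmx0 add0r => ->.
  exact: polymx1.
rewrite WE E -[in RHS]mulmxA mxtrace_mulC -!mulmxA.
rewrite -q'y0 [polymx Y be *m _]mulmxA beq mul1mx tr_admM -row_mul mulVmx // row1 -rowE y0k.
by rewrite !mxE.
Qed.

End AtPoint.

End TangentSpace.
End CoordinatePoisson.

Section GeneratedIdeal.
Variable B : comNzRingType.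

Definition ideal_gen (P : B -> Prop) (t : B) : Prop :=
  forall I, is_ideal I -> (forall x, P x -> I x) -> I t.

Lemma ideal_gen_ideal P : is_ideal (ideal_gen P).
Proof.
split=> [I [] //|x y gx gy I idI PI|a x gx I idI PI].
- by apply: (idealD idI); [apply: gx|apply: gy].
- by apply: (idealMl idI); apply: gx.
Qed.

Lemma ideal_gen_mem (P : B -> Prop) x : P x -> ideal_gen P x.
Proof. by move=> Px I _; apply. Qed.

Definition ideal_sum2 (I J : B -> Prop) (t : B) : Prop :=
  exists a b, [/\ I a, J b & t = a + b].

Lemma ideal_sum2_ideal I J : is_ideal I -> is_ideal J -> is_ideal (ideal_sum2 I J).
Proof.
move=> idI idJ; split.
- by exists 0, 0; split; [case: idI|case: idJ|rewrite addr0].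
- move=> _ _ [a [b [Ia Jb ->]]] [c [d [Ic Jd ->]]]; exists (a + c), (b + d).
  by split; [apply: (idealD idI)|apply: (idealD idJ)|rewrite addrACA].
- move=> k _ [a [b [Ia Jb ->]]]; exists (k * a), (k * b).
  by split; [apply: (idealMl idI)|apply: (idealMl idJ)|rewrite mulrDr].
Qed.

Lemma ideal_sum2l I J a : is_ideal J -> I a -> ideal_sum2 I J a.
Proof. by move=> idJ Ia; exists a, 0; split=> //; [case: idJ|rewrite addr0]. Qed.

Lemma ideal_sum2r I J a : is_ideal I -> J a -> ideal_sum2 I J a.
Proof. by move=> idI Ja; exists 0, a; split=> //; [case: idI|rewrite add0r]. Qed.

End GeneratedIdeal.

(** * Formal neighbourhood of the diagonal *)

Section FormalNeighbourhood.
Variables (R : numFieldType) (n : nat) (A : 'I_n -> 'M[R]_n).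
Hypotheses (LA : lie_structure A) (Ku : killing_mx A \in unitmx).
Local Notation S := (mpoly n R).
Local Notation x_ i := (mpolyX R (mnm1 i) : S).
Local Notation K := (killing_mx A).

Variable O : ('I_n -> R) -> Prop.
Definition vanish (f : S) : Prop := forall p, O p -> meval p f = 0.
Hypothesis vanish_ham : forall i f, vanish f -> vanish (ham A i f).

Variable J : S -> Prop.
Hypotheses (idJ : is_ideal J) (vanJ : forall f, vanish f -> J f)
  (hamJ : forall i f, J f -> J (ham A i f)).

Variables (q q1 al be : {poly R}).
Hypotheses (qE : q = 'X * q1) (q10 : q1.[0] != 0)
  (bez : al * q + be * q^`() = 1)
  (qO : forall p, O p -> polymx (adm A (pt_vec A p)) q = 0).

(* T plays the role of S (x) S, a pair of points: base f and moving f are the *)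
(* values of f at the first and at the second point, and V k is the difference *)
(* of their k-th coordinates.                                                  *)
Variables (T : comNzRingType) (base moving : {rmorphism S -> T}).
Hypothesis movingC : forall c, moving (mpolyC n c) = base (mpolyC n c).

Definition V (k : 'I_n) : T := moving (x_ k) - base (x_ k).

(** Modulo these, the second point stays on the orbit while the first one is a zero of [J]. *)
Definition limit_gens (t : T) : Prop :=
  (exists2 f, vanish f & t = moving f) \/ (exists2 f, J f & t = base f).
Definition limit_ideal : T -> Prop := ideal_gen limit_gens.
Definition nbh (r : nat) : T -> Prop := ideal_sum2 (ideal_pow V r) limit_ideal.

Let id_lim : is_ideal limit_ideal := ideal_gen_ideal limit_gens.
Let id_pow r : is_ideal (ideal_pow V r) := ideal_pow_ideal V r.
Let id_nbh r : is_ideal (nbh r) := ideal_sum2_ideal (id_pow r) id_lim.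

Lemma powV k : ideal_pow V 1 (V k).
Proof. by rewrite -[V k]mulr1; apply: ideal_powS. Qed.

Lemma moving_base f : ideal_pow V 1 (moving f - base f).
Proof.
elim/mpoly_gen_ind: f => [c|i|f h IHf IHh|f h IHf IHh].
- by rewrite movingC subrr; case: (id_pow 1).
- exact: powV.
- rewrite !rmorphD opprD addrACA; exact: (idealD (id_pow 1)).
- rewrite !rmorphM.
  have -> : moving f * moving h - base f * base h =
     moving h * (moving f - base f) + base f * (moving h - base h) by ring.
  by apply: (idealD (id_pow 1)); apply: (idealMl (id_pow 1)).
Qed.

Lemma taylor1 f : ideal_pow V 2
  (moving f - base f - \sum_k V k * base (mderiv k f)).
Proof.
elim/mpoly_gen_ind: f => [c|i|f h IHf IHh|f h IHf IHh].
- rewrite movingC subrr big1 ?subrr; first by case: (id_pow 2).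
  by move=> k _; rewrite mderivC rmorph0 mulr0.
- rewrite (bigD1 i) //= big1 => [|k /negPf ki].
    by rewrite mderivXU eqxx rmorph1 mulr1 addr0 subrr; case: (id_pow 2).
  by rewrite mderivXU ki rmorph0 mulr0.
- have -> : moving (f + h) - base (f + h) - \sum_k V k * base (mderiv k (f + h)) =
    (moving f - base f - \sum_k V k * base (mderiv k f)) +
    (moving h - base h - \sum_k V k * base (mderiv k h)).
    under eq_bigr do rewrite mderivD rmorphD mulrDr.
    by rewrite big_split /= !rmorphD; ring.
  exact: (idealD (id_pow 2)).
- have -> : moving (f * h) - base (f * h) - \sum_k V k * base (mderiv k (f * h)) =
    (moving f - base f) * (moving h - base h) +
    (base h * (moving f - base f - \sum_k V k * base (mderiv k f)) +
     base f * (moving h - base h - \sum_k V k * base (mderiv k h))).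
    have -> : \sum_k V k * base (mderiv k (f * h)) =
       base h * (\sum_k V k * base (mderiv k f)) +
       base f * (\sum_k V k * base (mderiv k h)).
      rewrite !mulr_sumr -big_split; apply: eq_bigr => k _ /=.
      by rewrite mderivM rmorphD !rmorphM; ring.
    by rewrite !rmorphM; ring.
  apply: (idealD (id_pow 2)).
    by apply: (@ideal_powM _ _ V 1 1); apply: moving_base.
  by apply: (idealD (id_pow 2)); apply: (idealMl (id_pow 2)).
Qed.

Lemma lim_moving f : vanish f -> limit_ideal (moving f).
Proof. by move=> vf; apply: ideal_gen_mem; left; exists f. Qed.

Lemma lim_base f : J f -> limit_ideal (base f).
Proof. by move=> Jf; apply: ideal_gen_mem; right; exists f. Qed.

(** In Taylor's formula both values of [f] lie in the limit ideal, the one at the first point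
    because [J] contains the vanishing polynomials. *)
Lemma vanish_first_order f : vanish f -> nbh 2 (\sum_k V k * base (mderiv k f)).
Proof.
move=> vf.
have -> : \sum_k V k * base (mderiv k f) =
  - (moving f - base f - \sum_k V k * base (mderiv k f)) + (moving f - base f) by ring.
apply: (idealD (id_nbh 2)).
  apply: (idealN (id_nbh 2)); apply: (ideal_sum2l id_lim); exact: taylor1.
apply: (ideal_sum2r (id_pow 2)); apply: (idealB id_lim); first exact: lim_moving.
exact: (lim_base (vanJ vf)).
Qed.

Lemma vanish_gen_min a b : vanish (gen_min A q a b).
Proof.
move=> p Op; have := congr1 (fun M : 'M[R]_n => M a b)
  (map_meval_polymx p (gen_ad A) q).
by rewrite gen_adE qO // !mxE.
Qed.

(** To first order the displacement is orthogonal to the centralizer: [tangent_relation_at] writes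
    each row of [gen_ker] by differentials of equations, up to polynomials [Gk] that vanish on the
    orbit. *)
Lemma tangent_relation j : nbh 2 (\sum_k V k * base (gen_ker A q1 j k)).
Proof.
pose Gk k : S := gen_ker A q1 j k -
  \sum_a \sum_b mderiv k (gen_min A q a b) * gen_W A q1 be j b a.
have vG k : vanish (Gk k).
  move=> p Op; rewrite /Gk mevalB (tangent_relation_at LA Ku qE bez (qO Op)).
  rewrite (raddf_sum (meval p)) /= -sumrB big1 // => a _.
  rewrite (raddf_sum (meval p)) /= -sumrB big1 // => b _.
  by rewrite /= mevalM subrr.
have -> : \sum_k V k * base (gen_ker A q1 j k) =
   \sum_k V k * base (Gk k) +
   \sum_a \sum_b base (gen_W A q1 be j b a) *
      (\sum_k V k * base (mderiv k (gen_min A q a b))).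
  have -> : \sum_a \sum_b base (gen_W A q1 be j b a) *
      (\sum_k V k * base (mderiv k (gen_min A q a b))) =
     \sum_k V k * base (\sum_a \sum_b mderiv k (gen_min A q a b) * gen_W A q1 be j b a).
    under eq_bigr => a _ do under eq_bigr => b _ do rewrite mulr_sumr.
    under eq_bigr => a _ do rewrite exchange_big.
    rewrite exchange_big; apply: eq_bigr => k _ /=.
    rewrite rmorph_sum mulr_sumr; apply: eq_bigr => a _.
    rewrite rmorph_sum mulr_sumr; apply: eq_bigr => b _.
    by rewrite rmorphM; ring.
  rewrite -big_split; apply: eq_bigr => k _ /=.
  by rewrite -mulrDr -rmorphD subrK.
apply: (idealD (id_nbh 2)).
  apply: (ideal_sum (id_nbh 2)) => k _; apply: (idealMl (id_nbh 2)).
  by apply: (ideal_sum2r (id_pow 2)); apply: lim_base; apply: vanJ.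
apply: (ideal_sum (id_nbh 2)) => a _; apply: (ideal_sum (id_nbh 2)) => b _.
apply: (idealMl (id_nbh 2)); apply: vanish_first_order; exact: vanish_gen_min.
Qed.

(* Xi with V = w^# . {., x} to first order: the vector field moving the first *)
(* point towards the second one along the orbit.                              *)
Lemma tangent_hamiltonian : exists w : 'I_n -> T,
  (forall i, ideal_pow V 1 (w i)) /\
  forall k, nbh 2 (V k - \sum_i w i * base (struct_poly A i k)).
Proof.
pose pk := proj_ker q1.
(* As the kernel projection is 1 at 0, [gen_ker] is the identity minus [gen_ad A *m QS]. The
   first-order relation therefore writes [V] as [gen_ad A] applied to [QS] times [V], the vector
   [w']. *)
have /dvdpP[Qp QpE] : 'X %| pk - 1.
  rewrite -['X]subr0 -polyC0 dvdp_XsubCl /root /pk hornerD hornerN hornerC.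
  by rewrite hornerZ mulVf // subrr.
have {QpE} pkE : pk = Qp * 'X + 1 by rewrite -QpE subrK.
pose QS : 'M[S]_n := polymx (- gen_ad A) (mapq n Qp).
have kerE : gen_ker A q1 = 1%:M - gen_ad A *m QS.
  rewrite /gen_ker -/pk pkE /mapq rmorphD rmorphM /= map_polyX rmorph1.
  rewrite polymxD polymxM polymxX polymx1 polymx_comm // mulNmx addrC.
  by [].
pose w' l : T := \sum_k V k * base (QS l k).
have w'1 l : ideal_pow V 1 (w' l).
  apply: (ideal_sum (id_pow 1)) => k _; rewrite mulrC.
  by apply: (idealMl (id_pow 1)); apply: powV.
pose Ki := invmx K.
exists (fun i => - \sum_l base (mpolyC n (Ki i l)) * w' l); split=> [i|j].
  apply: (idealN (id_pow 1)); apply: (ideal_sum (id_pow 1)) => l _.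
  exact: (idealMl (id_pow 1)).
suff -> : V j - \sum_i (- \sum_l base (mpolyC n (Ki i l)) * w' l) * base (struct_poly A i j)
    = \sum_k V k * base (gen_ker A q1 j k) by apply: tangent_relation.
rewrite kerE.
have -> : \sum_k V k * base ((1%:M - gen_ad A *m QS) j k) =
   V j - \sum_l base (gen_ad A j l) * w' l.
  under eq_bigr => k _ do rewrite mxE rmorphD mulrDr.
  rewrite big_split /=; congr (_ + _).
    rewrite (bigD1 j) //= big1 => [|k /negPf kj].
      by rewrite mxE eqxx rmorph1 mulr1 addr0.
    by rewrite mxE eq_sym kj rmorph0 mulr0.
  rewrite -sumrN /w'.
  under [RHS]eq_bigr => l _ do rewrite mulr_sumr -sumrN.
  rewrite exchange_big; apply: eq_bigr => k _ /=.
  rewrite mxE [X in base (- X)]mxE rmorphN rmorph_sum mulrN mulr_sumr -sumrN.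
  apply: eq_bigr => l _.
  by rewrite rmorphM; ring.
congr (_ - _).
have gadE l : gen_ad A j l = - \sum_i struct_poly A i j * mpolyC n (Ki i l).
  have -> : gen_ad A = gen_ad A *m map_mx (@mpolyC n R) K *m map_mx (@mpolyC n R) Ki.
    by rewrite -mulmxA -map_mxM mulmxV // map_mx1 mulmx1.
  rewrite mxE -sumrN; apply: eq_bigr => i _.
  by rewrite gen_ad_killing // mulNr [map_mx _ _ _ _]mxE.
under [RHS]eq_bigr => l _ do rewrite gadE rmorphN rmorph_sum mulNr mulr_suml -sumrN.
rewrite exchange_big; apply: eq_bigr => i _ /=.
rewrite mulNr mulr_suml -sumrN; apply: eq_bigr => l _.
by rewrite rmorphM; ring.
Qed.

Hypothesis derT : forall eta : 'I_n -> T, exists E : T -> T,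
  [/\ forall a b, E (a + b) = E a + E b,
      forall a b, E (a * b) = E a * b + a * E b,
      forall f, E (base f) = 0 & forall k, E (moving (x_ k)) = eta k].
Hypothesis T_ind : forall P : T -> Prop,
  (forall f, P (base f)) -> (forall f, P (moving f)) ->
  (forall a b, P a -> P b -> P (a + b)) ->
  (forall a b, P a -> P b -> P (a * b)) -> forall t, P t.

(** [E] moves the second point along a Hamiltonian field, which preserves vanishing on the orbit;
    hence it preserves the limit ideal. The field agrees with [V] to first order, so [E] fixes each
    [V k] modulo [nbh 2], and Leibniz's rule yields the factor [r] on the [r]-th power. *)
Lemma euler_derivation : exists (w : 'I_n -> T) (E : T -> T),
  [/\ forall i, ideal_pow V 1 (w i),
      forall f, E (moving f) = \sum_i w i * moving (ham A i f),
      forall a b, E (a + b) = E a + E b,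
      forall t, limit_ideal t -> limit_ideal (E t) &
      forall r c, ideal_pow V r c -> nbh r.+1 (E c - r%:R * c)].
Proof.
have [w [w1 wV]] := tangent_hamiltonian.
have [E [ED EM Ebase EX]] := derT (fun k => \sum_i w i * moving (struct_poly A i k)).
have E0 : E 0 = 0 by have := Ebase 0; rewrite rmorph0.
have EN a : E (- a) = - E a.
  by apply/eqP; rewrite -addr_eq0 -ED addNr E0.
have Emov f : E (moving f) = \sum_k moving (mderiv k f) * E (moving (x_ k)).
  elim/mpoly_gen_ind: f => [c|i|f h IHf IHh|f h IHf IHh].
  - rewrite movingC Ebase big1 // => k _.
    by rewrite mderivC rmorph0 mul0r.
  - rewrite (bigD1 i) //= big1 => [|k /negPf ki].
      by rewrite mderivXU eqxx rmorph1 mul1r addr0.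
    by rewrite mderivXU ki rmorph0 mul0r.
  - rewrite rmorphD ED IHf IHh -big_split; apply: eq_bigr => k _ /=.
    by rewrite mderivD rmorphD mulrDl.
  - rewrite rmorphM EM IHf IHh mulr_suml mulr_sumr -big_split.
    by apply: eq_bigr => k _ /=; rewrite mderivM rmorphD !rmorphM; ring.
have Eham f : E (moving f) = \sum_i w i * moving (ham A i f).
  rewrite Emov /ham.
  under eq_bigr => k _ do rewrite EX mulr_sumr.
  rewrite exchange_big; apply: eq_bigr => i _ /=.
  rewrite rmorph_sum mulr_sumr; apply: eq_bigr => k _.
  by rewrite rmorphM; ring.
have sumw r F : (forall i, nbh r (F i)) -> nbh r.+1 (\sum_i w i * F i).
  move=> nF; apply: (ideal_sum (id_nbh r.+1)) => i _.
  have [a [b [pa lb ->]]] := nF i; rewrite mulrDr.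
  apply: (idealD (id_nbh r.+1)).
    by apply: (ideal_sum2l id_lim); apply: (@ideal_powM _ _ V 1 r).
  by apply: (ideal_sum2r (id_pow _)); apply: (idealMl id_lim).
have Elim t : limit_ideal t -> limit_ideal (E t).
  move=> lt; suff [] : limit_ideal t /\ limit_ideal (E t) by [].
  apply: (lt (fun t => limit_ideal t /\ limit_ideal (E t))); first split.
  - by rewrite E0; split; case: id_lim.
  - move=> a b [la lEa] [lb lEb]; split; first exact: (idealD id_lim).
    by rewrite ED; apply: (idealD id_lim).
  - move=> a b [lb lEb]; split; first exact: (idealMl id_lim).
    rewrite EM; apply: (idealD id_lim); exact: (idealMl id_lim).
  - move=> _ [[f vf ->]|[f Jf ->]].
      split; first exact: lim_moving.
      rewrite Eham; apply: (ideal_sum id_lim) => i _; apply: (idealMl id_lim).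
      by apply: lim_moving; apply: vanish_ham.
    by split; [exact: lim_base|rewrite Ebase; case: id_lim].
have EV k : nbh 2 (E (V k) - V k).
  rewrite {1}/V ED EN Ebase subr0 EX.
  have -> : \sum_i w i * moving (struct_poly A i k) - V k =
    \sum_i w i * (moving (struct_poly A i k) - base (struct_poly A i k)) -
    (V k - \sum_i w i * base (struct_poly A i k)).
    under [X in _ = X - _]eq_bigr => i _ do rewrite mulrBr.
    by rewrite sumrB; ring.
  apply: (idealB (id_nbh 2)); last exact: wV.
  apply: sumw => i; apply: (ideal_sum2l id_lim); exact: moving_base.
have pow0 t : ideal_pow V 1 (E t).
  elim/T_ind: t => [f|f|a b IHa IHb|a b IHa IHb].
  - by rewrite Ebase; case: (id_pow 1).
  - rewrite Eham; apply: (ideal_sum (id_pow 1)) => i _.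
    by rewrite mulrC; apply: (idealMl (id_pow 1)).
  - by rewrite ED; apply: (idealD (id_pow 1)).
  - rewrite EM; apply: (idealD (id_pow 1)); last exact: (idealMl (id_pow 1)).
    by rewrite mulrC; apply: (idealMl (id_pow 1)).
exists w, E; split=> //.
elim=> [|r IHr] c.
  by move=> _; rewrite mul0r subr0; apply: (ideal_sum2l id_lim).
move=> [b [bP ->]].
have -> : E (\sum_k V k * b k) - r.+1%:R * (\sum_k V k * b k) =
    \sum_k ((E (V k) - V k) * b k + V k * (E (b k) - r%:R * b k)).
  have -> : E (\sum_k V k * b k) = \sum_k E (V k * b k).
    by elim/big_rec2: _ => [|k x y _ <-]; rewrite ?E0 ?ED.
  rewrite mulr_sumr -sumrB; apply: eq_bigr => k _.
  by rewrite EM -natr1; ring.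
apply: (ideal_sum (id_nbh _)) => k _; apply: (idealD (id_nbh _)).
  have [u [v [pu lv ->]]] := EV k; rewrite mulrDl; apply: (idealD (id_nbh _)).
    by apply: (ideal_sum2l id_lim); apply: (@ideal_powM _ _ V 2 r) => //; apply: bP.
  by apply: (ideal_sum2r (id_pow _)); rewrite mulrC; apply: (idealMl id_lim).
have [u [v [pu lv ->]]] := IHr (b k) (bP k); rewrite mulrDr.
apply: (idealD (id_nbh _)).
  by apply: (ideal_sum2l id_lim); apply: ideal_powS.
by apply: (ideal_sum2r (id_pow _)); apply: (idealMl id_lim).
Qed.

(** Write [moving f] as [c] of order [r + 1] plus a member of the limit ideal. Applying [E] raises
    the order, since [J] is stable under [ham] and the [w i] have order 1; but [E] multiplies [c] by
    [r + 1] up to higher order. Dividing by [r + 1] shows that [c] has order [r + 2]. *)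
Lemma moving_deep r f : J f -> nbh r (moving f).
Proof.
have [w [E [w1 Eham ED Elim Eul]]] := euler_derivation.
elim: r f => [|r IHr] f Jf.
  exact: (ideal_sum2l (I := ideal_pow V 0) id_lim).
case: r IHr => [|r] IHr.
  exists (moving f - base f), (base f).
  by split; [apply: moving_base|apply: lim_base|rewrite subrK].
have [c [a [pc la fE]]] := IHr f Jf.
have nEf : nbh r.+2 (E (moving f)).
  rewrite Eham; apply: (ideal_sum (id_nbh _)) => i _.
  have [u [v [pu lv ->]]] := IHr _ (hamJ i Jf); rewrite mulrDr.
  apply: (idealD (id_nbh _)).
    by apply: (ideal_sum2l id_lim); apply: (@ideal_powM _ _ V 1 r.+1).
  by apply: (ideal_sum2r (id_pow _)); apply: (idealMl id_lim).
have nrc : nbh r.+2 (r.+1%:R * c).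
  have -> : r.+1%:R * c = E (moving f) - E a - (E c - r.+1%:R * c).
    by rewrite fE ED; ring.
  apply: (idealB (id_nbh _)); last exact: Eul.
  apply: (idealB (id_nbh _)) => //.
  by apply: (ideal_sum2r (id_pow _)); apply: Elim.
rewrite fE; apply: (idealD (id_nbh _)); last exact: (ideal_sum2r (id_pow _)).
have -> : c = base (mpolyC n r.+1%:R^-1) * (r.+1%:R * c).
  have -> : r.+1%:R = base (mpolyC n r.+1%:R) :> T by rewrite !rmorph_nat.
  rewrite mulrA -rmorphM -mpolyCM mulVf ?pnatr_eq0 //.
  by rewrite mpolyC1 rmorph1 mul1r.
exact: (idealMl (id_nbh _)).
Qed.

Lemma generatedT : exists (phi : {rmorphism R -> T}) (z : seq T),
  forall t, generated phi z t.
Proof.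
pose phi : {rmorphism R -> T} := base \o @mpolyC n R.
exists phi, ([seq base (x_ k) | k <- enum 'I_n] ++
  [seq moving (x_ k) | k <- enum 'I_n]).
move=> t P PS Pz.
elim/T_ind: t => [f|f|a b|a b].
- elim/mpoly_gen_ind: f => [c|i|f h IHf IHh|f h IHf IHh].
  + exact: (subring_const PS).
  + apply: Pz; rewrite mem_cat; apply/orP; left; apply/mapP.
    by exists i; rewrite ?mem_enum.
  + by rewrite rmorphD; apply: (subring_add PS).
  + by rewrite rmorphM; apply: (subring_mul PS).
- elim/mpoly_gen_ind: f => [c|i|f h IHf IHh|f h IHf IHh].
  + by rewrite movingC; apply: (subring_const PS).
  + apply: Pz; rewrite mem_cat; apply/orP; right; apply/mapP.
    by exists i; rewrite ?mem_enum.
  + by rewrite rmorphD; apply: (subring_add PS).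
  + by rewrite rmorphM; apply: (subring_mul PS).
- exact: (subring_add PS).
- exact: (subring_mul PS).
Qed.

Lemma moving_annihilator f : J f ->
  exists a, ideal_pow V 1 a /\ limit_ideal ((1 - a) * moving f).
Proof.
move=> Jf; have [phi [z genT]] := generatedT.
apply: (krull_intersection genT id_lim) => r.
have [c [a [pc la ->]]] := moving_deep r Jf.
by exists c; split=> //; rewrite addrC addKr.
Qed.

End FormalNeighbourhood.

(** A matrix of largest rank among those with rows in [W]; stacking one more member of [W] cannot
    increase the rank. *)
Lemma spanning_rows (F : fieldType) (m : nat) (W : 'rV[F]_m -> Prop) :
  exists k (M : 'M[F]_(k, m)), (forall i, W (row i M)) /\
    forall w, W w -> (w <= M)%MS.
Proof.
pose P r := `[< exists k (M : 'M[F]_(k, m)), (forall i, W (row i M)) /\ \rank M = r >].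
have exP : exists r, P r.
  exists 0; apply/asboolP; exists 0, 0; split; first by case.
  by rewrite mxrank0.
have maxP r : P r -> (r <= m)%N.
  by move=> /asboolP[k [M [_ <-]]]; apply: rank_leq_col.
case: (ex_maxnP exP maxP) => r /asboolP[k [M [MW rM]]] rmax.
exists k, M; split=> // w Ww; apply: contrapT => /negP wM.
have : P (\rank (col_mx w M)).
  apply/asboolP; exists (1 + k)%N, (col_mx w M); split=> // i.
  rewrite -(splitK i); case: (fintype.split i) => j /=.
    by rewrite rowKu; rewrite ord1 (_ : row 0 w = w) //; apply/rowP => l; rewrite mxE.
  by rewrite rowKd.
move/rmax; apply/negP; rewrite -ltnNge -rM -addsmxE.
rewrite ltn_neqAle mxrankS ?addsmxSr // andbT.
apply: contra wM => /eqP rE.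
have [_] := mxrank_leqif_eq (addsmxSr w M); rewrite rE eqxx.
by move=> /esym/andP[_]; apply: submx_trans; apply: addsmxSl.
Qed.

(** * Poisson ideals of functions on a semisimple orbit *)

Section PoissonSimple.
Variables (R : numFieldType) (n : nat) (A : 'I_n -> 'M[R]_n).
Hypotheses (LA : lie_structure A) (Ku : killing_mx A \in unitmx).
Local Notation S := (mpoly n R).
Local Notation T := (mpoly n S).
Local Notation x_ i := (mpolyX R (mnm1 i) : S).

Variable O : ('I_n -> R) -> Prop.
Local Notation vanish := (vanish O).
Hypothesis vanish_ham : forall i f, vanish f -> vanish (ham A i f).
Hypothesis boolean_const : forall k : S,
  (forall p, O p -> meval p k = 0 \/ meval p k = 1) ->
  (forall p, O p -> meval p k = 0) \/ (forall p, O p -> meval p k = 1).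

Variables (q q1 al be : {poly R}).
Hypotheses (qE : q = 'X * q1) (q10 : q1.[0] != 0)
  (bez : al * q + be * q^`() = 1)
  (qO : forall p, O p -> polymx (adm A (pt_vec A p)) q = 0).

Variable J : S -> Prop.
Hypotheses (idJ : is_ideal J) (vanJ : forall f, vanish f -> J f)
  (hamJ : forall i f, J f -> J (ham A i f)).

(** The outer variables of [T] are the coordinates of the second point; the coefficients are
    functions of the first. *)
Definition baseT : {rmorphism S -> T} := @mpolyC n S.
Definition movingT : {rmorphism S -> T} := map_mpoly (@mpolyC n R).

Lemma movingTC c : movingT (mpolyC n c) = baseT (mpolyC n c).
Proof. exact: map_mpolyC. Qed.

Lemma movingTX k : movingT (x_ k) = mpolyX S (mnm1 k).
Proof. exact: map_mpolyX. Qed.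

Lemma derivation_T (eta : 'I_n -> T) : exists E : T -> T,
  [/\ forall a b, E (a + b) = E a + E b,
      forall a b, E (a * b) = E a * b + a * E b,
      forall f, E (baseT f) = 0 & forall k, E (movingT (x_ k)) = eta k].
Proof.
exists (fun t => \sum_k mderiv k t * eta k); split=> [a b|a b|f|k].
- by rewrite -big_split; apply: eq_bigr => k _; rewrite mderivD mulrDl.
- rewrite mulr_suml mulr_sumr -big_split; apply: eq_bigr => k _ /=.
  by rewrite mderivM mulrDl mulrAC mulrA.
- by rewrite big1 // => k _; rewrite mderivC mul0r.
- rewrite movingTX (bigD1 k) //= big1 => [|i /negPf ik].
    by rewrite mderivXU eqxx mul1r addr0.
  by rewrite mderivXU ik mul0r.
Qed.

Lemma T_ind (P : T -> Prop) :
  (forall f, P (baseT f)) -> (forall f, P (movingT f)) ->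
  (forall a b, P a -> P b -> P (a + b)) ->
  (forall a b, P a -> P b -> P (a * b)) -> forall t, P t.
Proof.
move=> Pb Pm PD PM; apply: mpoly_gen_ind => // i.
by rewrite -movingTX.
Qed.

Definition move_to (p : 'I_n -> R) : {rmorphism T -> S} :=
  meval (fun i => mpolyC n (p i)).
Definition diagonal : {rmorphism T -> S} := meval (fun i => x_ i).

Lemma move_to_base p f : move_to p (baseT f) = f.
Proof. exact: mevalC. Qed.

Lemma move_to_moving p f : move_to p (movingT f) = mpolyC n (meval p f).
Proof.
elim/mpoly_gen_ind: f => [c|i|f h IHf IHh|f h IHf IHh].
- rewrite mevalC; apply: (etrans (congr1 (move_to p) (movingTC c))).
  exact: move_to_base.
- rewrite mevalXU; apply: (etrans (congr1 (move_to p) (movingTX i))).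
  exact: (mevalXU _ i).
- rewrite mevalD mpolyCD -IHf -IHh.
  by apply: (etrans (congr1 (move_to p) (rmorphD movingT f h))); apply: rmorphD.
- rewrite mevalM mpolyCM -IHf -IHh.
  by apply: (etrans (congr1 (move_to p) (rmorphM movingT f h))); apply: rmorphM.
Qed.

Lemma diagonal_pow a : ideal_pow (V baseT movingT) 1 a -> diagonal a = 0.
Proof.
move=> [b [_ ->]]; rewrite rmorph_sum big1 // => k _.
rewrite rmorphM /V rmorphB /= movingTX [diagonal (mpolyX _ _)]mevalXU.
by rewrite [diagonal (baseT _)]mevalC subrr mul0r.
Qed.

(** Krull's theorem gives [b], equal to 1 on the diagonal, with [b * movingT f] in the limit ideal.
    Freezing the second point at [p] in O with f(p) nonzero puts b(-, p) into [J]. Expand [b] along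
    monomials in the second point, and let [P] project onto the span of the monomial values at such
    [p]. The part of [b] along [P] gives [k], a combination of finitely many b(-, p); the remaining
    part gives [h], which vanishes at these [p]. *)
Lemma split_unit f : J f ->
  exists h k, [/\ 1 = h + k, vanish (h * f) & J k].
Proof.
move=> Jf.
have [a [/diagonal_pow a1 lim]] := @moving_annihilator R n A LA Ku O vanish_ham
  J vanJ hamJ q q1 al be qE q10 bez qO T baseT movingT movingTC
  derivation_T T_ind f Jf.
set b := 1 - a in lim.
have Jb p : O p -> meval p f != 0 -> J (move_to p b).
  move=> Op fp; have : J (move_to p (b * movingT f)).
    apply: (lim (fun t => J (move_to p t))).
      split; first by rewrite rmorph0; case: idJ.
      - by move=> x y; rewrite rmorphD; apply: (idealD idJ).
      - by move=> x y; rewrite rmorphM; apply: (idealMl idJ).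
    move=> _ [[h vh ->]|[h Jh ->]]; last by rewrite move_to_base.
    by rewrite move_to_moving vh // mpolyC0; case: idJ.
  rewrite rmorphM move_to_moving => /(idealMl idJ (mpolyC n (meval p f)^-1)).
  by rewrite mulrCA -mpolyCM mulVf // mpolyC1 mulr1.
pose s := msupp b; pose L := size s.
pose mon (i : 'I_L) : S := mpolyX R (nth mnm0 s i).
pose cf (i : 'I_L) : S := mcoeff (nth mnm0 s i) b.
have bE (ev : {rmorphism T -> S}) : (forall c, ev (baseT c) = c) ->
    ev b = \sum_(i < L) cf i * ev (mpolyX S (nth mnm0 s i)).
  move=> evC; rewrite [in LHS](mpolyE b) rmorph_sum (big_nth mnm0) big_mkord.
  apply: eq_bigr => i _; rewrite -mul_mpolyC rmorphM /=.
  by rewrite -[mpolyC _ _]/(baseT _) evC.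
pose W (w : 'rV[R]_L) := exists p, [/\ O p, meval p f != 0 &
  w = \row_i meval p (mon i)].
have [r [M [MW WM]]] := spanning_rows W.
pose P := pinvmx M *m M.
have WP w : W w -> w *m P = w by move=> /WM wM; rewrite mulmxA mulmxKpV.
exists (\sum_j (\sum_i (((i == j)%:R - P i j) *: mon i)) * cf j).
exists (\sum_i mon i * \sum_j P i j *: cf j).
split.
- have : diagonal b = 1 by rewrite rmorphB rmorph1 a1 subr0.
  rewrite bE => [<-|c]; last exact: mevalC.
  have -> : \sum_i mon i * (\sum_j P i j *: cf j) =
      \sum_j (\sum_i P i j *: mon i) * cf j.
    under eq_bigr => i _ do rewrite mulr_sumr.
    rewrite exchange_big; apply: eq_bigr => j _ /=; rewrite mulr_suml.
    by apply: eq_bigr => i _; rewrite -scalerAr -scalerAl.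
  rewrite -big_split; apply: eq_bigr => j _ /=.
  rewrite -mulrDl -big_split mulrC /=.
  under [X in _ = X * _]eq_bigr => i _ do rewrite -scalerDl subrK.
  rewrite (bigD1 j) //= eqxx scale1r big1 => [|i /negPf ->]; last by rewrite scale0r.
  by rewrite addr0; congr (_ * _); rewrite [LHS]mevalX -mpolyXE_id.
- move=> p Op; rewrite mevalM.
  have [->|fp] := eqVneq (meval p f) 0; first by rewrite mulr0.
  rewrite (raddf_sum (meval p)) big1 ?mul0r // => j _ /=.
  rewrite mevalM (raddf_sum (meval p)).
  have Ww : W (\row_i meval p (mon i)) by exists p.
  have E : \sum_i meval p (mon i) * P i j = meval p (mon j).
    have /rowP/(_ j) := WP _ Ww; rewrite !mxE => <-.
    by apply: eq_bigr => i _; congr (_ * _); rewrite mxE.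
  rewrite (eq_bigr (fun i => (i == j)%:R * meval p (mon i) - meval p (mon i) * P i j)).
    rewrite sumrB (bigD1 j) //= eqxx mul1r big1 => [|i /negPf ->].
      by rewrite addr0 E subrr mul0r.
    by rewrite mul0r.
  by move=> i _ /=; rewrite mevalZ mulrBl [P i j * _]mulrC.
- apply: (ideal_sum idJ) => i _; apply: (idealMl idJ).
  have -> : \sum_j P i j *: cf j =
     \sum_l mpolyC n (pinvmx M i l) * \sum_j M l j *: cf j.
    under [RHS]eq_bigr => l _ do rewrite mul_mpolyC scaler_sumr.
    rewrite exchange_big; apply: eq_bigr => j _ /=.
    rewrite /P mxE scaler_suml; apply: eq_bigr => l _.
    by rewrite scalerA.
  apply: (ideal_sum idJ) => l _; apply: (idealMl idJ).
  have [p [Op fp Ml]] := MW l.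
  have := Jb p Op fp; rewrite bE; last exact: move_to_base.
  congr J; apply: eq_bigr => j _.
  have -> : M l j = meval p (mon j) by have /rowP/(_ j) := Ml; rewrite !mxE.
  rewrite -mul_mpolyC mulrC; congr (_ * _).
  rewrite [LHS]mevalX /mon mevalX rmorph_prod; apply: eq_bigr => i' _.
  by rewrite rmorphXn.
Qed.

Lemma noetherian_S (u : nat -> S) : exists N, exists c : nat -> S,
  u N = \sum_(i < N) c i * u i.
Proof.
have gen (f : S) : generated (@mpolyC n R : {rmorphism R -> S})
    [seq x_ k | k <- enum 'I_n] f.
  move=> P PS Pz; elim/mpoly_gen_ind: f => [c|i|f h|f h].
  - exact: (subring_const PS).
  - by apply: Pz; apply/mapP; exists i; rewrite ?mem_enum.
  - exact: (subring_add PS).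
  - exact: (subring_mul PS).
have [N [c [_ cE]]] := generated_noetherian (fun i => gen (u i)).
by exists N, c.
Qed.

(** By [split_unit], each term of the sequence [u] lies in [J] and equals 1 on O wherever the
    previous term is nonzero. A noetherian relation makes some [u N] vanish where all earlier terms
    do, so its values on O are 0 and 1 and [boolean_const] applies. *)
Theorem poisson_ideal_trivial f : J f -> vanish f \/ J 1.
Proof.
move=> Jf.
have /choice[nxt nxtP] : forall k0 : S, exists k : S, J k0 ->
    J k /\ forall p, O p -> meval p k0 != 0 -> meval p k = 1.
  move=> k0; have [Jk0|nJ] := pselect (J k0); last by exists 0.
  have [h [k [hk vh Jk]]] := split_unit Jk0; exists k => _; split=> // p Op k0p.
  have := congr1 (meval p) hk; rewrite mevalD meval1 => ->.
  have := vh p Op; rewrite mevalM => /eqP; rewrite mulf_eq0 (negPf k0p) orbF.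
  by move=> /eqP ->; rewrite add0r.
pose u := fix u i := if i is i'.+1 then nxt (u i') else f.
have Ju i : J (u i) by elim: i => // i IHi; have [] := nxtP _ IHi.
have u1 p i j : O p -> meval p (u i) != 0 -> (i < j)%N -> meval p (u j) = 1.
  move=> Op ui; elim: j => // j IHj; rewrite ltnS leq_eqVlt => /orP[/eqP <-|/IHj uj].
    by have [_] := nxtP _ (Ju i); apply.
  by have [_] := nxtP _ (Ju j); apply=> //; rewrite uj oner_neq0.
have [N [c uN]] := noetherian_S u.
have uN01 p : O p -> meval p (u N) = 0 \/ meval p (u N) = 1.
  move=> Op; have [[i ui]|no] := pselect (exists i : 'I_N, meval p (u i) != 0).
    by right; apply: (u1 p i).
  left; rewrite uN (raddf_sum (meval p)) big1 // => i _ /=; rewrite mevalM.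
  have [->|ui] := eqVneq (meval p (u i)) 0; first by rewrite mulr0.
  by case: no; exists i.
have [uN0|uN1] := boolean_const uN01.
  left=> p Op; apply/eqP; apply: contrapT => /negP fp.
  case: N uN uN0 {uN01} => [|N] uN uN0; first by rewrite [f]uN big_ord0 meval0 eqxx in fp.
  have := uN0 p Op; rewrite (u1 p 0 N.+1) // => /eqP.
  by rewrite oner_eq0.
right; have -> : 1 = u N - (u N - 1) by ring.
apply: (idealB idJ) => //; apply: vanJ => p Op.
by rewrite mevalB uN1 // meval1 subrr.
Qed.

End PoissonSimple.

(** * Restriction to the Jordan line *)

Section SeparableAnnihilator.
Variable F : fieldType.

(** A factor ['X] is added only if 0 is not already a root, which keeps the product separable. *)
Lemma separable_mulX (p : {poly F}) : p != 0 -> separable_poly p ->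
  exists q1 al be : {poly F}, [/\ p %| 'X * q1, q1.[0] != 0 &
    al * ('X * q1) + be * ('X * q1)^`() = 1].
Proof.
move=> p0 sp.
have cX r : coprimep 'X r = ~~ root r (0 : F).
  by rewrite coprimep_sym -[X in coprimep _ X]subr0 -polyC0 coprimep_XsubC.
have [q1 pq sq] : exists2 q1, p %| 'X * q1 & separable_poly ('X * q1).
  have [/factor_theorem[q1]|np] := boolP (root p 0).
    by rewrite polyC0 subr0 mulrC => pE; exists q1; rewrite -pE.
  exists p; first exact: dvdp_mull.
  by rewrite separable_mul sp cX np separable_poly.unlock derivX coprimep1.
have := sq; rewrite separable_mul => /and3P[_ _].
rewrite cX => q10.
have /Bezout_eq1_coprimepP[[u v] /= uv] : coprimep ('X * q1) ('X * q1)^`().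
  by move: sq; rewrite separable_poly.unlock.
exists q1, u, v; split=> //.
Qed.

End SeparableAnnihilator.

(** In characteristic zero, inseparability comes from two factors [u] and [v] that are not coprime.
    Cancelling their gcd once lowers the degree and keeps every root, in any extension. *)
Lemma separable_radical (F : numFieldType) (p : {poly F}) : p != 0 ->
  exists2 w : {poly F}, w != 0 /\ separable_poly w &
    forall (C : fieldType) (f : {rmorphism F -> C}) x,
      root (map_poly f p) x -> root (map_poly f w) x.
Proof.
have [N] := ubnP (size p); elim: N p => // N IHN p sp p0.
have [sep|/separable_polyP nsep] := boolP (separable_poly p); first by exists p.
have [[u [v [uvp ncop]]]|no] :=
  pselect (exists u v, u * v %| p /\ ~~ coprimep u v); last first.
  case: nsep; split=> [u v uvp|u _ su].
    by apply/negPn/negP => nc; apply: no; exists u, v.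
  apply/eqP => /polyP/(_ (size u).-2); rewrite coef_deriv coef0 => /eqP.
  have -> : (size u).-2.+1 = (size u).-1 by case: (size u) su => [|[]].
  rewrite mulrn_eq0 -lead_coefE lead_coef_eq0 -size_poly_eq0.
  by case: (size u) su => [|[]].
have /dvdpP[r pE] := uvp; set d := gcdp u v in ncop *.
have vd : v = v %/ d * d by rewrite divpK // dvdp_gcdr.
have [r0 u0 v0] : [/\ r != 0, u != 0 & v != 0].
  by move: p0; rewrite pE !mulf_eq0 !negb_or => /and3P.
have d0 : d != 0 by rewrite gcdp_eq0 negb_and u0.
have vd0 : v %/ d != 0 by apply: contraNneq v0 => E; rewrite vd E mul0r.
have p2 : r * (u * (v %/ d)) != 0 by rewrite !mulf_neq0.
have [|w wP wr] := IHN (r * (u * (v %/ d))) _ p2.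
  rewrite -ltnS; apply: leq_trans sp; rewrite pE [in X in (_ < X)%N]vd !mulrA ltnS.
  have sd : (1 < size d)%N.
    rewrite ltn_neqAle size_poly_gt0 d0 andbT eq_sym.
    by move: ncop; rewrite /coprimep.
  rewrite [X in (_ < X)%N]size_mul ?mulf_neq0 //.
  move: sd; case: (size d) => [|[|m]] // _.
  by rewrite addnS /= -[X in (X < _)%N]addn0 ltn_add2l.
exists w => // C f x; rewrite pE {1}vd => px; apply: wr; move: px.
rewrite !rmorphM !rootM => /or3P[->//|->|/orP[->|]]; rewrite ?orbT //.
have /dvdpP[k ->] : d %| u by rewrite dvdp_gcdl.
by rewrite rmorphM rootM => ->; rewrite !orbT.
Qed.

Lemma separable_multiple (F : numFieldType) (p : {poly F}) : p != 0 ->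
  exists q : {poly F}, [/\ q.[0] = 0, separable_poly q &
    forall (C : fieldType) (f : {rmorphism F -> C}) x,
      root (map_poly f p) x -> root (map_poly f q) x].
Proof.
move=> /separable_radical[w [w0 sw] pw].
have [q1 [al [be [wq _ bez]]]] := separable_mulX w0 sw.
exists ('X * q1); split=> [||C f x /pw].
- by rewrite hornerM hornerX mul0r.
- rewrite separable_poly.unlock; apply/Bezout_eq1_coprimepP.
  by exists (al, be).
- by move: wq => /dvdpP[k ->]; rewrite rmorphM rootM => ->; rewrite orbT.
Qed.

Section LineEvaluation.
Variables (R : fieldType) (C : numFieldType) (f : {rmorphism R -> C}).
Variables (n : nat) (A : 'I_n -> 'M[R]_n).
Hypothesis LA : lie_structure A.
Local Notation S := (mpoly n R).
Local Notation X i := (mpolyX R (mnm1 i) : S).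
Local Notation AC := (fun i => map_mx f (A i)).
Local Notation KC := (killing_mx AC).

Variables s v h : 'rV[C]_n.
Hypotheses (sh : s *m adm AC h = 0) (vh : v *m adm AC h = v).

(** Restriction to the line s + t v in the Lie algebra over [C], identified with its dual by the
    Killing form. *)
Definition line : {rmorphism S -> {poly C}} :=
  mmap (@polyC C \o f) (fun k => ((s *m KC) 0 k)%:P + ((v *m KC) 0 k)%:P * 'X).

Lemma lineX k : line (X k) = ((s *m KC) 0 k)%:P + ((v *m KC) 0 k)%:P * 'X.
Proof. by rewrite /line /= mmapX mmap1U. Qed.

Lemma lineC c : line (mpolyC n c) = (f c)%:P.
Proof. by rewrite /line /= mmapC. Qed.

Lemma lineZ c p : line (c *: p) = f c *: line p.
Proof. by rewrite -mul_mpolyC rmorphM lineC mul_polyC. Qed.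

(** The flow of [h] fixes [s] and scales [v], so the Hamiltonian field of [h] restricts to minus the
    Euler field of the line. *)
Lemma line_ham p : \sum_i h 0 i *: line (ham A i p) = - ('X * (line p)^`()).
Proof.
elim/mpoly_gen_ind: p => [c|k|p1 p2 IH1 IH2|p1 p2 IH1 IH2].
- rewrite lineC derivC mulr0 oppr0 big1 // => i _.
  by rewrite hamC rmorph0 scaler0.
- have LAC : lie_structure AC by exact: map_lie_structure.
  have KT : KC^T = KC by apply/matrixP => i j; rewrite !mxE mxtrace_mulC.
  have E (u : 'rV[C]_n) : \sum_i h 0 i * \sum_l AC i k l * (u *m KC) 0 l =
      - ((u *m adm AC h) *m KC) 0 k.
    have -> : \sum_i h 0 i * \sum_l AC i k l * (u *m KC) 0 l =
        (adm AC h *m (u *m KC)^T) k 0.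
      rewrite mulmx_suml summxE; apply: eq_bigr => i _.
      by rewrite -scalemxAl !mxE; congr (_ * _); apply: eq_bigr => l _; rewrite !mxE.
    have -> : adm AC h *m (u *m KC)^T = - (u *m adm AC h *m KC)^T.
      by rewrite !trmx_mul KT !mulmxA (adm_killing LAC) mulNmx.
    by rewrite mxE [in LHS]mxE.
  have lE i : line (struct_poly A i k) = (\sum_l AC i k l * (s *m KC) 0 l)%:P +
      (\sum_l AC i k l * (v *m KC) 0 l)%:P * 'X.
    rewrite rmorph_sum !rmorph_sum mulr_suml -big_split; apply: eq_bigr => l _ /=.
    by rewrite lineZ lineX scalerDr scale_polyC -mul_polyC mulrA -polyCM !mxE.
  have -> : \sum_i h 0 i *: line (ham A i (X k)) =
     (\sum_i h 0 i * \sum_l AC i k l * (s *m KC) 0 l)%:P +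
      (\sum_i h 0 i * \sum_l AC i k l * (v *m KC) 0 l)%:P * 'X.
    rewrite !rmorph_sum mulr_suml -big_split; apply: eq_bigr => i _ /=.
    by rewrite hamX lE scalerDr scale_polyC -mul_polyC mulrA -polyCM.
  rewrite !E sh vh mul0mx mxE oppr0 add0r lineX derivD derivC add0r derivM derivC.
  by rewrite derivX mul0r add0r mulr1 polyCN mulNr mulrC.
- rewrite rmorphD derivD mulrDr opprD -IH1 -IH2 -big_split; apply: eq_bigr => i _.
  by rewrite hamD rmorphD scalerDr.
- rewrite rmorphM derivM mulrDr opprD.
  have -> : - ('X * ((line p1)^`() * line p2)) = - ('X * (line p1)^`()) * line p2 by ring.
  have -> : - ('X * (line p1 * (line p2)^`())) = line p1 * - ('X * (line p2)^`()) by ring.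
  rewrite -IH1 -IH2 mulr_suml mulr_sumr -big_split; apply: eq_bigr => i _ /=.
  by rewrite hamM rmorphD !rmorphM scalerDr scalerAl scalerAr.
Qed.

Section VanishingOnLine.
Variable P : S -> Prop.
Hypotheses (P_ham : forall i p, P p -> P (ham A i p))
  (P1 : forall p, P p -> (line p).[1] = 0).

(** The span is over [C] because [h] has coordinates in [C], whereas members of [P] have
    coefficients in [R]. *)
Definition line_span (u : {poly C}) : Prop := forall W : {poly C} -> Prop,
  (forall a u w, W u -> W w -> W (a *: u + w)) -> W 0 ->
  (forall p, P p -> W (line p)) -> W u.

Lemma line_spanZD a u w : line_span u -> line_span w -> line_span (a *: u + w).
Proof. by move=> Su Sw W WZD W0 Wl; apply: (WZD); [apply: Su|apply: Sw]. Qed.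

Lemma line_span0 : line_span 0.
Proof. by []. Qed.

Lemma line_span_euler u : line_span u -> line_span ('X * u^`()).
Proof.
move=> /(_ (fun u => line_span ('X * u^`()))); apply=> [a u1 u2 S1 S2||p Pp].
- rewrite derivD derivZ mulrDr -scalerAr; exact: line_spanZD.
- by rewrite deriv0 mulr0; apply: line_span0.
- have -> : 'X * (line p)^`() = \sum_i (- h 0 i) *: line (ham A i p).
    rewrite -[LHS]opprK -line_ham -sumrN.
    by apply: eq_bigr => i _; rewrite scaleNr.
  move=> W WZD W0 Wl; apply: (big_ind W) => // [w1 w2 W1 W2|i _].
    by rewrite -[w1]scale1r; apply: (WZD).
  by rewrite -[_ *: _]addr0; apply: (WZD) => //; apply/Wl/P_ham.
Qed.

(** A space of polynomials vanishing at 1 and stable under the Euler operator is zero: by induction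
    on the degree m of u, X u' - m u is zero, so u is a monomial, and its value at 1 is its
    coefficient. *)
Lemma line_vanish p : P p -> line p = 0.
Proof.
move=> Pp.
have S1 u : line_span u -> u.[1] = 0.
  move=> /(_ (fun u => u.[1] = 0)); apply=> [a u1 u2 E1 E2||]; last exact: P1.
    by rewrite hornerD hornerZ E1 E2 mulr0 addr0.
  exact: horner0.
suff S0 u : line_span u -> u = 0 by apply: S0 => W _ _; apply.
have [N] := ubnP (size u); elim: N u => // N IHN u; rewrite ltnS => su Su.
pose m := (size u).-1.
have Ew i : ('X * u^`() - m%:R *: u)`_i = u`_i *+ i - u`_i *+ m.
  rewrite coefB coefZ coefXM coef_deriv mulr_natl.
  by case: i => [|i] /=; rewrite ?mulr0n.
have w0 : 'X * u^`() - m%:R *: u = 0.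
  have [->|u0] := eqVneq u 0; first by rewrite deriv0 mulr0 scaler0 subr0.
  apply: IHN.
    apply: leq_trans su; rewrite [in leqRHS]polySpred // ltnS.
    apply/leq_sizeP => i; rewrite leq_eqVlt Ew => /predU1P[<-|mi]; first exact: subrr.
    by rewrite nth_default ?mul0rn ?subrr // polySpred.
  by rewrite -scaleNr addrC; apply: line_spanZD => //; apply: line_span_euler.
have uE : u = u`_m *: 'X^m.
  apply/polyP => i; rewrite coefZ coefXn; have := Ew i; rewrite w0 coef0.
  have [->|im] := eqVneq i m; first by rewrite mulr1.
  move=> /esym/eqP; rewrite -!(mulr_natr u`_i) -mulrBr mulf_eq0 subr_eq0 eqr_nat.
  by rewrite (negPf im) orbF mulr0 => /eqP.
have := S1 u Su; rewrite {1}uE hornerZ hornerXn expr1n mulr1 => um.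
by rewrite uE um scale0r.
Qed.

End VanishingOnLine.
End LineEvaluation.

(** * Hamiltonian cores and the entries of q(ad x) *)

Section HamCore.
Variables (R : fieldType) (n : nat) (A : 'I_n -> 'M[R]_n).
Local Notation S := (mpoly n R).

(** The largest part of [M] stable under Hamiltonian derivations; see [ham_core_max]. *)
Definition ham_core (M : S -> Prop) (p : S) : Prop :=
  forall w : seq 'I_n, M (foldr (ham A) p w).

Lemma ham_core_ham M i p : ham_core M p -> ham_core M (ham A i p).
Proof. by move=> Mp w; have := Mp (rcons w i); rewrite foldr_rcons. Qed.

Lemma ham_core_max (M J : S -> Prop) : (forall i p, J p -> J (ham A i p)) ->
  (forall p, J p -> M p) -> forall p, J p -> ham_core M p.
Proof.
move=> Jham JM p Jp w; apply: JM; elim: w => //= i w IHw; exact: Jham.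
Qed.

Lemma foldr_hamD w p1 p2 :
  foldr (ham A) (p1 + p2) w = foldr (ham A) p1 w + foldr (ham A) p2 w.
Proof. by elim: w => //= i w ->; rewrite hamD. Qed.

Lemma ham_core_ideal M : is_ideal M -> is_ideal (ham_core M).
Proof.
move=> idM; split.
- move=> w; have -> : foldr (ham A) 0 w = 0; last exact: ideal0 idM.
  by elim: w => //= i w ->; rewrite ham0.
- by move=> p1 p2 K1 K2 w; rewrite foldr_hamD; apply: (idealD idM).
- move=> a p Kp w; elim/last_ind: w a p Kp => [|w i IHw] a p Kp.
    by apply: (idealMl idM); apply: (Kp [::]).
  rewrite foldr_rcons hamM foldr_hamD; apply: (idealD idM).
    exact: IHw.
  by apply: IHw; apply: ham_core_ham.
Qed.

Lemma ham_core_mul (M Q : S -> Prop) : is_ideal M ->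
  (forall i p, Q p -> Q (ham A i p)) -> (forall p1 p2, Q p1 -> Q p2 -> M (p1 * p2)) ->
  forall p1 p2, Q p1 -> Q p2 -> ham_core M (p1 * p2).
Proof.
move=> idM Qham QM p1 p2 Q1 Q2 w; elim/last_ind: w p1 p2 Q1 Q2 =>
  [|w i IHw] p1 p2 Q1 Q2.
  exact: QM.
rewrite foldr_rcons hamM foldr_hamD; apply: (idealD idM).
  by apply: IHw => //; apply: Qham.
by apply: IHw => //; apply: Qham.
Qed.

End HamCore.

Section HamGeneric.
Variables (R : fieldType) (n : nat) (A : 'I_n -> 'M[R]_n).
Hypotheses (LA : lie_structure A) (Ku : killing_mx A \in unitmx).
Local Notation S := (mpoly n R).
Local Notation X i := (mpolyX R (mnm1 i) : S).
Local Notation toS := (@mpolyC n R).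
Local Notation K := (killing_mx A).

Lemma ham_sum i (I : Type) (r : seq I) (F : I -> S) :
  ham A i (\sum_(l <- r) F l) = \sum_(l <- r) ham A i (F l).
Proof. by elim/big_rec2: _ => [|l x z _ <-]; rewrite ?ham0 ?hamD. Qed.

Lemma ham_mx_mul i m k l (M : 'M[S]_(m, k)) (N : 'M[S]_(k, l)) :
  map_mx (ham A i) (M *m N) = map_mx (ham A i) M *m N + M *m map_mx (ham A i) N.
Proof.
apply/matrixP => a b; rewrite !mxE ham_sum -big_split; apply: eq_bigr => c _ /=.
by rewrite hamM !mxE.
Qed.

Lemma ham_mx_add i m k (M N : 'M[S]_(m, k)) :
  map_mx (ham A i) (M + N) = map_mx (ham A i) M + map_mx (ham A i) N.
Proof. by apply/matrixP => a b; rewrite !mxE hamD. Qed.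

Lemma ham_mx_const i m k (M : 'M[R]_(m, k)) : map_mx (ham A i) (map_mx toS M) = 0.
Proof. by apply/matrixP => a b; rewrite !mxE hamC. Qed.

Lemma ham_gen_vec i : map_mx (ham A i) (gen_vec A) = - (gen_vec A *m map_mx toS (A i)).
Proof.
rewrite /gen_vec ham_mx_mul ham_mx_const mulmx0 addr0 -mulmxA -map_mxM.
have -> : invmx K *m A i = - ((A i)^T *m invmx K).
  have AK : A i *m K = - (K *m (A i)^T).
    by have := adm_killing LA (delta_mx 0 i); rewrite adm_delta.
  by rewrite -[LHS](mulmxK Ku) -(mulmxA (invmx K)) AK mulmxN mulKmx // mulNmx.
rewrite map_mxN mulmxN opprK map_mxM mulmxA; congr (_ *m _).
apply/rowP => k; rewrite !mxE hamX; apply: eq_bigr => l _.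
by rewrite !mxE -mul_mpolyC mulrC.
Qed.

Lemma ham_gen_ad i : map_mx (ham A i) (gen_ad A) =
  map_mx toS (A i) *m gen_ad A - gen_ad A *m map_mx toS (A i).
Proof.
have LAS : lie_structure (fun i => map_mx toS (A i)).
  exact: (map_lie_structure (@mpolyC n R) LA).
have E := adm_br LAS (delta_mx 0 i) (gen_vec A); rewrite adm_delta in E.
rewrite -opprB -/(gen_ad A) /gen_ad -E -admN -ham_gen_vec.
apply/matrixP => a b; rewrite mxE !summxE ham_sum; apply: eq_bigr => k _.
by rewrite !mxE hamM hamC mulr0 addr0.
Qed.

(** Equivariance: on polynomials in the generic [ad x], the Hamiltonian derivation of the [i]-th
    coordinate is the commutator with [A i]. *)
Lemma ham_gen_min q i : map_mx (ham A i) (gen_min A q) =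
  map_mx toS (A i) *m gen_min A q - gen_min A q *m map_mx toS (A i).
Proof.
rewrite /gen_min /mapq; elim/poly_ind: q => [|q c IHq].
  rewrite rmorph0 polymx0 mulmx0 mul0mx subrr.
  by apply/matrixP => a b; rewrite !mxE ham0.
rewrite rmorphD rmorphM /= map_polyX map_polyC /=.
rewrite polymxD polymxM polymxX polymxC ham_mx_add ham_mx_mul IHq ham_gen_ad.
have -> : map_mx (ham A i) ((mpolyC n c)%:M : 'M[S]_n) = 0.
  by rewrite (_ : _%:M = map_mx toS (c%:M : 'M[R]_n)) ?ham_mx_const ?map_scalar_mx.
rewrite addr0 [in RHS]mulmxDr [in RHS]mulmxDl mul_mx_scalar mul_scalar_mx.
by rewrite mulmxBl mulmxBr !mulmxA addrA subrK opprD addrACA subrr addr0 //.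
Qed.

(** The ideal of the entries of q(ad x), in trace form so that cyclicity turns equivariance into
    stability. *)
Definition gen_min_ideal q (p : S) : Prop :=
  exists c : 'M[S]_n, p = \tr (c *m gen_min A q).

Lemma gen_min_ideal_ham q i p : gen_min_ideal q p -> gen_min_ideal q (ham A i p).
Proof.
move=> [c ->].
exists (map_mx (ham A i) c + c *m map_mx toS (A i) - map_mx toS (A i) *m c).
have -> : ham A i (\tr (c *m gen_min A q)) =
    \tr (map_mx (ham A i) (c *m gen_min A q)).
  by rewrite /mxtrace ham_sum; apply: eq_bigr => a _; rewrite [RHS]mxE.
have E : \tr (c *m (gen_min A q *m map_mx toS (A i))) =
    \tr (map_mx toS (A i) *m c *m gen_min A q).
  by rewrite mulmxA mxtrace_mulC mulmxA.
rewrite ham_mx_mul ham_gen_min mulmxBr mulmxBl mulmxDl.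
by rewrite addrA mulmxA [LHS](raddfB (@mxtrace S n)) [RHS](raddfB (@mxtrace S n)) /= E.
Qed.

Lemma gen_min_ideal_mem q a b : gen_min_ideal q (gen_min A q a b).
Proof.
exists (delta_mx b a); rewrite /mxtrace (bigD1 b) //= big1 => [|c cb].
  rewrite addr0 mxE (bigD1 a) //= big1 => [|d da]; rewrite !mxE ?eqxx ?mul1r ?addr0 //.
  by rewrite (negPf da) andbF mul0r.
by rewrite mxE big1 // => d _; rewrite mxE (negPf cb) mul0r.
Qed.

End HamGeneric.

(** * The ideal attached to a Jordan decomposition *)

Section JordanObstruction.
Variables (R : numFieldType) (C : numClosedFieldType) (f : {rmorphism R -> C}).
Variables (n : nat) (A : 'I_n -> 'M[R]_n).
Hypotheses (LA : lie_structure A) (Ku : killing_mx A \in unitmx).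
Local Notation S := (mpoly n R).
Local Notation X i := (mpolyX R (mnm1 i) : S).
Local Notation toS := (@mpolyC n R).
Local Notation K := (killing_mx A).

Variable O : ('I_n -> R) -> Prop.
Hypothesis vanish_ham : forall i g, vanish O g -> vanish O (ham A i g).
Variable p : 'I_n -> R.
Hypothesis Op : O p.
Local Notation Y := (adm A (pt_vec A p)).
Variable q : {poly R}.
Hypotheses (q0 : q.[0] = 0)
  (qroots : forall z, root (map_poly f (char_poly Y)) z -> root (map_poly f q) z).

Local Notation F := (gen_min A q).

(** [J] is the core of the polynomials of order at least 2 at t = 0 along the line s + t v. It
    contains those vanishing on O by [line_vanish], as t = 1 is the given point. The entries of q(ad
    x) and their Hamiltonian derivatives vanish at [s], so products of two entries have order 2. *)
Lemma jordan_core : exists J : S -> Prop,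
  [/\ is_ideal J, forall i g, J g -> J (ham A i g), forall g, vanish O g -> J g,
      (forall i j, J (struct_poly A i j)) -> polymx Y q = 0 &
      forall a b c d, J (F a b * F c d)].
Proof.
pose AC i := map_mx f (A i); pose x := map_mx f (pt_vec A p).
have LAC : lie_structure AC by apply: map_lie_structure.
have KC : killing_mx AC = map_mx f K by rewrite map_killing_mx.
have KuC : killing_mx AC \in unitmx by rewrite KC map_unitmx.
have YC : adm AC x = map_mx f Y by rewrite map_adm.
have [s [h [sh vh sq]]] := jordan_flow LAC KuC x; set v := x - s in vh.
pose L := line f A s v.
pose M g := ('X^2 : {poly C}) %| L g.
have idM : is_ideal M.
  split.
  - by rewrite /M rmorph0 dvdp0.
  - by move=> g1 g2; rewrite /M rmorphD; apply: dvdp_add.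
  - by move=> a g; rewrite /M rmorphM; apply: dvdp_mull.
have Lham := line_ham LA sh vh.
have LX k : L (X k) = ((s *m killing_mx AC) 0 k)%:P + ((v *m killing_mx AC) 0 k)%:P * 'X.
  exact: lineX.
have L1 g : (L g).[1] = f (meval p g).
  elim/mpoly_gen_ind: g => [c|k|g1 g2 E1 E2|g1 g2 E1 E2].
  - by rewrite /L lineC hornerC mevalC.
  - rewrite LX hornerD hornerC hornerM hornerC hornerX mulr1 mevalXU.
    have <- : (x *m killing_mx AC) 0 k = (s *m killing_mx AC) 0 k + (v *m killing_mx AC) 0 k.
      by rewrite -{1}(subrK s x) -/v addrC mulmxDl mxE.
    by rewrite KC /x -map_mxM /pt_vec mulmxKV // !mxE.
  - by rewrite rmorphD hornerD E1 E2 mevalD rmorphD.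
  - by rewrite rmorphM hornerM E1 E2 mevalM rmorphM.
exists (ham_core A M); split.
- exact: ham_core_ideal.
- by move=> i g; apply: ham_core_ham.
- apply: ham_core_max => // g vg.
  rewrite /M (_ : L g = 0) ?dvdp0 //.
  apply: (line_vanish LA sh vh vanish_ham) vg => g' vg'.
  by rewrite [LHS]L1 vg' // rmorph0.
- move=> Jst.
  (* By [line_ham], the combination with weights [h 0 i] of the brackets with the [k]-th coordinate
     restricts to -t times the [k]-th coordinate of [v] in the dual. This is divisible by t^2 only
     if that coordinate is zero. *)
  have v0 : v = 0.
    suff vK : v *m killing_mx AC = 0 by rewrite -[v](mulmxK KuC) vK mul0mx.
    apply/rowP => k; rewrite [RHS]mxE.
    have : ('X^2 : {poly C}) %| \sum_i h 0 i *: L (ham A i (X k)).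
      apply: (big_ind (fun u => 'X^2 %| u)) => [|a b|i _].
      - exact: dvdp0.
      - exact: dvdp_add.
      - by rewrite -mul_polyC dvdp_mull // hamX; apply: (Jst i k [::]).
    rewrite /L (Lham (X k)) -[line _ _ _ _ _]/(L (X k)) LX.
    rewrite derivD derivC add0r derivM derivC mul0r add0r derivX mulr1.
    rewrite dvdpNr expr2 dvdp_mul2l ?polyX_eq0 //.
    rewrite -[Z in Z %| _]subr0 -polyC0 dvdp_XsubCl rootE hornerC => /eqP.
    exact.
  have xs : x = s by apply/eqP; rewrite -subr_eq0; apply/eqP.
  apply/eqP; rewrite -(map_mx_eq0 f) map_polymx -YC xs; apply/eqP/sq => z.
  by rewrite YC -map_char_poly; apply: qroots.
- move=> a b c d; apply: (ham_core_mul (Q := gen_min_ideal A q)) => //.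
  + by move=> i g; apply: gen_min_ideal_ham.
  + have LQ g : gen_min_ideal A q g -> 'X %| L g.
      move=> [c' ->]; rewrite -[Z in Z %| _]subr0 -polyC0 dvdp_XsubCl rootE.
      pose L0 : {rmorphism S -> C} := horner_eval 0 \o L.
      have L0E r (N : 'M[S]_r) : (L (\tr N)).[0] = \tr (map_mx L0 N).
        by rewrite -[LHS]/(L0 _) raddf_sum; apply: eq_bigr => i _; rewrite [RHS]mxE.
      rewrite L0E map_mxM.
      suff -> : map_mx L0 F = 0 by rewrite mulmx0 mxtrace0.
      have L0C c0 : L0 (mpolyC n c0) = f c0 by rewrite /L0 /= /horner_eval lineC hornerC.
      have L0M m k (N : 'M[R]_(m, k)) : map_mx L0 (map_mx toS N) = map_mx f N.
        by apply/matrixP => i j; rewrite !mxE L0C.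
      rewrite /gen_min map_polymx /mapq -map_poly_comp.
      have -> : map_mx L0 (gen_ad A) = adm AC s.
        rewrite /gen_ad map_adm; congr adm; first by apply/funext => i; apply: L0M.
        rewrite map_mxM L0M map_invmx -KC -[s in RHS](mulmxK KuC); congr (_ *m _).
        apply/rowP => k; rewrite [LHS]mxE [(\row__ _) _ _]mxE /L0 /= /horner_eval LX.
        by rewrite hornerD hornerC hornerM hornerX mulr0 addr0.
      rewrite (eq_map_poly L0C); apply: sq => z.
      by rewrite YC -map_char_poly; apply: qroots.
    by move=> g1 g2 /LQ d1 /LQ d2; rewrite /M rmorphM expr2; apply: dvdp_mul.
  + exact: gen_min_ideal_mem.
  + exact: gen_min_ideal_mem.
Qed.

(** If [T] = q(ad y) were nonzero, its entries would have zero Hamiltonian derivatives at [p], so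
    [T] would commute with all of [ad] and lie in the centroid. As [T] is a multiple of [Y] and [y]
    commutes with itself, [y T = 0], then [Y T = 0] and [T T = 0]. Hence [ad (u T) ad w] squares to
    zero for all u and w, and nondegeneracy of the Killing form gives [T = 0]. *)
Lemma central_annihilator :
  (forall a b c d i, meval p (ham A i (F a b * F c d)) = 0) -> polymx Y q = 0.
Proof.
pose T := polymx Y q => cen.
have FT : map_mx (meval p) F = T by rewrite map_meval_polymx gen_adE.
have FTE a b : meval p (F a b) = T a b by rewrite -FT mxE.
have hamFT i : map_mx (meval p) (map_mx (ham A i) F) = A i *m T - T *m A i.
  have mevalmapK (N : 'M[R]_n) : map_mx (meval p) (map_mx toS N) = N.
    by apply/matrixP => a b; rewrite !mxE /= mevalC.
  by rewrite ham_gen_min // map_mxB !map_mxM mevalmapK FT.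
apply/eqP/negPn/negP => /eqP T0.
have [[a [b Tab]]|noT] := pselect (exists a b, T a b != 0); last first.
  apply: T0; apply/matrixP => a b; rewrite [RHS]mxE; apply/eqP/negPn/negP => Tab.
  by apply: noT; exists a, b.
have comm i : A i *m T = T *m A i.
  apply/eqP; rewrite -subr_eq0 -hamFT; apply/eqP/matrixP => c d.
  rewrite [LHS]mxE [Z in meval p Z]mxE [RHS]mxE.
  have prod c' d' : meval p (ham A i (F a b)) * T c' d' +
      T a b * meval p (ham A i (F c' d')) = 0.
    by rewrite -!FTE -!mevalM -mevalD -hamM.
  (* Equal entries give 2 T_ab {x_i, F_ab} = 0 at [p]. *)
  have Nab : meval p (ham A i (F a b)) = 0.
    have := prod a b; rewrite mulrC -mulrDr => /eqP; rewrite mulf_eq0 (negPf Tab) /=.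
    by rewrite -mulr2n mulrn_eq0 /= => /eqP.
  have := prod c d; rewrite Nab mul0r add0r => /eqP.
  by rewrite mulf_eq0 (negPf Tab) /= => /eqP.
have commA u : adm A u *m T = T *m adm A u.
  by rewrite mulmx_suml mulmx_sumr; apply: eq_bigr => i _; rewrite -scalemxAl -scalemxAr comm.
have centroid u : adm A (u *m T) = adm A u *m T.
  apply/row_matrixP => i; rewrite !rowE.
  rewrite (mul_adm_anti LA) -mulmxA -commA mulmxA -mulNmx -(mul_adm_anti LA).
  by rewrite mulmxA.
set y := pt_vec A p.
have yY : y *m Y = 0.
  apply/eqP; have /eqP := mul_adm_anti LA y y.
  by rewrite -addr_eq0 -mulr2n -scaler_nat scaler_eq0 pnatr_eq0.
have yT : y *m T = 0.
  have qX : q = (q %/ 'X) * 'X.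
    by rewrite divpK // -[Z in Z %| _]subr0 -polyC0 dvdp_XsubCl rootE q0.
  rewrite /T qX polymxM polymxX polymx_comm // mulmxA yY mul0mx //.
have YT : Y *m T = 0 by rewrite -centroid yT adm0.
have TT : T *m T = 0.
  rewrite {1}/T; have qX : q = (q %/ 'X) * 'X.
    by rewrite divpK // -[Z in Z %| _]subr0 -polyC0 dvdp_XsubCl rootE q0.
  by rewrite {1}qX polymxM polymxX -mulmxA YT mulmx0.
apply: T0; apply/row_matrixP => i; rewrite row0 rowE.
apply: (killing_nondegenerate Ku) => w.
apply: (@mxtrace_nilpotent _ _ _ 2); rewrite centroid expr2.
set U := adm A _; set W := adm A w.
have -> : U *m T *m W * (U *m T *m W) = U *m W *m U *m (T *m T) *m W.
  rewrite -[LHS]/(U *m T *m W *m (U *m T *m W)) !mulmxA.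
  by rewrite -[U *m T *m W]mulmxA -commA !mulmxA -[_ *m T *m U]mulmxA -commA !mulmxA.
by rewrite TT mulmx0 mul0mx.
Qed.

End JordanObstruction.

(** * Cartan's criterion *)

Section LieBracketTheory.
Variables (K : fieldType) (L : lmodType K) (br : L -> L -> L).
Hypothesis lieL : is_lie_bracket br.

Lemma brDl x y z : br (x + y) z = br x z + br y z.
Proof. by have := lie_linearl lieL z 1 x y; rewrite !scale1r. Qed.

Lemma brDr x y z : br x (y + z) = br x y + br x z.
Proof. by have := lie_linearr lieL x 1 y z; rewrite !scale1r. Qed.

Lemma br0l x : br 0 x = 0.
Proof. by apply: (addrI (br 0 x)); rewrite -brDl !addr0. Qed.

Lemma br0r x : br x 0 = 0.
Proof. by apply: (addrI (br x 0)); rewrite -brDr !addr0. Qed.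

Lemma brZl a x y : br (a *: x) y = a *: br x y.
Proof. by have := lie_linearl lieL y a x 0; rewrite br0l !addr0. Qed.

Lemma brZr a x y : br x (a *: y) = a *: br x y.
Proof. by have := lie_linearr lieL x a y 0; rewrite br0r !addr0. Qed.

Lemma br_anti x y : br x y = - br y x.
Proof.
apply/eqP; rewrite -addr_eq0; apply/eqP.
have := lie_alternating lieL (x + y); rewrite brDl !brDr !(lie_alternating lieL).
by rewrite add0r addr0.
Qed.

Lemma brNr x y : br x (- y) = - br x y.
Proof. by rewrite -!scaleN1r brZr. Qed.

Lemma br_jacobi x y z : br x (br y z) = br (br x y) z + br y (br x z).
Proof.
have /eqP := lie_jacobi lieL x y z; rewrite -addrA addr_eq0 => /eqP ->.
by rewrite opprD addrC [br z x]br_anti brNr opprK -br_anti.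
Qed.

Lemma br_line a b u v w :
  br (u + a *: w) (v + b *: w) = br u v + b *: br u w - a *: br v w.
Proof.
rewrite brDl !brDr !brZl !brZr (lie_alternating lieL) !scaler0 addr0.
by rewrite [br w v]br_anti scalerN.
Qed.

Lemma foldr_br_is_linear s : linear (fun x => foldr br x s).
Proof.
move=> a x y; elim: s => //= u s ->.
by rewrite brDr brZr.
Qed.

End LieBracketTheory.

Section LinearSpan.
Variables (K : fieldType) (L : lmodType K).

Lemma subspace_linear_span (A : set L) : subspace (linear_span A).
Proof.
split=> [W [[W0 _] _] //|a u v Au Av W [sW AW]].
by have [_ lin] := sW; apply: lin; [apply: Au|apply: Av].
Qed.

Lemma sub_linear_span (A : set L) : A `<=` linear_span A.
Proof. by move=> x Ax W [_ AW]; apply: AW. Qed.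

Lemma linear_span_min (A W : set L) :
  subspace W -> A `<=` W -> linear_span A `<=` W.
Proof. by move=> sW AW x; apply; split. Qed.

Lemma subspaceD (W : set L) x y : subspace W -> W x -> W y -> W (x + y).
Proof. by move=> [_ lin] Wx Wy; rewrite -(scale1r x); apply: lin. Qed.

Lemma subspaceZ (W : set L) a x : subspace W -> W x -> W (a *: x).
Proof. by move=> [W0 lin] Wx; rewrite -(addr0 (a *: x)); apply: lin. Qed.

End LinearSpan.

(** * Engel's theorem *)

Section Engel.
Variables (K : fieldType) (g : vectType K) (br : g -> g -> g).
Hypothesis lieg : is_lie_bracket br.

(* The span of the words [p_1, [p_2, ..., [p_j, v]]] with letters in P. *)
Inductive word_span (P : set g) : nat -> set g :=
| word_span0 v : word_span P 0 v
| word_spanS j u v : P u -> word_span P j v -> word_span P j.+1 (br u v)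
| word_span_lin j a u v :
    word_span P j u -> word_span P j v -> word_span P j (a *: u + v)
| word_span_zero j : word_span P j 0.

Lemma subspace_word_span P j : subspace (word_span P j).
Proof. by split; [apply: word_span_zero|move=> *; apply: word_span_lin]. Qed.

Definition word_nil (P : set g) (N : nat) : Prop :=
  forall s, size s = N -> (forall u, u \in s -> P u) -> forall x, foldr br x s = 0.

Lemma word_span_nil P N : word_nil P N -> word_span P N `<=` [set 0].
Proof.
move=> nilP v wv.
suff nil_j j w : word_span P j w -> forall s, (size s + j)%N = N ->
    (forall u, u \in s -> P u) -> foldr br w s = 0.
  by apply: (nil_j N v wv [::]).
move=> {v wv} jw; elim: j w / jw => [v s|j u v Pu wv IH s|j a u v _ IHu _ IHv s|j s].
- by rewrite addn0 => sN Ps; apply: nilP.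
- rewrite addnS -addSn => sN Ps; have := IH (rcons s u).
  rewrite size_rcons foldr_rcons; apply=> // w.
  by rewrite mem_rcons inE => /orP[/eqP ->|/Ps].
- by move=> sN Ps; rewrite foldr_br_is_linear // IHu // IHv // scaler0 addr0.
- by move=> _ _; elim: s => //= u s ->; rewrite br0r.
Qed.

Lemma word_span_pred P j v : word_span P j v -> word_span P j.-1 v.
Proof.
elim=> {j v} [v|j u v Pu wv IH|j a u v _ IHu _ IHv|j].
- exact: word_span0.
- by case: j IH {wv} => [|j] IH; [apply: word_span0|apply: word_spanS].
- exact: word_span_lin.
- exact: word_span_zero.
Qed.

Lemma word_span_normal P w j v :
  (forall u, P u -> P (br w u)) -> word_span P j v -> word_span P j (br w v).
Proof.
move=> Pw; elim=> {j v} [v|j u v Pu wv IH|j a u v _ IHu _ IHv|j].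
- exact: word_span0.
- rewrite br_jacobi //; apply: (subspaceD (subspace_word_span _ _)).
    by apply: word_spanS => //; apply: Pw.
  exact: word_spanS.
- by rewrite brDr // brZr //; apply: word_span_lin.
- by rewrite br0r //; apply: word_span_zero.
Qed.

(* Jacobson's proof: w acts nilpotently on the quotients of the filtration by *)
(* words in U.                                                                *)
Lemma word_nil_extend (U : {vspace g}) w N m :
  (forall u, u \in U -> br w u \in U) -> word_nil [set u | u \in U] N ->
  (forall x, iter m (br w) x = 0) ->
  word_nil [set u | u \in (U + <[w]>)%VS] (m * N).
Proof.
move=> wU nilU nilw; set P := [set u | u \in U]; set Q := [set u | _].
have sW j := subspace_word_span P j.
have wP j v : word_span P j v -> word_span P j (br w v).
  by apply: word_span_normal => u /wU.
have actU s j v : (forall u, u \in s -> Q u) -> word_span P j v ->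
  word_span P j (foldr br v s) /\
  exists a, word_span P j.+1 (foldr br v s - a *: iter (size s) (br w) v).
  elim: s => [|x s IHs] Qs wv /=.
    by split=> //; exists 1; rewrite scale1r subrr; apply: word_span_zero.
  have [] := IHs _ wv; first by move=> u us; apply: Qs; rewrite inE us orbT.
  set v' := foldr br v s => wv' [a wa].
  have /memv_addP[u uU [_ /vlineP[b ->] xE]] : Q x by apply: Qs; rewrite mem_head.
  have buv : word_span P j.+1 (br u v') by apply: word_spanS.
  rewrite xE brDl // brZl //; split.
    apply: (subspaceD (sW _)); first exact: word_span_pred buv.
    by apply: (subspaceZ _ (sW _)); apply: wP.
  exists (b * a); rewrite -addrA; apply: (subspaceD (sW _)) => //.
  rewrite -scalerA -scalerBr; apply: (subspaceZ _ (sW _)).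
  by rewrite -brZr // -brNr // -brDr //; apply: wP.
have nilstep j s v : size s = m -> (forall u, u \in s -> Q u) ->
    word_span P j v -> word_span P j.+1 (foldr br v s).
  move=> sm Qs /(actU s j v Qs)[_ [a]].
  by rewrite sm nilw scaler0 subr0.
move=> s sN Qs x.
have step j : (j <= N)%N -> forall s', size s' = (m * j)%N ->
    (forall u, u \in s' -> Q u) -> word_span P j (foldr br x s').
  elim: j => [|j IHj] jN s' ss Qs'; first exact: word_span0.
  rewrite -(cat_take_drop m s') foldr_cat; apply: nilstep.
  - by rewrite size_takel // ss mulnS leq_addr.
  - by move=> u /mem_take/Qs'.
  - apply: IHj; first exact: ltnW.
      by rewrite size_drop ss mulnS addKn.
    by move=> u /mem_drop/Qs'.
by apply: (word_span_nil nilU); apply: step.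
Qed.

(** Let [U] be a subalgebra inside [Z], of largest dimension, whose long words act by zero. For [z]
    in [Z] outside [U], a longest word of [U] sending [z] outside [U] yields an element [w]
    normalizing [U], and [word_nil_extend] enlarges [U] by [w]. *)
Lemma engel (Z : set g) : subspace Z -> (forall x y, Z x -> Z y -> Z (br x y)) ->
  (forall z, Z z -> exists N, forall x, iter N (br z) x = 0) ->
  exists N, word_nil Z N.
Proof.
move=> sZ Zbr Znil.
pose good (U : {vspace g}) := [/\ forall u, u \in U -> Z u,
  forall u v, u \in U -> v \in U -> br u v \in U &
  exists N, word_nil [set u | u \in U] N].
have exd : exists d, `[< exists U, good U /\ \dim U = d >].
  exists 0; apply/asboolP; exists 0%VS; rewrite dimv0; split=> //; split.
  - by move=> u; rewrite memv0 => /eqP ->; case: sZ.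
  - by move=> u v; rewrite !memv0 => /eqP -> /eqP ->; rewrite br0l.
  - exists 1 => -[|u [|//]] //= _ Pu x.
    have := Pu u (mem_head _ _); rewrite /= memv0 => /eqP ->.
    by rewrite br0l.
have dmax d : `[< exists U, good U /\ \dim U = d >] -> (d <= \dim {:g})%N.
  by move=> /asboolP[U [_ <-]]; apply: dimvS; apply: subvf.
case: (ex_maxnP exd dmax) => d /asboolP[U [[UZ Ubr [N nilU]] Ud]] Umax.
suff ZU z : Z z -> z \in U.
  by exists N => s sN Zs; apply: nilU => // u us; apply/ZU/Zs.
move=> Zz; apply: contrapT => zU.
have [w [Zw wU wnorm]] : exists w, [/\ Z w, w \notin U &
    forall u, u \in U -> br u w \in U].
  have exk : exists k, `[< forall s, size s = k -> (forall u, u \in s -> u \in U) ->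
      foldr br z s \in U >].
    exists N; apply/asboolP => s sN Us; rewrite (nilU s sN Us); exact: mem0v.
  case: (ex_minnP exk) => -[|k] /asboolP kP kmin.
    by case: zU; apply: (kP [::]).
  have : ~ forall s, size s = k -> (forall u, u \in s -> u \in U) ->
      foldr br z s \in U.
    by move=> /asboolP/kmin; rewrite ltnn.
  move=> /existsNP[s /not_implyP[sk /not_implyP[sU wU]]].
  exists (foldr br z s); split; last 1 first.
  - move=> u uU; apply: (kP (u :: s)); first by rewrite /= sk.
    by move=> v; rewrite inE => /orP[/eqP ->|/sU].
  - elim: s sU {sk wU} => //= u s IHs sU; apply: Zbr.
      by apply/UZ/sU; rewrite mem_head.
    by apply: IHs => v vs; apply: sU; rewrite inE vs orbT.
  - exact/negP.
have goodUw : good (U + <[w]>)%VS.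
  split.
  - move=> _ /memv_addP[u uU [_ /vlineP[b ->] ->]].
    by apply: (subspaceD sZ); [apply: UZ|apply: subspaceZ].
  - move=> x y /memv_addP[u uU [_ /vlineP[a ->] ->]] /memv_addP[v vU [_ /vlineP[b ->] ->]].
    apply: (subvP (addvSl U <[w]>%VS)); rewrite br_line //.
    apply: memvB; last by apply: memvZ; apply: wnorm.
    by apply: memvD; [apply: Ubr|apply: memvZ; apply: wnorm].
  - have [m wm] := Znil w Zw; exists (m * N)%N.
    apply: word_nil_extend => // u uU; rewrite br_anti // memvN; exact: wnorm.
have : (\dim (U + <[w]>)%VS <= d)%N.
  by apply: Umax; apply/asboolP; exists (U + <[w]>)%VS.
rewrite -Ud => dle; case/negP: wU.
have /eqP -> : U == (U + <[w]>)%VS by rewrite eqEdim addvSl.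
by apply: (subvP (addvSr _ _)); apply: memv_line.
Qed.

End Engel.

From mathcomp Require Import complex.

(** * The radical of the Killing form *)

Section Coordinates.
Variables (R : realType) (g : vectType R) (br : g -> g -> g).
Hypothesis lieg : is_lie_bracket br.
Local Notation n := (\dim {:g}).
Local Notation e := (vbasis {:g}).
Local Notation rV := (rVof e).

Definition struct_mx (i : 'I_n) : 'M[R]_n := ad_mx br e`_i.
Local Notation A := struct_mx.

Lemma linfun_br x y : linfun (br x) y = br x y.
Proof.
pose f : {linear g -> g} := HB.pack (br x)
  (GRing.isLinear.Build _ _ _ _ (br x) (lie_linearr lieg x)).
exact: (lfunE f).
Qed.

Lemma rVof_br x y : rV (br x y) = rV y *m ad_mx br x.
Proof. by rewrite -linfun_br (rVof_app _ (vbasisP _)). Qed.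

Lemma ad_mxE x : ad_mx br x = adm A (rV x).
Proof.
apply/row_matrixP => i; rewrite !rowE -(rVofE (vbasisP _)) -rVof_br.
rewrite [x in LHS](coord_vbasis (memvf x)) /adm mulmx_sumr.
pose f : {linear g -> g} := HB.pack (br^~ e`_i)
  (GRing.isLinear.Build _ _ _ _ (br^~ e`_i) (lie_linearl lieg e`_i)).
rewrite -[br _ _]/(f _) linear_sum raddf_sum; apply: eq_bigr => j _ /=.
by rewrite brZl // linearZ /= rVof_br mxE -scalemxAr.
Qed.

Lemma lie_structure_struct_mx : lie_structure A.
Proof.
have eE i : delta_mx 0 i = rV e`_i by rewrite rVofE // vbasisP.
split=> i j.
  by rewrite !rowE !eE -!rVof_br br_anti // raddfN.
rewrite rowE eE -rVof_br -ad_mxE; apply/row_matrixP => k.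
rewrite !rowE eE -rVof_br mulmxBr !mulmxA -!rVof_br.
by rewrite br_jacobi // raddfD /= addrK.
Qed.

Lemma killingE x y : killing br x y = (rV x *m killing_mx A *m (rV y)^T) 0 0.
Proof. by rewrite /killing !ad_mxE tr_admM. Qed.

Definition killing_rad : set g := [set x | rV x *m killing_mx A = 0].

Lemma subspace_killing_rad : subspace killing_rad.
Proof.
split; first by rewrite /killing_rad /= raddf0 mul0mx.
move=> a u v; rewrite /killing_rad /= => u0 v0.
by rewrite linearP /= mulmxDl -scalemxAl u0 v0 scaler0 addr0.
Qed.

Lemma killing_rad_ideal : lie_ideal br killing_rad.
Proof.
split=> [|x y]; first exact: subspace_killing_rad.
rewrite /killing_rad /= => y0; rewrite rVof_br ad_mxE -mulmxA.
by rewrite (adm_killing lie_structure_struct_mx) mulmxN mulmxA y0 mul0mx oppr0.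
Qed.

(** Over the complex numbers, the trace of a derivation D against ad [x, y] is minus the Killing
    pairing of x with D y, which is zero for x in the radical; [trace_derivation_nilpotent]
    concludes. *)
Lemma bracket_span_rad_nilpotent z : bracket_span br killing_rad killing_rad z ->
  exists N, forall x, iter N (br z) x = 0.
Proof.
move=> zZ.
pose AC i : 'M[R[i]]_n := map_mx (real_complex R) (A i).
have LAC : lie_structure AC.
  exact: (map_lie_structure (real_complex R) lie_structure_struct_mx).
have adC x : map_mx (real_complex R) (ad_mx br x) =
    adm AC (map_mx (real_complex R) (rV x)).
  by rewrite ad_mxE map_adm.
have [N zN] : exists N, adm AC (map_mx (real_complex R) (rV z)) ^+ N = 0.
  apply: (trace_derivation_nilpotent LAC) => M dM.
  pose W := [set x | \tr (M *m adm AC (map_mx (real_complex R) (rV x))) = 0].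
  have sW : subspace W.
    split; first by rewrite /W /= raddf0 map_mx0 adm0 mulmx0 mxtrace0.
    move=> a u v; rewrite /W /= => u0 v0.
    rewrite linearP /= map_mxD map_mxZ admD admZ mulmxDr -scalemxAr mxtraceD.
    by rewrite mxtraceZ u0 v0 mulr0 addr0.
  apply: (linear_span_min sW _ zZ) => _ [x xr [y _ <-]]; rewrite /W /=.
  rewrite rVof_br map_mxM adC (tr_derivation_br LAC) // derivation_killing //.
  rewrite tr_admM -(map_killing_mx (real_complex R)) -map_mxM.
  by rewrite xr map_mx0 mul0mx mxE oppr0.
exists N => x; have adN : ad_mx br z ^+ N = 0.
  apply: (map_mx_inj (f := real_complex R)); rewrite map_mx0 -zN -adC.
  elim: (N) => [|k IHk]; first by rewrite !expr0 map_mx1.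
  by rewrite !exprS map_mxM IHk.
have iterE k : rV (iter k (br z) x) = rV x *m ad_mx br z ^+ k.
  elim: k => [|k IHk]; first by rewrite mulmx1.
  by rewrite iterS rVof_br IHk exprSr -mulmxA.
by apply: (can_inj (rVofK (vbasisP {:g}))); rewrite iterE adN mulmx0 raddf0.
Qed.

(** Engel's theorem applies to the derived algebra [Z] of the radical, and each step of the derived
    series lands in the span of longer words in [Z]. *)
Lemma killing_rad_solvable : lie_solvable br killing_rad.
Proof.
set Z := bracket_span br killing_rad killing_rad.
have sZ : subspace Z by apply: subspace_linear_span.
have Zrad : Z `<=` killing_rad.
  apply: linear_span_min; first exact: subspace_killing_rad.
  by move=> _ [x _ [y yr <-]]; apply: (proj2 killing_rad_ideal).
have Zbr x y : Z x -> Z y -> Z (br x y).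
  move=> Zx Zy; apply: sub_linear_span; exists x; first exact: Zrad.
  by exists y => //; apply: Zrad.
have [N nilZ] := engel lieg sZ Zbr bracket_span_rad_nilpotent.
exists N.+1 => x /= Ix.
suff : forall k, iter k.+1 (fun W => bracket_span br W W) killing_rad `<=`
    Z `&` word_span br Z k.
  by move=> /(_ N x Ix)[_ /(word_span_nil lieg nilZ)].
elim=> [y Zy|k IHk]; first by split=> //; apply: word_span0.
rewrite iterS; apply: linear_span_min.
  have [Z0 Zlin] := sZ; have [w0 wlin] := subspace_word_span br Z k.+1.
  by split=> // a u v [Zu wu] [Zv wv]; split; [apply: Zlin|apply: wlin].
move=> _ [u /IHk[Zu _] [v /IHk[Zv wv] <-]]; split; first exact: Zbr.
exact: word_spanS.
Qed.

Lemma killing_mx_unit : lie_semisimple br -> killing_mx A \in unitmx.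
Proof.
move=> ss; rewrite -row_free_unit; apply: inj_row_free => v v0.
have := ss _ killing_rad_ideal killing_rad_solvable (vecof e v).
rewrite /killing_rad /= vecofK ?vbasisP // => /(_ v0) /eqP.
by rewrite vecof_eq0 ?vbasisP // => /eqP.
Qed.

End Coordinates.

Import numFieldNormedType.Exports.

(** * The adjoint action in a chart *)

Section DifferentiableNear.
Variables (R : realType) (V W : normedModType R).

(** Differentials are local: the difference of the two functions is zero near [x], hence has zero
    differential. *)
Lemma near_is_diff (f h df : V -> W) (x : V) :
  (\forall y \near x, f y = h y) -> is_diff x f df -> is_diff x h df.
Proof.
move=> fh [Df dfE].
pose k : V -> W := h - f.
have k0 : \forall y \near x, k y = 0.
  by near=> y; rewrite /k /= !fctE -(near fh y) ?subrr.
have kx : k x = 0 by apply: nbhs_singleton k0.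
have zc : continuous (\0 : V -> W) by move=> ?; apply: cvg_cst.
have kO : k \o shift x = cst (k x) + (\0 : V -> W) +o_ (0 : V) id.
  apply/eqaddoP => eps eps0.
  have : \forall y \near (0 : V), k (y + x) = 0.
    by move: k0; rewrite (near_shift 0 x) subr0.
  move=> h0; near=> y.
  rewrite !fctE /= (near h0 y) // kx addr0 subr0 normr0 mulr_ge0 //; exact: ltW.
have dk : is_diff x k (\0).
  apply: DiffDef; last exact: diff_unique.
  by apply/diff_locallyP; rewrite (diff_unique zc kO).
have -> : h = f + k by apply/funext => y; rewrite /k /= !fctE addrC subrK.
have -> : df = df + \0 by apply/funext => y; rewrite !fctE addr0.
by apply: is_diffD.
Unshelve. all: by end_near.
Qed.

End DifferentiableNear.

Lemma is_diff_comp_at (R : realType) (U V W : normedModType R)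
    (f df : U -> V) (h dh : V -> W) x y :
  f x = y -> is_diff x f df -> is_diff y h dh -> is_diff x (h \o f) (dh \o df).
Proof. by move=> <- isf ish; apply: is_diff_comp. Qed.

Section DifferentiableScale.
Variables (R : realType) (V : normedModType R) (n : nat).

Lemma differentiable_rV_scale (k : V -> R) (f : V -> 'rV[R]_n) x :
  differentiable k x -> differentiable f x ->
  differentiable (fun y => k y *: f y) x.
Proof.
move=> dk df.
have -> : (fun y => k y *: f y) =
    \sum_(j < n) (fun y => (k y * f y 0 j) *: (delta_mx 0 j : 'rV[R]_n)).
  apply/funext => y; rewrite fct_sumE {1}[f y]row_sum_delta scaler_sumr.
  by apply: eq_bigr => j _; rewrite scalerA.
apply: differentiable_sum => j; apply: differentiableZl.
apply: differentiableM => //.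
exact: (differentiable_comp df (differentiable_coord _ _ _)).
Qed.

End DifferentiableScale.

Section Charts.
Variables (R : realType) (n : nat) (T : topologicalType) (c : chart R n T).

Lemma chart_codP x : chart_dom c x -> chart_cod c (chart_to c x).
Proof. by exists x. Qed.

Lemma chart_fromK u : chart_cod c u -> chart_to c (chart_from c u) = u.
Proof. by move=> [x cx <-]; rewrite chart_toK. Qed.

Lemma near_chart_dom x : chart_dom c x -> \forall y \near x, chart_dom c y.
Proof. by move=> cx; apply: open_nbhs_nbhs; split=> //; apply: chart_dom_open. Qed.

Lemma near_chart_cod u : chart_cod c u -> \forall v \near u, chart_cod c v.
Proof. by move=> cu; apply: open_nbhs_nbhs; split=> //; apply: chart_cod_open. Qed.

Lemma chart_to_cvg x : chart_dom c x -> {for x, continuous (chart_to c)}.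
Proof.
have := @chart_to_continuous _ _ _ c.
rewrite continuous_open_subspace; last exact: chart_dom_open.
by move=> h cx; apply: h; rewrite inE.
Qed.

Lemma chart_from_cvg u : chart_cod c u -> {for u, continuous (chart_from c)}.
Proof.
have := @chart_from_continuous _ _ _ c.
rewrite continuous_open_subspace; last exact: chart_cod_open.
by move=> h cu; apply: h; rewrite inE.
Qed.

End Charts.

Section TopologicalGroup.
Variable G : topGroupType.

Lemma mulgl_continuous (a : G) : continuous (fun x : G => (a * x)%g).
Proof.
move=> x; apply: (@continuous_comp _ _ _ (fun x : G => (a, x)) (fun p : G * G => (p.1 * p.2)%g)).
  by apply: cvg_pair; [apply: cvg_cst|apply: cvg_id].
exact: mulg_continuous.
Qed.

Lemma mulgr_continuous (a : G) : continuous (fun x : G => (x * a)%g).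
Proof.
move=> x; apply: (@continuous_comp _ _ _ (fun x : G => (x, a)) (fun p : G * G => (p.1 * p.2)%g)).
  by apply: cvg_pair; [apply: cvg_id|apply: cvg_cst].
exact: mulg_continuous.
Qed.

End TopologicalGroup.

Section AdjointDifferential.
Variables (R : realType) (n : nat) (G : lieGroupType R n) (c : chart R n G).
Hypotheses (c_atlas : lie_atlas c) (c1 : chart_dom c 1%g).
Local Notation e := (chart_to c 1%g).
Local Notation from := (chart_from c).

Definition conj_chart (a : G) (u : 'rV[R]_n) : 'rV[R]_n :=
  chart_to c (a * from u * a^-1)%g.

Lemma smooth_differentiable (V W : normedModType R) (U : set V) (f : V -> W) x :
  smooth_on U f -> U x -> differentiable f x.
Proof. by move=> [_ /(_ 1)[+ _]] Ux; apply. Qed.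

Lemma smooth_derive_differentiable (V W : normedModType R) (U : set V)
  (f : V -> W) x v : smooth_on U f -> U x -> differentiable ('D_v f) x.
Proof. by move=> [_ /(_ 2)[_ /(_ v)[+ _]]] Ux; apply. Qed.

Lemma smooth_near (V W : normedModType R) (U : set V) (f : V -> W) x :
  smooth_on U f -> U x -> \forall y \near x, U y.
Proof. by move=> [oU _] Ux; apply: open_nbhs_nbhs. Qed.

Lemma from_e : from e = 1%g. Proof. exact: chart_toK. Qed.

Lemma cod_e : chart_cod c e. Proof. exact: chart_codP. Qed.

Lemma conj_chart_e a : conj_chart a e = e.
Proof. by rewrite /conj_chart from_e mulg1 mulgV. Qed.

Lemma conj_from_cvg (a : G) :
  {for e, continuous (fun u => (a * from u * a^-1)%g)}.
Proof.
apply: (@continuous_comp _ _ _ from (fun x : G => (a * x * a^-1)%g)).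
  exact: chart_from_cvg cod_e.
apply: (@continuous_comp _ _ _ (fun x : G => (a * x)%g) (fun x : G => (x * a^-1)%g)).
  exact: mulgl_continuous.
exact: mulgr_continuous.
Qed.

Lemma near_conj_dom (a : G) :
  \forall u \near e, chart_dom c (a * from u * a^-1)%g.
Proof.
apply: (conj_from_cvg (a := a)); rewrite /= from_e mulg1 mulgV.
exact: near_chart_dom.
Qed.

Lemma near_from_conj (a : G) :
  \forall u \near e, from (conj_chart a u) = (a * from u * a^-1)%g.
Proof. by near=> u; rewrite /conj_chart chart_toK //; near: u; apply: near_conj_dom.
Unshelve. all: by end_near. Qed.

(** Charts around [a] and its inverse write conjugation as two smooth multiplications. *)
Lemma differentiable_conj_chart (a : G) : differentiable (conj_chart a) e.
Proof.
have [d d_atlas da] := lie_atlas_cover a.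
have [d' d'_atlas da'] := lie_atlas_cover (a^-1)%g.
have sm1 := lie_mul_smooth _ _ _ d_atlas c_atlas d_atlas.
have sm2 := lie_mul_smooth _ _ _ d_atlas d'_atlas c_atlas.
set U1 := (X in smooth_on X _) in sm1; set m1 := (X in smooth_on _ X) in sm1.
set U2 := (X in smooth_on X _) in sm2; set m2 := (X in smooth_on _ X) in sm2.
have U1e : U1 (chart_to d a, e).
  split; [exact: chart_codP|exact: cod_e|].
  by rewrite /= chart_toK // from_e mulg1.
have m1e : m1 (chart_to d a, e) = chart_to d a.
  by rewrite /m1 /= chart_toK // from_e mulg1.
have U2e : U2 (chart_to d a, chart_to d' (a^-1)%g).
  split; [exact: chart_codP|exact: chart_codP|].
  by rewrite /= !chart_toK // mulgV.
pose f u : 'rV[R]_n * 'rV[R]_n := (m1 (chart_to d a, u), chart_to d' (a^-1)%g).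
have dpe : differentiable (fun u => (chart_to d a, u)) e.
  by apply: differentiable_pair.
have pe := differentiable_continuous dpe.
have [] : is_diff e (conj_chart a) ('d (m2 \o f) e); last by [].
apply: (near_is_diff (f := m2 \o f)).
  have /pe n1 := smooth_near sm1 U1e.
  near=> u; have [/= _ cu du] : U1 (chart_to d a, u) by near: u; apply: n1.
  rewrite /conj_chart /m2 /m1 /=; congr (chart_to c _).
  by move: du; rewrite /= chart_toK // => du; rewrite !chart_toK.
apply: DiffDef => //.
apply: differentiable_comp.
  apply: differentiable_pair; last by [].
  apply: (differentiable_comp dpe).
  exact: (smooth_differentiable sm1).
by apply: (smooth_differentiable sm2); rewrite /f m1e.
Unshelve. all: by end_near. Qed.

Lemma Ad_chartE a v : Ad_chart c a v = 'd (conj_chart a) e v.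
Proof. by rewrite /Ad_chart -deriveE //; apply: differentiable_conj_chart. Qed.

Lemma Ad_chart_linear a : linear (Ad_chart c a).
Proof. by move=> k u v; rewrite !Ad_chartE linearP. Qed.

Lemma Ad_chart1 v : Ad_chart c 1%g v = v.
Proof.
rewrite Ad_chartE.
suff -> : 'd (conj_chart 1%g) e = id :> ('rV[R]_n -> _) by [].
have [] // : is_diff e (conj_chart 1%g) id.
apply: (near_is_diff (f := id)).
near=> u; rewrite /conj_chart mul1g invg1 mulg1 chart_fromK //.
by near: u; apply: near_chart_cod cod_e.
Unshelve. all: by end_near. Qed.

Lemma Ad_chartM a b v : Ad_chart c (a * b)%g v = Ad_chart c a (Ad_chart c b v).
Proof.
rewrite !Ad_chartE.
have da := differentiable_conj_chart a; have db := differentiable_conj_chart b.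
have isd : is_diff e (conj_chart (a * b)%g)
    ('d (conj_chart a) e \o 'd (conj_chart b) e).
  apply: (near_is_diff (f := conj_chart a \o conj_chart b)).
    near=> u; rewrite /= {1}/conj_chart (near (near_from_conj b) u) //.
    by rewrite /conj_chart invgM !mulgA.
  have isa : is_diff e (conj_chart a) ('d (conj_chart a) e) by apply: DiffDef.
  have isb : is_diff e (conj_chart b) ('d (conj_chart b) e) by apply: DiffDef.
  exact: (is_diff_comp_at (conj_chart_e b) isb isa).
exact: (congr1 (fun h : 'rV[R]_n -> 'rV[R]_n => h v) (@diff_val _ _ _ _ _ _ _ isd)).
Unshelve. all: by end_near. Qed.

End AdjointDifferential.

Section AdjointSecondOrder.
Variables (R : realType) (n : nat) (G : lieGroupType R n) (c : chart R n G).
Hypotheses (c_atlas : lie_atlas c) (c1 : chart_dom c 1%g).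
Local Notation e := (chart_to c 1%g).
Local Notation from := (chart_from c).

Definition Ad_at (w u : 'rV[R]_n) : 'rV[R]_n := Ad_chart c (from u) w.

(* The conjugation v |-> u v u^-1 is m(m(u, v), i(u)) in the chart, so its    *)
(* differential at v = 1 is expressed by first partial derivatives of m.      *)
Lemma differentiable_Ad_at (w : 'rV[R]_n) : differentiable (Ad_at w) e.
Proof.
have sm := lie_mul_smooth _ _ _ c_atlas c_atlas c_atlas.
have si := lie_inv_smooth _ _ c_atlas c_atlas.
set U := (X in smooth_on X _) in sm; set m := (X in smooth_on _ X) in sm.
set Ui := (X in smooth_on X _) in si; set i := (X in smooth_on _ X) in si.
have e1 : from e = 1%g := from_e c1.
have ce : chart_cod c e := cod_e c1.
have Uie : Ui e by split=> //; rewrite e1 invg1.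
have ie : i e = e by rewrite /i e1 invg1.
have Uee : U (e, e) by split=> //; rewrite /= e1 mulg1.
have di : differentiable i e by apply: smooth_differentiable si Uie.
have dp1 : differentiable (fun u => (u, e)) e by apply: differentiable_pair.
have dp2 : differentiable (fun u => (u, i u)) e by apply: differentiable_pair.
have nU1 := differentiable_continuous dp1 (smooth_near sm Uee).
have nU2 : \forall u \near e, U (u, i u).
  by apply: (differentiable_continuous dp2); rewrite /= ie; apply: smooth_near sm Uee.
have nUi : \forall u \near e, Ui u by apply: smooth_near si Uie.
have nce : \forall u \near e, chart_cod c u by apply: near_chart_cod.
pose y u : 'rV[R]_n := 'D_((0, w) : 'rV[R]_n * 'rV[R]_n) m (u, e).
pose z k u : 'rV[R]_n :=
  'D_((delta_mx 0 k, 0) : 'rV[R]_n * 'rV[R]_n) m (u, i u).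
pose f : 'rV[R]_n -> 'rV[R]_n := \sum_(k < n) (fun u => y u 0 k *: z k u).
have df : differentiable f e.
  apply: differentiable_sum => k; apply: differentiable_rV_scale.
    apply: (@differentiable_comp _ _ _ _ y (fun N : 'rV[R]_n => N 0 k)).
      apply: (@differentiable_comp _ _ _ _ (fun u => (u, e)) ('D_(0, w) m)) => //.
      exact: smooth_derive_differentiable sm Uee.
    exact: differentiable_coord.
  apply: (@differentiable_comp _ _ _ _ (fun u => (u, i u)) ('D_('e_k, 0) m)) => //.
  by rewrite ie; apply: smooth_derive_differentiable sm Uee.
suff [] : is_diff e (Ad_at w) ('d f e) by [].
have isf : is_diff e f ('d f e) by apply: DiffDef.
apply: (near_is_diff (f := f)).
near=> u.
have cu : chart_cod c u by near: u.
have Ue : U (u, e) by near: u.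
have Ui' : U (u, i u) by near: u.
have iu : Ui u by near: u.
have me : m (u, e) = u by rewrite /m /= e1 mulg1 chart_fromK.
have fromi : from (i u) = (from u)^-1%g by rewrite chart_toK //; case: iu.
pose dm1 : 'rV[R]_n * 'rV[R]_n -> 'rV[R]_n := 'd m (u, e).
pose dm2 : 'rV[R]_n * 'rV[R]_n -> 'rV[R]_n := 'd m (u, i u).
have ism1 : is_diff (u, e) m dm1.
  by apply: DiffDef => //; apply: smooth_differentiable sm Ue.
have ism2 : is_diff (u, i u) m dm2.
  by apply: DiffDef => //; apply: smooth_differentiable sm Ui'.
have isp1 : is_diff e (fun v : 'rV[R]_n => (u, v)) (fun v => (0, v)).
  by apply: is_diff_pair.
have ism1p : is_diff e (fun v => m (u, v)) (fun v => dm1 (0, v)).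
  exact: (is_diff_comp_at erefl isp1 ism1).
have isp2 : is_diff e (fun v => (m (u, v), i u)) (fun v => (dm1 (0, v), 0)).
  by apply: is_diff_pair.
have at2 : (m (u, e), i u) = (u, i u) by rewrite me.
have isc := is_diff_comp_at at2 isp2 ism2.
have isconj : is_diff e (conj_chart c (from u)) (fun v => dm2 (dm1 (0, v), 0)).
  apply: near_is_diff isc; near=> v.
  have Uv : U (u, v).
    near: v; apply: (differentiable_continuous (@ex_diff _ _ _ _ _ _ _ isp1)).
    exact: smooth_near sm Ue.
  rewrite /conj_chart /= {1}/m /= fromi.
  by congr (chart_to c (_ * _)%g); rewrite /m /= chart_toK //; case: Uv.
have -> : Ad_at w u = dm2 (dm1 (0, w), 0).
  rewrite /Ad_at Ad_chartE //.
  exact: (congr1 (fun h : 'rV[R]_n -> 'rV[R]_n => h w) (@diff_val _ _ _ _ _ _ _ isconj)).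
have yE : y u = dm1 (0, w).
  by rewrite /y deriveE //; apply: smooth_differentiable sm Ue.
rewrite -yE {1}[y u]row_sum_delta.
have -> : (\sum_j y u 0 j *: 'e_j, 0) =
    \sum_j y u 0 j *: ('e_j, 0) :> 'rV[R]_n * 'rV[R]_n.
  have pairE (s : seq 'I_n) (F : 'I_n -> 'rV[R]_n) :
      (\sum_(j <- s) F j, 0) = \sum_(j <- s) (F j, 0) :> 'rV[R]_n * 'rV[R]_n.
    elim: s => [|k s IHs]; first by rewrite !big_nil.
    by rewrite !big_cons -IHs; congr pair; rewrite addr0.
  by rewrite pairE; apply: eq_bigr => k _; congr pair; rewrite scaler0.
rewrite /dm2 linear_sum /f fct_sumE; apply: eq_bigr => k _.
rewrite linearZ /= /z deriveE //; exact: smooth_differentiable sm Ui'.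
Unshelve. all: by end_near.
Qed.

Lemma bracket_chartE v w : bracket_chart c v w = 'd (Ad_at w) e v.
Proof. by rewrite /bracket_chart -deriveE //; apply: differentiable_Ad_at. Qed.

(** Both sides come from differentiating, at b = 1 in the direction v, the identity Ad(a b a^-1)
    Ad(a) w = Ad(a) Ad(b) w. *)
Lemma Ad_bracket_chart a v w : Ad_chart c a (bracket_chart c v w) =
  bracket_chart c (Ad_chart c a v) (Ad_chart c a w).
Proof.
pose w' := Ad_chart c a w.
have wE : Ad_chart c a^-1%g w' = w by rewrite -Ad_chartM // mulVg Ad_chart1.
have da := differentiable_conj_chart c_atlas c1 a.
have dA z := differentiable_Ad_at z.
have isa : is_diff e (conj_chart c a) ('d (conj_chart c a) e) by apply: DiffDef.
have isA z : is_diff e (Ad_at z) ('d (Ad_at z) e) by apply: DiffDef.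
have isl : is_diff e (Ad_at w' \o conj_chart c a)
    ('d (Ad_at w') e \o 'd (conj_chart c a) e).
  exact: (is_diff_comp_at (conj_chart_e c1 a) isa (isA w')).
pose L : {linear 'rV[R]_n -> 'rV[R]_n} := 'd (conj_chart c a) e.
have isL x : is_diff x L L.
  have cL : continuous L by apply: diff_continuous.
  apply: DiffDef; first exact: (@linear_differentiable R _ _ L x cL).
  exact: (@diff_lin R _ _ L x cL).
have isr : is_diff e (L \o Ad_at w) (L \o 'd (Ad_at w) e).
  exact: (is_diff_comp_at erefl (isA w) (isL _)).
have isl' : is_diff e (Ad_at w' \o conj_chart c a) (L \o 'd (Ad_at w) e).
  apply: near_is_diff isr; near=> u.
  rewrite /= /Ad_at (near (near_from_conj c1 a) u) // Ad_chartM // wE Ad_chartM //.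
  by rewrite -Ad_chartE // /L.
rewrite !bracket_chartE.
have vE : Ad_chart c a v = L v by apply: Ad_chartE.
have bE : Ad_chart c a ('d (Ad_at w) e v) = L ('d (Ad_at w) e v).
  exact: Ad_chartE.
apply: (etrans bE); apply: (etrans _ (congr1 ('d (Ad_at w') e) (esym vE))).
have E : ('d (Ad_at w') e \o 'd (conj_chart c a) e : 'rV[R]_n -> 'rV[R]_n) =
    L \o 'd (Ad_at w) e.
  exact: (etrans (esym (@diff_val _ _ _ _ _ _ _ isl))
                 (@diff_val _ _ _ _ _ _ _ isl')).
exact: (esym (congr1 (fun h : 'rV[R]_n -> 'rV[R]_n => h v) E)).
Unshelve. all: by end_near.
Qed.

End AdjointSecondOrder.

Section EvaluationCalculus.
Variables (R : realType) (n : nat) (V : normedModType R).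
Variables (f df : 'I_n -> V -> R) (x : V).

Lemma is_diff_meval (p : mpoly n R) :
  (forall i, is_diff x (f i) (df i)) ->
  is_diff x (fun y => meval (f^~ y) p)
    (fun v => \sum_i meval (f^~ x) (mderiv i p) * df i v).
Proof.
move=> dfx.
have ext (h h' dh dh' : V -> R) : h =1 h' -> dh =1 dh' ->
    is_diff x h dh -> is_diff x h' dh' by move=> /funext -> /funext ->.
elim/mpoly_gen_ind: p => [c|j|p q IHp IHq|p q IHp IHq].
- apply: (ext (cst c) _ 0) => [y|v].
    by rewrite mevalC.
  by rewrite big1 // => i _; rewrite mderivC meval0 mul0r.
- apply: (ext (f j) _ (df j)) => [y|v]; first by rewrite mevalXU.
  rewrite (bigD1 j) //= big1 ?addr0 => [|i /negPf ij].
    by rewrite mderivXU eqxx meval1 mul1r.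
  by rewrite mderivXU ij meval0 mul0r.
- apply: ext (is_diffD IHp IHq) => [y|v]; first by rewrite mevalD.
  rewrite -[LHS]big_split; apply: eq_bigr => i _ /=.
  by rewrite mderivD mevalD mulrDl.
- apply: ext (is_diffM IHp IHq) => [y|v]; first by rewrite mevalM.
  rewrite -[LHS]/(_ * _ + _ * _) !mulr_sumr -big_split; apply: eq_bigr => i _ /=.
  by rewrite mderivM mevalD !mevalM; ring.
Qed.

End EvaluationCalculus.

Lemma meval_continuous (R : realType) (n : nat) (T : topologicalType)
    (f : 'I_n -> T -> R) (p : mpoly n R) :
  (forall i, continuous (f i)) -> continuous (fun y => meval (f^~ y) p).
Proof.
move=> cf; elim/mpoly_gen_ind: p => [c|j|p q IHp IHq|p q IHp IHq] y.
- rewrite (_ : (fun y => _) = cst c); first exact: cvg_cst.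
  by apply/funext => z; rewrite mevalC.
- rewrite (_ : (fun y => _) = f j); first exact: cf.
  by apply/funext => z; rewrite mevalXU.
- rewrite (_ : (fun y => _) = (fun y => meval (f^~ y) p) + (fun y => meval (f^~ y) q)).
    by apply: continuousD; [apply: IHp|apply: IHq].
  by apply/funext => z; rewrite mevalD.
- rewrite (_ : (fun y => _) = (fun y => meval (f^~ y) p) * (fun y => meval (f^~ y) q)).
    by apply: continuousM; [apply: IHp|apply: IHq].
  by apply/funext => z; rewrite mevalM.
Qed.

Lemma linear_rV_is_diff (R : realType) n (L : {linear 'rV[R]_n -> R^o}) x :
  is_diff x (L : 'rV[R]_n -> R^o) L.
Proof.
have LE : L = \sum_(k < n) (fun u : 'rV[R]_n => u 0 k *: L (delta_mx 0 k)) :> (_ -> _).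
  apply/funext => u; rewrite fct_sumE {1}[u]row_sum_delta linear_sum.
  by apply: eq_bigr => k _; rewrite linearZ.
have dL y : differentiable (L : 'rV[R]_n -> R^o) y.
  rewrite LE; apply: differentiable_sum => k; apply: differentiableZl.
  exact: differentiable_coord.
apply: DiffDef => //; apply: (@diff_lin R _ _ L x).
by move=> y; apply: differentiable_continuous.
Qed.

(** * Polynomials on a coadjoint orbit *)

Definition vanishes_on (R : realType) (g : vectType R) (O : set 'Hom(g, R^o))
  (f : Sym g) : Prop := forall xi, O xi -> sym_eval f xi = 0.

Section CoadjointOrbit.
Variables (R : realType) (g : vectType R) (br : g -> g -> g).
Hypothesis lieg : is_lie_bracket br.
Variables (G : lieGroupType R (\dim {:g})) (la : lie_algebra_of br G).
Local Notation n := (\dim {:g}).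
Local Notation e := (vbasis {:g}).
Local Notation c := (la_chart la).
Let c_atlas := la_chart_atlas la.
Let c1 := la_chart1 la.

Lemma la_from_linear : linear (la_from la).
Proof.
move=> a u v; apply: (can_inj (la_toK la)).
have lin := linearP (la_to la) a (la_from la u) (la_from la v).
have Eu := la_fromK la u; have Ev := la_fromK la v.
by apply: (etrans (la_fromK la _)); apply: (etrans _ (esym lin)); rewrite Eu Ev.
Qed.

Lemma AdE a x : la_to la (Ad la a x) = Ad_chart c a (la_to la x).
Proof. by rewrite /Ad la_fromK. Qed.

Lemma Ad_linear a : linear (Ad la a).
Proof.
move=> k x y; rewrite /Ad (linearP (la_to la)) (Ad_chart_linear c_atlas c1 a).
exact: la_from_linear.
Qed.

Lemma AdM a b x : Ad la (a * b)%g x = Ad la a (Ad la b x).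
Proof. by rewrite /Ad la_fromK Ad_chartM. Qed.

Lemma Ad1 x : Ad la 1%g x = x.
Proof. by rewrite /Ad Ad_chart1 // la_toK. Qed.

Lemma Ad_br a x y : Ad la a (br x y) = br (Ad la a x) (Ad la a y).
Proof.
apply: (can_inj (la_toK la)).
have E1 := AdE a (br x y); have E2 := la_bracket la x y.
have E3 := la_bracket la (Ad la a x) (Ad la a y).
have Ex := AdE a x; have Ey := AdE a y.
apply: (etrans E1); apply: (etrans (congr1 _ E2)); apply: (etrans _ (esym E3)).
exact: (etrans (Ad_bracket_chart c_atlas c1 a _ _)
  (esym (congr2 (bracket_chart c) Ex Ey))).
Qed.

Lemma coAdE a xi x : coAd la a xi x = xi (Ad la a^-1%g x).
Proof.
pose f : {linear g -> R^o} := HB.pack (fun x => xi (Ad la a^-1%g x) : R^o)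
  (GRing.isLinear.Build _ _ _ _ (fun x => xi (Ad la a^-1%g x) : R^o)
    (fun k u v => etrans (congr1 xi (Ad_linear a^-1%g k u v)) (linearP xi k _ _))).
exact: (lfunE f).
Qed.

Lemma coAdM a b xi : coAd la (a * b)%g xi = coAd la a (coAd la b xi).
Proof. by apply/lfunP => x; rewrite !coAdE invgM AdM. Qed.

Variable O : set 'Hom(g, R^o).
Hypothesis orbO : coadjoint_orbit la O.

Lemma orbit_coAd a xi : O xi -> O (coAd la a xi).
Proof.
have [eta ->] := orbO => -[b _ <-].
by exists (a * b)%g; [exact: I|exact: coAdM].
Qed.

Lemma orbit_trans xi eta : O xi -> O eta -> exists a, eta = coAd la a xi.
Proof.
have [zeta ->] := orbO => -[a _ <-] [b _ <-]; exists (b * a^-1)%g.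
by rewrite -coAdM mulgVK.
Qed.

Lemma orbit_nonempty : exists xi, O xi.
Proof. by have [eta ->] := orbO; exists (coAd la 1%g eta); exists 1%g. Qed.

Lemma Ad_is_diff (xi : 'Hom(g, R^o)) x :
  is_diff (chart_to c 1%g)
    (fun u => xi (Ad la (chart_from c u) x) : R)
    (fun v => xi (la_from la (bracket_chart c v (la_to la x))) : R).
Proof.
have L : linear (fun u => xi (la_from la u)).
  by move=> k u v; rewrite la_from_linear linearP.
pose f : {linear 'rV[R]_n -> R^o} := HB.pack (fun u => xi (la_from la u))
  (GRing.isLinear.Build _ _ _ _ (fun u => xi (la_from la u)) L).
have isA : is_diff (chart_to c 1%g) (Ad_at c (la_to la x))
    ('d (Ad_at c (la_to la x)) (chart_to c 1%g)).
  by apply: DiffDef => //; apply: differentiable_Ad_at.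
have := is_diff_comp_at erefl isA (linear_rV_is_diff f _).
rewrite (_ : f \o 'd _ _ = (fun v => xi (la_from la (bracket_chart c v (la_to la x))))) //.
by apply/funext => v /=; rewrite bracket_chartE.
Qed.

Lemma sym_eval_poisson y f (xi : 'Hom(g, R^o)) :
  sym_eval (poisson br (sym_inj y) f) xi =
    \sum_j sym_eval (mderiv j f) xi * xi (br y e`_j).
Proof.
rewrite /poisson exchange_big /sym_eval raddf_sum; apply: eq_bigr => j _ /=.
rewrite raddf_sum /= [y in RHS](coord_vbasis (memvf y)).
have -> : br (\sum_i coord e i y *: e`_i) e`_j = \sum_i coord e i y *: br e`_i e`_j.
  pose f' : {linear g -> g} := HB.pack (br^~ e`_j)
    (GRing.isLinear.Build _ _ _ _ (br^~ e`_j) (lie_linearl lieg e`_j)).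
  rewrite -[LHS]/(f' _) linear_sum; apply: eq_bigr => i _.
  by rewrite linearZ.
rewrite (linear_sum xi) mulr_sumr; apply: eq_bigr => i _.
rewrite linearZ /= mderiv_sym_inj !mevalM mevalC -[meval _ (sym_inj _)]/(sym_eval _ _).
by rewrite sym_evalX -mulrA mulrCA.
Qed.

(** On the orbit map through [xi] the polynomial [f] is identically zero; by [sym_eval_poisson] its
    derivative at the unit in the direction [y] is the bracket evaluated at [xi]. *)
Lemma vanishes_on_poisson y f : vanishes_on O f ->
  vanishes_on O (poisson br (sym_inj y) f).
Proof.
move=> f0 xi Oxi; rewrite sym_eval_poisson.
have isF := is_diff_meval f (fun i => Ad_is_diff xi e`_i).
have F0 : (fun u => meval (fun i => xi (Ad la (chart_from c u) e`_i) : R) f) = cst 0.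
  apply/funext => u /=.
  have := f0 (coAd la (chart_from c u)^-1%g xi) (orbit_coAd _ Oxi).
  rewrite /sym_eval => <-; apply: meval_eq => i.
  by rewrite coAdE invgK.
rewrite F0 in isF.
have := congr1 (fun h : 'rV[R]_n -> R => h (la_to la y))
  (etrans (esym (@diff_val _ _ _ _ _ _ _ isF)) (diff_cst _ _)).
rewrite /= => E0; rewrite -[RHS]E0; apply: eq_bigr => j _.
congr (_ * _).
  apply: meval_eq => i.
  by rewrite from_e // Ad1.
by rewrite -la_bracket la_toK.
Qed.

Lemma Ad_continuous (xi : 'Hom(g, R^o)) x : continuous (fun a => xi (Ad la a x) : R).
Proof.
have at1 y : {for 1%g, continuous (fun a => xi (Ad la a y) : R)}.
  have ca : {for 1%g, continuous (fun a => xi (Ad la (chart_from c (chart_to c a)) y) : R)}.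
    apply: (@continuous_comp _ _ _ (chart_to c) (fun u => xi (Ad la (chart_from c u) y) : R)).
      exact: chart_to_cvg.
    exact: (differentiable_continuous (@ex_diff _ _ _ _ _ _ _ (Ad_is_diff xi y))).
  have E1 : chart_from c (chart_to c 1%g) = 1%g := from_e c1.
  move: ca; rewrite /prop_for /continuous_at E1.
  apply: cvg_trans; apply: near_eq_cvg; near=> a.
  by rewrite chart_toK //; near: a; apply: near_chart_dom.
move=> a.
have -> : (fun b => xi (Ad la b x) : R) =
    (fun b => xi (Ad la b (Ad la a x)) : R) \o (fun b => (b * a^-1)%g).
  by apply/funext => b /=; rewrite -AdM mulgVK.
apply: (@continuous_comp _ _ _ (fun b => (b * a^-1)%g)); first exact: mulgr_continuous.
by rewrite mulgV; apply: at1.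
Unshelve. all: by end_near. Qed.

(** Pulled back to the connected group the polynomial is continuous with values 0 and 1, so the set
    where it exceeds 1/2 is open and closed. *)
Lemma boolean_on_orbit (k : Sym g) : connected [set: G] ->
  (forall xi, O xi -> sym_eval k xi = 0 \/ sym_eval k xi = 1) ->
  (forall xi, O xi -> sym_eval k xi = 0) \/ (forall xi, O xi -> sym_eval k xi = 1).
Proof.
move=> connG k01; have [xi Oxi] := orbit_nonempty.
pose F a := sym_eval k (coAd la a^-1%g xi).
have FE : F = fun a => meval (fun i => xi (Ad la a e`_i) : R) k.
  by apply/funext => a; apply: meval_eq => i; rewrite coAdE invgK.
have cF : continuous F.
  by rewrite FE; apply: meval_continuous => i; apply: Ad_continuous.
have F01 a : F a = 0 \/ F a = 1 by apply/k01/orbit_coAd.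
have Oall eta : O eta -> exists a, sym_eval k eta = F a.
  by move=> /(orbit_trans Oxi)[a ->]; exists a^-1%g; rewrite /F invgK.
clear FE; clearbody F.
have [[a Fa]|noF] := pselect (exists a, F a = 1); last first.
  left=> eta /Oall[a ->]; have [//|Fa] := F01 a.
  by case: noF; exists a.
right=> eta /Oall[b ->].
suff E : F @^-1` [set x | 1 / 2 < x] = setT.
  have Fb : (F @^-1` [set x | 1 / 2 < x]) b by rewrite E.
  by have [Fb0|//] := F01 b; exfalso; move: Fb; rewrite /= Fb0; lra.
apply: connG.
- by exists a; rewrite /= Fa; lra.
- exists (F @^-1` [set x | 1 / 2 < x]); last by rewrite setTI.
  by apply: open_comp; [move=> ? _; apply: cF|apply: open_gt].
- exists (F @^-1` [set x | 1 / 2 <= x]).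
    by apply: closed_comp; [move=> ? _; apply: cF|apply: closed_ge].
  rewrite setTI; apply/seteqP; split=> z /=; first exact: ltW.
  by case: (F01 z) => ->; lra.
Qed.

Lemma Ad_mx a : exists M : 'M[R]_n, forall x, rVof e (Ad la a x) = rVof e x *m M.
Proof.
pose f : {linear g -> g} := HB.pack (Ad la a)
  (GRing.isLinear.Build _ _ _ _ (Ad la a) (Ad_linear a)).
exists (mxof e e (linfun f)) => x.
by rewrite -(rVof_app _ (vbasisP _)) lfunE.
Qed.

Lemma ad_mx_Ad a : exists M M' : 'M[R]_n,
  M' *m M = 1%:M /\ forall x, ad_mx br (Ad la a x) = M' *m ad_mx br x *m M.
Proof.
have [M ME] := Ad_mx a; have [M' ME'] := Ad_mx a^-1%g.
have rowP (P Q : 'M[R]_n) : (forall x, rVof e x *m P = rVof e x *m Q) -> P = Q.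
  move=> PQ; apply/row_matrixP => i; rewrite !rowE.
  by rewrite -(vecofK (vbasisP {:g}) (delta_mx 0 i)).
have AdK y : Ad la a (Ad la a^-1%g y) = y by rewrite -AdM mulgV Ad1.
exists M, M'; split; first by apply: rowP => x; rewrite mulmxA -ME' -ME AdK mulmx1.
move=> x; apply: rowP => y.
by rewrite -rVof_br // !mulmxA -ME' -rVof_br // -ME Ad_br AdK.
Qed.

(** [Ad a] is an automorphism: it conjugates [ad x] and preserves the Killing form. One annihilating
    polynomial thus serves the whole orbit. *)
Lemma orbit_killing_transport xi0 x0 : O xi0 ->
    (forall y, xi0 y = killing br x0 y) ->
  forall xi, O xi -> exists x, (forall y, xi y = killing br x y) /\
    forall q, polymx (ad_mx br x0) q = 0 -> polymx (ad_mx br x) q = 0.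
Proof.
move=> O0 xi0E xi /(orbit_trans O0)[a ->]; exists (Ad la a x0).
have [M [M' [MM adE]]] := ad_mx_Ad a; have MM' := mulmx1C MM.
have AdK y : Ad la a (Ad la a^-1%g y) = y by rewrite -AdM mulgV Ad1.
have trE (X Y : 'M[R]_n) : \tr (M' *m X *m M *m (M' *m Y *m M)) = \tr (X *m Y).
  rewrite mxtrace_mulC !mulmxA -(mulmxA _ M) MM' mulmx1.
  by rewrite mxtrace_mulC !mulmxA MM' mul1mx mxtrace_mulC.
have killE z y : killing br (Ad la a z) (Ad la a y) = killing br z y.
  exact: (etrans (congr2 (fun P Q => \tr (P *m Q)) (adE z) (adE y)) (trE _ _)).
split=> [y|q q0].
  rewrite coAdE xi0E; apply: (etrans (esym (killE _ _))).
  by congr (killing br _ _); apply: AdK.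
rewrite adE.
suff -> : polymx (M' *m ad_mx br x0 *m M) q = M' *m polymx (ad_mx br x0) q *m M.
  by rewrite q0 mulmx0 mul0mx.
elim/poly_ind: q {q0} => [|q k IHq]; first by rewrite !polymx0 mulmx0 mul0mx.
rewrite !polymxD !polymxM !polymxX !polymxC IHq mulmxDr mulmxDl; congr (_ + _).
  by rewrite !mulmxA -(mulmxA _ M) MM' mulmx1.
by rewrite mul_mx_scalar -scalemxAl MM scalemx1.
Qed.

End CoadjointOrbit.

(** * Essential simplicity *)

Lemma diagonalizable_annihilator (R : realType) n (M : 'M[R]_n) :
  diagonalizable (map_mx (real_complex R) M) ->
  exists q1 al be : {poly R}, [/\ polymx M ('X * q1) = 0, q1.[0] != 0 &
    al * ('X * q1) + be * ('X * q1)^`() = 1].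
Proof.
(* In size zero the annihilating polynomial is ['X]. *)
case: n M => [|n] M dM.
  exists 1, 0, 1; rewrite mulr1 mul0r mul1r derivX add0r hornerC oner_eq0.
  by split=> //; rewrite [LHS]flatmx0.
have sp : separable_poly (mxminpoly M).
  rewrite -(separable_map (real_complex R)) -mxminpoly_map.
  have /diagonalizableP[rs urs mE] := dM.
  by rewrite -separable_prod_XsubC in urs; apply: dvdp_separable urs.
have [q1 [al [be [mq q10 bez]]]] := separable_mulX (monic_neq0 (mxminpoly_monic M)) sp.
exists q1, al, be; split=> //; rewrite polymxE; apply/eqP.
by rewrite -dvd_mxminpoly.
Qed.

Section PoissonCoordinates.
Variables (R : realType) (g : vectType R) (br : g -> g -> g).
Hypothesis lieg : is_lie_bracket br.
Local Notation n := (\dim {:g}).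
Local Notation e := (vbasis {:g}).
Local Notation A := (struct_mx br).
Local Notation "{{ f , h }}" := (poisson br f h).

Lemma sym_inj_struct (i j : 'I_n) : sym_inj (br e`_i e`_j) = struct_poly A i j.
Proof.
apply: eq_bigr => k _; congr (_ *: _).
have eE : delta_mx 0 j = rVof e e`_j by rewrite rVofE // vbasisP.
have /rowP/(_ k) := rVof_br lieg e`_i e`_j.
by rewrite -eE -rowE !mxE.
Qed.

Lemma poissonE f h : {{f, h}} = \sum_i mderiv i f * ham A i h.
Proof.
apply: eq_bigr => i _; rewrite /ham mulr_sumr; apply: eq_bigr => j _.
by rewrite sym_inj_struct mulrA.
Qed.

Lemma poisson_ham (i : 'I_n) h : {{sym_inj e`_i, h}} = ham A i h.
Proof.
rewrite poissonE (bigD1 i) //= big1 => [|j /negPf ji].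
  by rewrite sym_inj_basis mderivXU eqxx mul1r addr0.
by rewrite sym_inj_basis mderivXU ?ji 1?eq_sym ?ji mul0r.
Qed.

Lemma poissonDr f h1 h2 : {{f, h1 + h2}} = {{f, h1}} + {{f, h2}}.
Proof. by rewrite !poissonE -big_split; apply: eq_bigr => i _; rewrite hamD mulrDr. Qed.

Lemma poissonDl f1 f2 h : {{f1 + f2, h}} = {{f1, h}} + {{f2, h}}.
Proof.
by rewrite !poissonE -big_split; apply: eq_bigr => i _; rewrite mderivD mulrDl.
Qed.

Lemma poissonNl f h : {{- f, h}} = - {{f, h}}.
Proof. by rewrite !poissonE -sumrN; apply: eq_bigr => i _; rewrite mderivN mulNr. Qed.

Lemma poissonMr f h1 h2 : {{f, h1 * h2}} = h1 * {{f, h2}} + {{f, h1}} * h2.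
Proof.
by rewrite !(poissonC _ f) // poissonMl opprD mulrN mulNr.
Qed.

Variable O : set 'Hom(g, R^o).

Definition basis_values (p : 'I_n -> R) : Prop :=
  exists2 xi, O xi & p = fun i => xi e`_i.

Lemma vanish_basis_values f : vanish basis_values f <-> vanishes_on O f.
Proof.
split=> f0 xi; last by move=> [eta Oeta ->]; apply: f0.
by move=> Oxi; apply: f0; exists xi.
Qed.

Lemma pt_vec_killing (xi : 'Hom(g, R^o)) x : killing_mx A \in unitmx ->
  (forall y, xi y = killing br x y) -> pt_vec A (fun i => xi e`_i) = rVof e x.
Proof.
move=> Ku xiE; have KT : (killing_mx A)^T = killing_mx A.
  by apply/matrixP => i j; rewrite !mxE mxtrace_mulC.
rewrite /pt_vec; suff -> : \row_k (xi e`_k : R) = rVof e x *m killing_mx A.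
  by rewrite mulmxK.
apply/rowP => k; rewrite mxE xiE killingE //.
have <- : delta_mx 0 k = rVof e e`_k by rewrite rVofE // vbasisP.
by rewrite trmx_delta -colE mxE.
Qed.

Hypothesis vanish_poisson : forall y f, vanishes_on O f ->
  vanishes_on O {{sym_inj y, f}}.

Lemma vanishes_poissonr f h : vanishes_on O h -> vanishes_on O {{f, h}}.
Proof.
move=> h0 xi Oxi; rewrite poissonE /sym_eval raddf_sum big1 // => i _ /=.
rewrite mevalM -poisson_ham -[X in _ * X]/(sym_eval _ _).
by rewrite (vanish_poisson e`_i h0 Oxi) mulr0.
Qed.

Lemma vanishes_poissonl f h : vanishes_on O f -> vanishes_on O {{f, h}}.
Proof.
move=> f0 xi Oxi; rewrite poissonC // /sym_eval mevalN.
by rewrite -[meval _ _]/(sym_eval _ _) (vanishes_poissonr h f0 Oxi) oppr0.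
Qed.

Local Notation to := (@to_orbit_poly R g O).

Lemma to_orbit_poly_eq f h : to f = to h <-> vanishes_on O (f - h).
Proof.
split=> [E xi Oxi|v].
  have := congr1 (fun F : orbit_poly O => F (SigSub (mem_set Oxi))) E.
  by rewrite /= /sym_restrict /= /sym_eval mevalB => ->; rewrite subrr.
apply: val_inj; apply/funext => xi /=; apply/eqP; rewrite -subr_eq0.
by rewrite /sym_restrict /sym_eval -mevalB; apply/eqP/v/set_valP.
Qed.

Lemma to_orbit_poly0 : to 0 = 0.
Proof. by apply: val_inj; apply/funext => xi; exact: meval0. Qed.

Lemma to_orbit_poly_is_linear a f h : to (a *: f + h) = a *: to f + to h.
Proof.
apply: val_inj; apply/funext => xi.
by rewrite /= /sym_restrict /sym_eval mevalD mevalZ.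
Qed.

Lemma orbit_liftK F : to (orbit_lift F) = F.
Proof.
apply: val_inj; rewrite /= /orbit_lift; case: cid => f /= E.
by rewrite E.
Qed.

(** The choice of lifts is immaterial, as the polynomials vanishing on [O] form a Poisson ideal. *)
Lemma orbit_poissonE f h : orbit_poisson br (to f) (to h) = to {{f, h}}.
Proof.
apply/to_orbit_poly_eq => xi Oxi; set f' := orbit_lift _; set h' := orbit_lift _.
have vf : vanishes_on O (f' - f) by apply/to_orbit_poly_eq; rewrite orbit_liftK.
have vh : vanishes_on O (h' - h) by apply/to_orbit_poly_eq; rewrite orbit_liftK.
have -> : {{f', h'}} - {{f, h}} = {{f' - f, h'}} + {{f, h' - h}}.
  rewrite poissonDl poissonNl poissonDr [{{f, - h}}]poissonC // poissonNl opprK.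
  by rewrite [{{h, f}}]poissonC //; ring.
by rewrite /sym_eval mevalD; rewrite [X in X + _](vanishes_poissonl h' vf Oxi)
  [X in _ + X](vanishes_poissonr f vh Oxi) addr0.
Qed.

End PoissonCoordinates.

Section LieIdeals.
Variables (R : realType) (g : vectType R) (br : g -> g -> g).
Hypothesis lieg : is_lie_bracket br.
Local Notation n := (\dim {:g}).
Local Notation e := (vbasis {:g}).
Local Notation A := (struct_mx br).
Local Notation "{{ f , h }}" := (poisson br f h).
Variable O : set 'Hom(g, R^o).
Hypothesis vanish_poisson : forall y f, vanishes_on O f ->
  vanishes_on O {{sym_inj y, f}}.
Local Notation to := (@to_orbit_poly R g O).

(* For a Lie ideal I of a Poisson algebra, J = {f | {f, -} in I} is a          *)
(* subalgebra containing I, and {f | f h in J for all h} is a Poisson ideal,  *)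
(* which contains {I, I}.                                                     *)
Lemma poisson_simple_essentially_simple :
  (forall K : Sym g -> Prop, is_ideal K -> (forall f, vanishes_on O f -> K f) ->
     (forall i f, K f -> K (ham A i f)) -> K `<=` vanishes_on O \/ K 1) ->
  essentially_simple (@orbit_poisson R g O br).
Proof.
move=> simple I [subI idI].
have [I0 IZD] := subI.
pose I' f := I (to f); pose J f := forall h, I' {{f, h}}.
pose K f := forall h, J (f * h).
have IB f h : I' f -> I' h -> I' (f - h).
  rewrite /I' -scaleN1r addrC to_orbit_poly_is_linear => If Ih.
  exact: IZD.
have IN f : I' f -> I' (- f).
  rewrite -[- f]add0r => If; apply: IB => //; rewrite /I'.
  by rewrite to_orbit_poly0.
have ID f h : I' f -> I' h -> I' (f + h).
  by move=> If Ih; rewrite -[h]opprK; apply: IB => //; apply: IN.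
have Ipois h f : I' f -> I' {{h, f}}.
  by move=> If; rewrite /I' -orbit_poissonE //; apply: idI.
have Ipois' h f : I' f -> I' {{f, h}}.
  by move=> If; rewrite poissonC //; apply/IN/Ipois.
have Iv f : vanishes_on O f -> I' f.
  move=> f0; rewrite /I'; have -> : to f = to 0; last by rewrite to_orbit_poly0.
  by apply/to_orbit_poly_eq; rewrite subr0.
have IJ f : I' f -> J f by move=> If h; apply: Ipois'.
have JB f h : J f -> J h -> J (f - h).
  by move=> Jf Jh k; rewrite (poissonDl lieg) (poissonNl lieg); apply: IB.
have JM f h : J f -> J h -> J (f * h).
  move=> Jf Jh k; have -> : {{f * h, k}} = {{f, h * k}} + {{h, f * k}}.
    by rewrite poissonMl !(poissonMr lieg) (poissonC f h lieg); ring.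
  exact: ID.
have JJK a b : I' a -> I' b -> K {{a, b}}.
  move=> Ia Ib c; have -> : {{a, b}} * c = {{a, b * c}} - b * {{a, c}}.
    by rewrite (poissonMr lieg); ring.
  apply: JB; first exact/IJ/Ipois'.
  by apply: JM; apply: IJ => //; apply: Ipois'.
have idK : is_ideal K.
  split.
  - by move=> h k; rewrite mul0r; apply: Ipois'; rewrite /I' to_orbit_poly0.
  - move=> f h Kf Kh k l; rewrite mulrDl (poissonDl lieg); apply: ID.
      exact: Kf.
    exact: Kh.
  - by move=> a f Kf h; rewrite (mulrC a) -mulrA; apply: Kf.
have vK f : vanishes_on O f -> K f.
  move=> f0 h; apply/IJ/Iv => xi Oxi; rewrite /sym_eval mevalM.
  by rewrite [X in X * _](f0 xi Oxi) mul0r.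
have hamK i f : K f -> K (ham A i f).
  move=> Kf h; rewrite -(poisson_ham lieg); set x := sym_inj _.
  have -> : {{x, f}} * h = {{x, f * h}} - f * {{x, h}}.
    by rewrite (poissonMr lieg); ring.
  apply: JB; last exact: Kf.
  by rewrite poissonC //; apply/IJ/IN; apply: Kf.
(* If 1 is in [K], then [J] is everything and [I] contains all brackets. *)
have [Kvan|K1] := simple K idK vK hamK; last first.
  right; apply: linear_span_min => // _ [F _ [H _ <-]].
  rewrite -(orbit_liftK F) -(orbit_liftK H) orbit_poissonE //.
  by have := K1 (orbit_lift F) (orbit_lift H); rewrite mul1r.
left=> F; rewrite -(orbit_liftK F); set a := orbit_lift F => Ia H.
rewrite -(orbit_liftK H); set c := orbit_lift H; rewrite orbit_poissonE //.
have vaa d : vanishes_on O {{a, {{a, d}}}}.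
  by apply: Kvan; apply: JJK => //; apply: Ipois'.
suff v : vanishes_on O {{a, c}}.
  by rewrite -to_orbit_poly0; apply/to_orbit_poly_eq; rewrite subr0.
move=> xi Oxi.
(* Both {a, {a, c * c}} and {a, {a, c}} vanish on [O], which leaves twice the square of {a, c}. *)
have E : {{a, {{a, c * c}}}} = c * {{a, {{a, c}}}} *+ 2 + {{a, c}} ^+ 2 *+ 2.
  by rewrite !(poissonMr lieg) (poissonDr lieg) !(poissonMr lieg); ring.
have := vaa (c * c) xi Oxi; rewrite E /sym_eval mevalD mevalMn mevalM.
rewrite [X in _ * X](vaa c xi Oxi) mulr0 mul0rn add0r mevalMn.
by move=> /eqP; rewrite mulrn_eq0 /= rmorphXn expf_eq0 /= => /eqP.
Qed.

End LieIdeals.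

(** * From semisimple orbits to essential simplicity *)

Section Semisimple.
Variables (R : realType) (g : vectType R) (br : g -> g -> g).
Hypotheses (lieg : is_lie_bracket br) (ssg : lie_semisimple br).
Variables (G : lieGroupType R (\dim {:g})) (la : lie_algebra_of br G).
Hypothesis connG : connected [set: G].
Variable O : set 'Hom(g, R^o).
Hypothesis orbO : coadjoint_orbit la O.

Lemma semisimple_orbit_essentially_simple :
  semisimple_orbit br O -> essentially_simple (@orbit_poisson R g O br).
Proof.
move=> ssO; have vp := vanishes_on_poisson lieg orbO.
have Ku := killing_mx_unit lieg ssg; have LA := lie_structure_struct_mx lieg.
apply: poisson_simple_essentially_simple => // K idK vK hamK.
have [xi0 Oxi0] := orbit_nonempty orbO.
have [x0 xi0E dx0] := ssO xi0 Oxi0.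
have [q1 [al [be [q0 q10 bez]]]] := diagonalizable_annihilator dx0.
have [K1|nK1] := pselect (K 1); [by right|left=> f Kf].
have [] // := @poisson_ideal_trivial R _ _ LA Ku (basis_values O) _ _
  ('X * q1) q1 al be erefl q10 bez _ K idK _ hamK f Kf.
- move=> i h /vanish_basis_values vh; apply/vanish_basis_values.
  by rewrite -(poisson_ham lieg); apply: vp.
- move=> k k01.
  have [xi Oxi||] := boolean_on_orbit orbO (k := k) connG.
      by apply: k01; exists xi.
    by move=> k0; left=> _ [xi Oxi ->]; apply: k0.
  by move=> k1; right=> _ [xi Oxi ->]; apply: k1.
- move=> _ [xi Oxi ->].
  have [x [xiE xq]] := orbit_killing_transport lieg orbO Oxi0 xi0E Oxi.
  by rewrite (pt_vec_killing lieg Ku xiE) -ad_mxE //; apply: xq.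
- by move=> h /vanish_basis_values; apply: vK.
- by move=> /vanish_basis_values.
Qed.

End Semisimple.

Lemma annihilator_diagonalizable (R : realType) n (M : 'M[R]_n) (q : {poly R}) :
  separable_poly q -> polymx M q = 0 -> diagonalizable (map_mx (real_complex R) M).
Proof.
case: n M => [|n] M sq Mq.
  exists 1%:M; first exact: unitmx1.
  by apply/is_diag_mxP; case.
apply/diagonalizableP.
have sp : separable_poly (mxminpoly (map_mx (real_complex R) M)).
  rewrite mxminpoly_map separable_map; apply: dvdp_separable sq.
  by rewrite dvd_mxminpoly -polymxE Mq.
have [rs rsE] := closed_field_poly_normal (mxminpoly (map_mx (real_complex R) M)).
move: rsE; rewrite (monicP (mxminpoly_monic _)) scale1r => rsE.
exists rs; last by rewrite -rsE.
by rewrite -separable_prod_XsubC -rsE.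
Qed.

(** * From essential simplicity to semisimple orbits *)

Section Necessity.
Variables (R : realType) (g : vectType R) (br : g -> g -> g).
Hypotheses (lieg : is_lie_bracket br) (ssg : lie_semisimple br).
Local Notation n := (\dim {:g}).
Local Notation e := (vbasis {:g}).
Local Notation A := (struct_mx br).
Variable O : set 'Hom(g, R^o).
Hypothesis vanish_poisson : forall y f, vanishes_on O f ->
  vanishes_on O (poisson br (sym_inj y) f).
Local Notation to := (@to_orbit_poly R g O).

(** The ideal of [jordan_core] induces a Lie ideal [I] of P(O). Whether [I] is central or contains
    the derived ideal, the separable [q] annihilates [ad x]. *)
Lemma essentially_simple_semisimple_orbit :
  essentially_simple (@orbit_poisson R g O br) -> semisimple_orbit br O.
Proof.
move=> simple xi Oxi.
have Ku := killing_mx_unit lieg ssg; have LA := lie_structure_struct_mx lieg.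
pose p i := xi e`_(i : 'I_n) : R; pose x := vecof e (pt_vec A p).
have xE : rVof e x = pt_vec A p by rewrite vecofK // vbasisP.
have adx : ad_mx br x = adm A (pt_vec A p) by rewrite ad_mxE // xE.
exists x.
  move=> y; rewrite killingE // xE /pt_vec mulmxKV // mxE.
  rewrite {1}(coord_vbasis (memvf y)) linear_sum; apply: eq_bigr => i _.
  by rewrite linearZ /= !mxE mulrC.
have [q [q0 sq qroots]] :=
  separable_multiple (monic_neq0 (char_poly_monic (adm A (pt_vec A p)))).
apply: (annihilator_diagonalizable sq); rewrite adx.
have vham i h : vanish (basis_values O) h -> vanish (basis_values O) (ham A i h).
  move=> /vanish_basis_values vh; apply/vanish_basis_values.
  by rewrite -(poisson_ham lieg); apply: vanish_poisson.
have Op : basis_values O p by exists xi.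
have [J [idJ hamJ vJ Jder Jprod]] :=
  jordan_core LA Ku vham Op (qroots _ (real_complex R)).
pose I F := exists2 h, J h & F = to h.
have Jpois h1 h2 : J h2 -> J (poisson br h1 h2).
  move=> Jh; rewrite (poissonE lieg); apply: (ideal_sum idJ) => i _.
  by apply: (idealMl idJ); apply: hamJ.
have idI : lie_ideal (orbit_poisson br (O := O)) I.
  split=> [|F _ [h Jh ->]].
    split; first by exists 0; [exact: ideal0 idJ|rewrite to_orbit_poly0].
    move=> a _ _ [h1 J1 ->] [h2 J2 ->]; exists (a *: h1 + h2).
      by rewrite -mul_mpolyC; apply: (idealD idJ) => //; apply: (idealMl idJ).
    by rewrite to_orbit_poly_is_linear.
  rewrite -(orbit_liftK F) orbit_poissonE //.
  by exists (poisson br (orbit_lift F) h) => //; apply: Jpois.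
have [Icen|Ider] := simple I idI.
  apply: central_annihilator => // a b c d i.
  set h := _ * _; have Ih : I (to h) by exists h => //; apply: Jprod.
  have := Icen _ Ih (to (sym_inj e`_i)); rewrite orbit_poissonE //.
  rewrite -to_orbit_poly0 => /to_orbit_poly_eq/(_ xi Oxi); rewrite subr0 poissonC // poisson_ham //.
  by rewrite /sym_eval mevalN => /eqP; rewrite oppr_eq0 => /eqP.
(* The bracket of two coordinates agrees on [O] with a member of [J], and [J] contains everything
   that vanishes on [O]. *)
apply: Jder => i j; rewrite -sym_inj_struct // -(poisson_sym_inj _ _ lieg).
set h := poisson _ _ _.
have [h' Jh' hh'] : I (to h).
  apply: Ider; apply: sub_linear_span; rewrite -orbit_poissonE //.
  by exists (to (sym_inj e`_i)) => //; exists (to (sym_inj e`_j)).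
rewrite -(subrK h' h); apply: (idealD idJ) => //.
by apply/vJ/vanish_basis_values/to_orbit_poly_eq.
Qed.

End Necessity.

Theorem theorem4 (R : realType) (g : vectType R) (br : g -> g -> g)
  (br_lie : is_lie_bracket br) (g_semisimple : lie_semisimple br)
  (G : lieGroupType R (\dim {:g})) (G_1connected : one_connected R G)
  (la : lie_algebra_of br G)
  (O : set 'Hom(g, R^o)) (O_orbit : coadjoint_orbit la O) :
  essentially_simple (@orbit_poisson R g O br) <-> semisimple_orbit br O.
Proof.
split; first exact/essentially_simple_semisimple_orbit/vanishes_on_poisson/O_orbit.
exact: (semisimple_orbit_essentially_simple br_lie g_semisimple G_1connected.1 O_orbit).
Qed.
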